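(* Let $E_h,S_h,T_h\in\mathbb{V}_h^k$ be the numerical solutions of the semi-discrete DG method: for all $\varphi,\psi,\phi\in\mathbb{V}_h^k$ and all cells $I_i\times J_j$, $$\int_{J_j}\int_{I_i}dE_h\,\varphi\,dx\,dy=-\int_{J_j}\mathcal{A}_{I_i}(T_h,\varphi;\alpha_1)\,dy\,dt+\int_{I_i}\mathcal{A}_{J_j}(S_h,\varphi;-\alpha_2)\,dx\,dt-\int_{J_j}\int_{I_i}\lambda_1\varphi\,dW_t\,dx\,dy,$$ $$\int_{J_j}\int_{I_i}dS_h\,\psi\,dx\,dy=\int_{I_i}\mathcal{A}_{J_j}(E_h,\psi;\alpha_2)\,dx\,dt+\int_{J_j}\int_{I_i}\lambda_2\psi\,dW_t\,dx\,dy,$$ $$\int_{J_j}\int_{I_i}dT_h\,\phi\,dx\,dy=-\int_{J_j}\mathcal{A}_{I_i}(E_h,\phi;-\alpha_1)\,dy\,dt+\int_{J_j}\int_{I_i}\lambda_2\phi\,dW_t\,dx\,dy,$$ with $\alpha_1,\alpha_2\in\mathbb{R}$, under periodic boundary conditions. (a) For any $t\in[0,T]$, the numerical solutions satisfy the discrete energy law $$\|E_h(\omega,x,y,t)\|^2+\|S_h(\omega,x,y,t)\|^2+\|T_h(\omega,x,y,t)\|^2=2\int_0^t\int_J\int_I\big(\lambda_2(T_h+S_h)-\lambda_1E_h\big)\,dW_s\,dx\,dy$$ $$\qquad+\|E_h(x,y,0)\|^2+\|S_h(x,y,0)\|^2+\|T_h(x,y,0)\|^2+(\lambda_1^2+2\lambda_2^2)Kt$$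 and $$\mathbb{E}\Big(\|E_h(x,y,t)\|^2+\|S_h(x,y,t)\|^2+\|T_h(x,y,t)\|^2\Big)=\|E_h(x,y,0)\|^2+\|S_h(x,y,0)\|^2+\|T_h(x,y,0)\|^2+(\lambda_1^2+2\lambda_2^2)Kt,$$ with $$K=\sum_{i,j}\sum_{l=0}^{k^2+2k}\mu_{i,j}^l\sum_{m=1}^\infty\Big(\int_{J_j}\int_{I_i}\phi_{i,j}^l\sqrt{\gamma_m}\,e_m\,dx\,dy\Big)^2,$$ where $\{\phi_{i,j}^l:\ l=0,\dots,k^2+2k\}$ is the (orthogonal, tensor-product) Legendre basis over the cell $I_i\times J_j$ and $\mu_{i,j}^l=\big(\int_{J_j}\int_{I_i}(\phi_{i,j}^l)^2\,dx\,dy\big)^{-1}$. (b) The constant $K$ is bounded by $(k^2+2k)\,\mathrm{Tr}(Q)$, with $k$ the polynomial degree of the DG method. Moreover, if there exists some constant $\alpha>0$ such that $\sum_{m=1}^\infty\gamma_m(K_m)^\alpha<\infty$ with $K_m=\|\nabla e_m\|_\infty$, then $K=\mathrm{Tr}(Q)+O(h^\alpha)$; that is, $K$ is an approximation of the $\mathrm{Tr}(Q)$ appearing in the continuous energy law $$\mathcal{E}(t)=\mathcal{E}(0)+2\int_0^t\int_J\int_I\big(\lambda_2(S+T)-\lambda_1E\big)\,dW_s\,dx\,dy+(\lambda_1^2+2\lambda_2^2)\mathrm{Tr}(Q)\,t,\qquad \mathbb{E}(\mathcal{E}(t))=\mathcal{E}(0)+(\lambda_1^2+2\lambda_2^2)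\mathrm{Tr}(Q)\,t.$$
   Context: The method discretizes the two-dimensional stochastic Maxwell equations $-dE+T_x\,dt-S_y\,dt=\lambda_1dW_t$, $dS+E_y\,dt=\lambda_2dW_t$, $dT-E_x\,dt=\lambda_2dW_t$ on a bounded rectangle $I\times J$, with constants $\lambda_1,\lambda_2\in\mathbb{R}$; the energy of the exact solution $(E,S,T)$ with periodic boundary conditions is $\mathcal{E}(t)=\int_J\int_I(E^2+S^2+T^2)\,dx\,dy$. The rectangle is partitioned into cells $I_i\times J_j=[x_{i-\frac12},x_{i+\frac12}]\times[y_{j-\frac12},y_{j+\frac12}]$, $i=1,\dots,N_x$, $j=1,\dots,N_y$; $h$ is the maximum of all $x_{i+\frac12}-x_{i-\frac12}$ and $y_{j+\frac12}-y_{j-\frac12}$. $\mathbb{V}_h^k=\{v:v|_{I_i\times J_j}\in Q^k(I_i\times J_j)=P^k(I_i)\otimes P^k(J_j)\ \forall i,j\}$, with $P^k$ the polynomials of degree at most $k$. At a cell interface, $g^+,g^-$ are the limits from the right (resp. top) and from the left (resp. bottom), $\{g\}=\frac12(g^++g^-)$, $[g]=g^+-g^-$, and, for a flux parameter $a\in\mathbb{R}$, $\widetilde{g_a}=\{g\}+a[g]$; traces on the boundary of $I\times J$ are defined by periodicity. Moreover $$\mathcal{A}_{I_i}(f,g;a)=\int_{I_i}fg_x\,dx-(\widetilde{f_a}g^-)_{i+\frac12,y}+(\widetilde{f_a}g^+)_{i-\frac12,y},$$ $$\mathcal{A}_{J_j}(f,g;a)=\int_{J_j}fg_y\,dy-(\widetilde{f_a}g^-)_{x,j+\frac12}+(\widetilde{f_a}g^+)_{x,j-\frac12}.$$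 $\|\cdot\|$ is the $L^2(I\times J)$ norm. $W_t=\sum_{m\ge1}\sqrt{\gamma_m}\,e_m(x,y)\mathcal{B}_m(t,\omega)$ is a $Q$-Wiener process on $(\Omega,\mathcal{F},\mathbb{P})$, with $\{e_m\}$ an orthonormal basis of $L^2(I\times J)$, $Q$ symmetric non-negative, $Qe_m=\gamma_me_m$, $\mathrm{Tr}(Q)=\sum_m\gamma_m<\infty$, and $\mathcal{B}_m$ independent standard Brownian motions. Stochastic differentials are in the Itô sense and $\int_0^t\int_J\int_If\,dW_s\,dx\,dy=\sum_m\sqrt{\gamma_m}\int_0^t(\int_J\int_Ife_m\,dx\,dy)\,d\mathcal{B}_m(s)$. The initial data are deterministic. $O(h^\alpha)$ refers to $h\to0$, with constant independent of $h$.
   Formalization: The bound K ≤ (k²+2k)Tr(Q) is stated for k ≥ 1 (it fails for k = 0); K = Tr(Q) + O(h^min(α,2)) replaces O(h^α), which is false for α > 2; ∇e_m is the classical gradient, assumed to exist at every interior point. *)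

(* Defs.v *)
From HB Require Import structures.
From mathcomp Require Import all_boot all_order all_algebra.
From mathcomp Require Import all_classical all_reals all_analysis.

Set Implicit Arguments.
Unset Strict Implicit.
Unset Printing Implicit Defensive.

Import Order.TTheory GRing.Theory Num.Theory.
Import numFieldNormedType.Exports.

Local Open Scope classical_set_scope.
Local Open Scope ring_scope.

Record rectangle (R : realType) := Rectangle {
  xlo : R; xhi : R; ylo : R; yhi : R;
  xlo_lt_xhi : xlo < xhi;
  ylo_lt_yhi : ylo < yhi }.

Section L2.
Context {R : realType}.
Implicit Types (X Y : set R) (f g : R -> R -> R) (D : rectangle R).

Definition leb2 := (@lebesgue_measure R \x @lebesgue_measure R)%E.

Definition int2 X Y f : R := \int[leb2]_(z in X `*` Y) f z.1 z.2.

Definition xside D : set R := `[xlo D, xhi D].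
Definition yside D : set R := `[ylo D, yhi D].
Definition domain D : set (R * R) := xside D `*` yside D.

Definition inL2 D f : Prop :=
  measurable_fun (domain D) (fun z : R * R => f z.1 z.2) /\
  (\int[leb2]_(z in domain D) ((f z.1 z.2) ^+ 2)%:E < +oo)%E.

Definition inner D f g : R := int2 (xside D) (yside D) (fun x y => f x y * g x y).

Definition L2norm D f : R := Num.sqrt (inner D f f).

Definition ae_eq2 D f g : Prop :=
  {ae leb2, forall z, domain D z -> f z.1 z.2 = g z.1 z.2}.

Definition orthonormal_basis D (e : nat -> R -> R -> R) : Prop :=
  [/\ forall m, inL2 D (e m),
      forall m n, inner D (e m) (e n) = (m == n)%:R &
      forall f, inL2 D f ->
        L2norm D (fun x y => f x y - \sum_(m < n) inner D f (e m) * e m x y)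
          @[n --> \oo] --> (0 : R)].

(* An operator on L2, presented on representatives. *)
Record symmetric_nonneg_operator D (Q : (R -> R -> R) -> R -> R -> R) : Prop := {
  op_inL2 : forall f, inL2 D f -> inL2 D (Q f);
  op_linear : forall (a : R) f g, inL2 D f -> inL2 D g ->
    ae_eq2 D (Q (fun x y => a * f x y + g x y))
             (fun x y => a * Q f x y + Q g x y);
  op_symmetric : forall f g, inL2 D f -> inL2 D g ->
    inner D (Q f) g = inner D f (Q g);
  op_nonneg : forall f, inL2 D f -> 0 <= inner D (Q f) f }.

Definition has_partials D f : Prop :=
  forall x y, x \in `]xlo D, xhi D[ -> y \in `]ylo D, yhi D[ ->
    derivable (fun x' => f x' y) x 1 /\ derivable (f x) y 1.

Definition sup_grad D f : \bar R :=
  ereal_sup [set r | exists x y,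
    [/\ x \in `]xlo D, xhi D[, y \in `]ylo D, yhi D[ &
        r = (Num.sqrt (((fun x' => f x' y)^`()%classic x) ^+ 2
                       + ((f x)^`()%classic y) ^+ 2))%:E]].

End L2.

Section Noise.
Context {R : realType} {d : measure_display} {Omega : measurableType d}.
Variables (P : probability Omega R) (F : R -> set (set Omega)).

Definition filtration : Prop :=
  [/\ forall t : R, 0 <= t -> sigma_algebra setT (F t),
      forall t : R, 0 <= t -> F t `<=` measurable &
      forall s t : R, 0 <= s -> s <= t -> F s `<=` F t].

Definition measurable_wrt (G : set (set Omega)) (f : Omega -> R) : Prop :=
  forall A : set R, measurable A -> G (f @^-1` A).

Definition increment (b : R -> Omega -> R) (s t : R) (w : Omega) : R :=
  b t w - b s w.

(* [bm_indep] is joint: the increments of finitely many of the [B m] over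
   [s, t] are independent of each other and of [F s]. *)
Record independent_brownian_motions (B : nat -> R -> Omega -> R) : Prop := {
  bm_adapted : forall m (t : R), 0 <= t -> measurable_wrt (F t) (B m t);
  bm_start : forall m, {ae P, forall w, B m 0 w = 0};
  bm_continuous : forall m,
    {ae P, forall w, {within `[0, +oo[, continuous (fun t : R => B m t w)}};
  bm_normal : forall m (s t : R), 0 <= s -> s < t -> forall A : set R, measurable A ->
    P (increment (B m) s t @^-1` A) = normal_prob 0 (Num.sqrt (t - s)) A;
  bm_indep : forall s t : R, 0 <= s -> s <= t ->
    forall (G : set Omega) (n : nat) (A : nat -> set R),
      F s G -> (forall m, measurable (A m)) ->
      P (G `&` \bigcap_(m < n) (increment (B m) s t @^-1` A m)) =
      (P G * \prod_(m < n) P (increment (B m) s t @^-1` A m))%E }.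

Record simple_process (t : R) := SimpleProcess {
  sp_size : nat;
  sp_time : nat -> R;
  sp_val : nat -> Omega -> R;
  sp_time_ge0 : 0 <= sp_time 0;
  sp_time_nd : forall i, (i < sp_size)%N -> sp_time i <= sp_time i.+1;
  sp_time_le : sp_time sp_size <= t;
  sp_val_adapted : forall i, (i < sp_size)%N ->
    measurable_wrt (F (sp_time i)) (sp_val i);
  sp_val_L2 : forall i, (i < sp_size)%N ->
    (\int[P]_w ((sp_val i w) ^+ 2)%:E < +oo)%E }.

Definition sp_eval (t : R) (H : simple_process t) (s : R) (w : Omega) : R :=
  \sum_(i < sp_size H) sp_val H i w * \1_(`]sp_time H i, sp_time H i.+1]) s.

Definition sp_integral (b : R -> Omega -> R) (t : R) (H : simple_process t)
    (w : Omega) : R :=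
  \sum_(i < sp_size H)
    sp_val H i w * increment b (sp_time H i) (sp_time H i.+1) w.

Definition L2_cvg (Z : nat -> Omega -> R) (I : Omega -> R) : Prop :=
  (\int[P]_w ((Z n w - I w) ^+ 2)%:E)%E @[n --> \oo] --> 0%E.

(* [I] is (a version of) the Ito integral of [X] against [b] over [0, t]. *)
Definition is_ito (b : R -> Omega -> R) (X : R -> Omega -> R) (t : R)
    (I : Omega -> R) : Prop :=
  [/\ measurable_fun (`[0, t] `*` [set: Omega]) (fun z : R * Omega => X z.1 z.2),
      forall s : R, s \in `[0, t] -> measurable_wrt (F s) (X s),
      measurable_fun setT I &
      exists H : nat -> simple_process t,
        (\int[P]_w \int[lebesgue_measure]_(s in `[0%R, t])
            ((sp_eval (H n) s w - X s w) ^+ 2)%:E)%E @[n --> \oo] --> 0%E /\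
        L2_cvg (fun n => sp_integral b (H n)) I].

(* [I] is (a version of) the integral over [0, t] and [X] x [Y] of f dW_s dx dy,
   W being the Wiener process with covariance eigenpairs (gamma m, e m). *)
Definition is_dW_integral (e : nat -> R -> R -> R) (gamma : nat -> R)
    (B : nat -> R -> Omega -> R) (X Y : set R) (f : R -> Omega -> R -> R -> R)
    (t : R) (I : Omega -> R) : Prop :=
  measurable_fun setT I /\
  exists J : nat -> Omega -> R,
    (forall m, is_ito (B m)
       (fun s w => int2 X Y (fun x y => f s w x y * e m x y)) t (J m)) /\
    L2_cvg (fun n w => \sum_(m < n) Num.sqrt (gamma m) * J m w) I.

End Noise.

(* The trace-class covariance operator [Q], its eigenbasis and the Brownian
   motions that define the Q-Wiener process. *)
Record Q_wiener (R : realType) (D : rectangle R) (d : measure_display)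
    (Omega : measurableType d) (P : probability Omega R)
    (F : R -> set (set Omega)) (Q : (R -> R -> R) -> R -> R -> R)
    (e : nat -> R -> R -> R) (gamma : nat -> R) (B : nat -> R -> Omega -> R) :
    Prop := {
  qw_basis : orthonormal_basis D e;
  qw_operator : symmetric_nonneg_operator D Q;
  qw_eigen : forall m, ae_eq2 D (Q (e m)) (fun x y => gamma m * e m x y);
  qw_trace : cvgn (series gamma);
  qw_brownian : independent_brownian_motions P F B }.

Section DG1.
Context {R : realType}.
Variables (lo : R) (s : seq R).
Implicit Types (u v : R -> R).

(* [s] lists the nodes after [lo]: node 0 is [lo] and node (size s) the right
   endpoint. The cell number [i], counted from 0, has end nodes [i], [i.+1]. *)
Definition node (i : nat) : R := nth lo (lo :: s) i.

(* Cells are open: an element of the DG space has no meaningful value at an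
   interface. *)
Definition cell (i : nat) : set R := `]node i, node i.+1[.

Definition width (i : nat) : R := node i.+1 - node i.

Definition trace_right u (i : nat) : R :=
  lim (u x @[x --> (node (if i == size s then 0%N else i))^'+]).

Definition trace_left u (i : nat) : R :=
  lim (u x @[x --> (node (if i == 0%N then size s else i))^'-]).

Definition flux (a : R) u (i : nat) : R :=
  (trace_right u i + trace_left u i) / 2
    + a * (trace_right u i - trace_left u i).

Definition dgform (i : nat) u v (a : R) : R :=
  \int[lebesgue_measure]_(x in cell i) (u x * (v^`()%classic x))
    - flux a u i.+1 * trace_left v i.+1 + flux a u i * trace_right v i.

End DG1.

Record mesh (R : realType) (D : rectangle R) := Mesh {
  xs : seq R;
  ys : seq R;
  xs_partition : itv_partition (xlo D) (xhi D) xs;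
  ys_partition : itv_partition (ylo D) (yhi D) ys }.

Definition legendre (R : realType) (n : nat) : {poly R} :=
  (2 ^+ n * n`!%:R)^-1 *: (('X^2 - 1) ^+ n)^`(n).

Definition legendre_on (R : realType) (a b : R) (n : nat) (x : R) : R :=
  (legendre R n).[(2 * x - a - b) / (b - a)].

Section DG2.
Context {R : realType} {D : rectangle R}.
Variables (M : mesh D) (k : nat).
Implicit Types (f g v : R -> R -> R).

Definition Nx : nat := size (xs M).
Definition Ny : nat := size (ys M).

Definition xcell (i : nat) : set R := cell (xlo D) (xs M) i.
Definition ycell (j : nat) : set R := cell (ylo D) (ys M) j.

Definition mesh_size : R :=
  Num.max (\big[Num.max/0]_(i < Nx) width (xlo D) (xs M) i)
          (\big[Num.max/0]_(j < Ny) width (ylo D) (ys M) j).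

Definition dg_space v : Prop :=
  measurable_fun (domain D) (fun z : R * R => v z.1 z.2) /\
  forall (i : 'I_Nx) (j : 'I_Ny), exists c : 'M[R]_k.+1,
    forall x y, xcell i x -> ycell j y ->
      v x y = \sum_(p < k.+1) \sum_(q < k.+1) c p q * x ^+ p * y ^+ q.

Definition formI (i : nat) f g (a y : R) : R :=
  dgform (xlo D) (xs M) i (fun x => f x y) (fun x => g x y) a.

Definition formJ (j : nat) f g (a x : R) : R :=
  dgform (ylo D) (ys M) j (f x) (g x) a.

(* [l] = 0, ..., k^2 + 2k enumerates the pairs of degrees (p, q), p, q <= k, as
   l = p (k + 1) + q. *)
Definition legendre_basis (i j l : nat) (x y : R) : R :=
  legendre_on (node (xlo D) (xs M) i) (node (xlo D) (xs M) i.+1) (l %/ k.+1) x *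
  legendre_on (node (ylo D) (ys M) j) (node (ylo D) (ys M) j.+1) (l %% k.+1) y.

Definition mu_coef (i j l : nat) : R :=
  (int2 (xcell i) (ycell j) (fun x y => legendre_basis i j l x y ^+ 2))^-1.

Definition discrete_trace (e : nat -> R -> R -> R) (gamma : nat -> R) : R :=
  \sum_(i < Nx) \sum_(j < Ny) \sum_(0 <= l < (k ^ 2 + 2 * k).+1)
    mu_coef i j l *
    limn (series (fun m =>
      int2 (xcell i) (ycell j) (fun x y =>
        legendre_basis i j l x y * (Num.sqrt (gamma m) * e m x y)) ^+ 2)).

End DG2.

Section Scheme.
Context {R : realType} {D : rectangle R} {d : measure_display}
  {Omega : measurableType d}.
Variables (P : probability Omega R) (F : R -> set (set Omega)).
Variables (e : nat -> R -> R -> R) (gamma : nat -> R)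
  (B : nat -> R -> Omega -> R).
Variables (M : mesh D) (k : nat) (tmax : R).

Record dg_process (U0 : R -> R -> R) (U : R -> Omega -> R -> R -> R) : Prop := {
  dgp_space : forall (t : R) w, t \in `[0, tmax] -> dg_space M k (U t w);
  dgp_continuous : forall w (i : 'I_(Nx M)) (j : 'I_(Ny M)) x y,
    xcell M i x -> ycell M j y ->
    {within `[0, tmax], continuous (fun t : R => U t w x y)};
  dgp_adapted : forall (t : R) (i : 'I_(Nx M)) (j : 'I_(Ny M)) x y,
    t \in `[0, tmax] -> xcell M i x -> ycell M j y ->
    measurable_wrt (F t) (fun w => U t w x y);
  dgp_init : forall w, U 0 w = U0 }.

(* dU tested with [v] on the cell (i, j) equals [drift] dt + [c] v dW, in
   integrated form. *)
Definition cell_equation (i j : nat) (U : R -> Omega -> R -> R -> R)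
    (v : R -> R -> R) (drift : R -> Omega -> R) (c : R) : Prop :=
  forall t : R, t \in `[0, tmax] -> exists I : Omega -> R,
    is_dW_integral P F e gamma B (xcell M i) (ycell M j)
      (fun _ _ x y => c * v x y) t I /\
    {ae P, forall w,
      int2 (xcell M i) (ycell M j) (fun x y => U t w x y * v x y) =
      int2 (xcell M i) (ycell M j) (fun x y => U 0 w x y * v x y)
      + \int[lebesgue_measure]_(s in `[0, t]) drift s w + I w}.

Record dg_solution (alpha1 alpha2 lambda1 lambda2 : R) (E0 S0 T0 : R -> R -> R)
    (E S T : R -> Omega -> R -> R -> R) : Prop := {
  dg_E : dg_process E0 E;
  dg_S : dg_process S0 S;
  dg_T : dg_process T0 T;
  dg_eqE : forall (i : 'I_(Nx M)) (j : 'I_(Ny M)) v, dg_space M k v ->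
    cell_equation i j E v
      (fun s w =>
        - (\int[lebesgue_measure]_(y in ycell M j) formI M i (T s w) v alpha1 y)
        + \int[lebesgue_measure]_(x in xcell M i)
            formJ M j (S s w) v (- alpha2) x)
      (- lambda1);
  dg_eqS : forall (i : 'I_(Nx M)) (j : 'I_(Ny M)) v, dg_space M k v ->
    cell_equation i j S v
      (fun s w =>
        \int[lebesgue_measure]_(x in xcell M i) formJ M j (E s w) v alpha2 x)
      lambda2;
  dg_eqT : forall (i : 'I_(Nx M)) (j : 'I_(Ny M)) v, dg_space M k v ->
    cell_equation i j T v
      (fun s w =>
        - (\int[lebesgue_measure]_(y in ycell M j)
             formI M i (E s w) v (- alpha1) y))
      lambda2 }.

End Scheme.

(* Main.v *)
Require Import Defs.
From HB Require Import structures.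
From mathcomp Require Import all_boot all_order all_algebra.
From mathcomp Require Import all_classical all_reals all_analysis.
From mathcomp Require Import measurable_realfun.
From mathcomp Require Import ring lra zify.

(** Tested with the Legendre polynomials of the cells, normalized in L2, the
    scheme is a linear system for the coordinates [z q] of [E], [S] and [T],
    [dz q = \sum_r A q r * z r dt + \sum_m G q m dB m], and Parseval's identity
    makes the energy the sum of the squares of the [z q] ([L2norm_coord]). The
    two fluxes that couple a pair of fields carry opposite parameters, so
    discrete integration by parts with periodic traces ([pform_antisym]) makes
    [A] antisymmetric, and the drift does not change the energy. Ito's formula
    then leaves a stochastic integral, whose integrand is the inner product of
    [lambda2 (T + S) - lambda1 E] with the [e m] ([noise_sourceE]), and the sum
    of the squares of all the [G q m] times the elapsed time. That sum is
    [(lambda1^2 + 2 lambda2^2) K] ([bracketE]), which proves the energy law; the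
    stochastic integral has mean zero, which proves its expected form.

    Ito's formula is proved for such a system in [energy_identity]. The energy
    is telescoped over 4^n equal time intervals; antisymmetry removes the drift
    up to a term that is small in mean ([energy_remainder]); the squares of the
    noise increments converge in L1 by the fourth moments of Brownian
    increments ([quadratic_variation]); and left point sums converge to Ito
    integrals ([ito_exists]). The noise is an infinite sum, so these sums are
    truncated to the first [M] Brownian motions; by orthogonality of the motions
    the error of the truncation is bounded by a tail of the series of squared
    weights, uniformly in the time partition ([truncated_sum_diff]), which
    allows the two limits to be taken in either order. The moments that all
    this requires come from Gronwall's lemma path by path ([moment_bound]).

    For the constant [K], [discrete_trace_mass] writes it as the sum of the
    [gamma m] weighted by the squared norms of the projections of the [e m] on
    the discrete space. These weights are at most 1 by Bessel's inequality, so
    [K <= Tr Q], which is at most the stated multiple of [Tr Q] as soon as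
    [0 < k]. What a weight lacks to 1 is the squared distance of [e m] to the
    discrete space, hence at most its squared distance to functions constant on
    the cells, of order [h^2 K_m^2] by the mean value theorem ([defect_le]).
    Interpolating with the trivial bound 1 ([interpolate]) gives the order
    [h^(min alpha 2)] with a factor [1 + K_m^alpha], which the assumption on the
    gradients makes summable against [gamma m] ([discrete_trace_cvg]). *)

Set Implicit Arguments.
Unset Strict Implicit.
Unset Printing Implicit Defensive.

Import Order.TTheory GRing.Theory Num.Theory.
Import numFieldNormedType.Exports.

Local Open Scope classical_set_scope.
Local Open Scope ring_scope.

(** * Integrable and square integrable functions *)

Section Elementary_inequalities.
Variable R : realFieldType.
Implicit Types a b l : R.

Lemma sqrD_le a b : (a + b) ^+ 2 <= 2 * a ^+ 2 + 2 * b ^+ 2.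
Proof.
rewrite -subr_ge0.
have -> : 2 * a ^+ 2 + 2 * b ^+ 2 - (a + b) ^+ 2 = (a - b) ^+ 2 by ring.
exact: sqr_ge0.
Qed.

Lemma young a b l : 0 < l -> `|a * b| <= l * a ^+ 2 + l^-1 * b ^+ 2.
Proof.
move=> l0; rewrite normrM -[a ^+ 2]real_normK ?num_real//.
rewrite -[b ^+ 2]real_normK ?num_real//.
move: `|a| `|b| (normr_ge0 a) (normr_ge0 b) => u v u0 v0.
rewrite -subr_ge0.
have -> : l * u ^+ 2 + l^-1 * v ^+ 2 - u * v =
    l^-1 * ((l * u - v) ^+ 2 + l * (u * v)).
  by field; rewrite gt_eqF.
apply: mulr_ge0; first by rewrite invr_ge0 ltW.
by rewrite addr_ge0 ?sqr_ge0// mulr_ge0 ?mulr_ge0// ltW.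
Qed.

Lemma normM_le a b : `|a * b| <= a ^+ 2 + b ^+ 2.
Proof. by have := young a b ltr01; rewrite invr1 !mul1r. Qed.

End Elementary_inequalities.

Lemma cvg_half (R : realType) (a b : R) :
  a * 2^-1 ^+ n * b @[n --> \oo] --> (0 : R).
Proof.
suff : a * 2^-1 ^+ n * b @[n --> \oo] --> a * 0 * b by rewrite mulr0 mul0r.
apply: cvgM; last exact: cvg_cst.
apply: cvgM; first exact: cvg_cst.
by apply: cvg_expr; rewrite ger0_norm// invf_lt1// ltr1n.
Qed.

Section Square_integrable.
Context {d : measure_display} {T : measurableType d} {R : realType}.
Variables (mu : {measure set T -> \bar R}) (D : set T).
Hypothesis mD : measurable D.
Implicit Types f g : T -> R.

Definition itg f := mu.-integrable D (EFin \o f).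
Definition sqi f := measurable_fun D f /\ itg (fun x => f x ^+ 2).

Lemma itg_meas f : itg f -> measurable_fun D f.
Proof. by move=> /measurable_int/measurable_EFinP. Qed.

Lemma itg_le f g : measurable_fun D f -> itg g ->
  (forall x, D x -> `|f x| <= g x) -> itg f.
Proof.
move=> mf ig fg; apply: (le_integrable mD _ _ ig) => /=.
  exact/measurable_EFinP.
by move=> x Dx; rewrite lee_fin (le_trans (fg x Dx))// ler_norm.
Qed.

Lemma itg_eq f g : {in D, f =1 g} -> itg f -> itg g.
Proof. by move=> fg; apply: eq_integrable => // x xD /=; rewrite fg. Qed.

Lemma itgD f g : itg f -> itg g -> itg (fun x => f x + g x).
Proof.
by move=> fi gi; have := integrableD mD fi gi; apply: eq_integrable.
Qed.

Lemma itgZ k f : itg f -> itg (fun x => k * f x).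
Proof. by move=> fi; have := integrableZl mD k fi; apply: eq_integrable. Qed.

Lemma itgN f : itg f -> itg (fun x => - f x).
Proof. by move=> /(itgZ (-1)); apply: itg_eq => x _; rewrite mulN1r. Qed.

Lemma itgB f g : itg f -> itg g -> itg (fun x => f x - g x).
Proof. by move=> ? /itgN; exact: itgD. Qed.

Lemma itg0 : itg (fun=> 0).
Proof. exact: integrable0. Qed.

Lemma itg_sum (I : Type) (s : seq I) (p : pred I) (h : I -> T -> R) :
  (forall i, p i -> itg (h i)) -> itg (fun x => \sum_(i <- s | p i) h i x).
Proof.
move=> ih; elim: s => [|i s IH].
  by apply: itg_eq itg0 => x _; rewrite big_nil.
case pi: (p i); last by apply: itg_eq IH => x _; rewrite big_cons pi.
by apply: itg_eq (itgD (ih _ pi) IH) => x _; rewrite big_cons pi.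
Qed.

Lemma itg_norm f : itg f -> itg (fun x => `|f x|).
Proof. exact: integrable_norm. Qed.

Lemma Rintegral_sum (I : Type) (s : seq I) (p : pred I) (h : I -> T -> R) :
  (forall i, p i -> itg (h i)) ->
  \int[mu]_(x in D) (\sum_(i <- s | p i) h i x) =
  \sum_(i <- s | p i) \int[mu]_(x in D) h i x.
Proof.
move=> ih; elim: s => [|i s IH].
  by under eq_Rintegral do rewrite big_nil; rewrite Rintegral_cst// mul0r big_nil.
rewrite big_cons; case: ifPn => [pi|npi].
  under eq_Rintegral do rewrite big_cons pi.
  by rewrite RintegralD ?IH//; [exact: ih|exact: itg_sum].
by under eq_Rintegral do rewrite big_cons (negbTE npi).
Qed.

Lemma RintD f g : itg f -> itg g ->
  \int[mu]_(x in D) (f x + g x) =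
  \int[mu]_(x in D) f x + \int[mu]_(x in D) g x.
Proof. exact: RintegralD. Qed.

Lemma RintB f g : itg f -> itg g ->
  \int[mu]_(x in D) (f x - g x) =
  \int[mu]_(x in D) f x - \int[mu]_(x in D) g x.
Proof. exact: RintegralB. Qed.

Lemma RintZ k f : itg f ->
  \int[mu]_(x in D) (k * f x) = k * \int[mu]_(x in D) f x.
Proof. exact: RintegralZl. Qed.

Lemma le_Rint f g : itg f -> itg g -> (forall x, D x -> f x <= g x) ->
  \int[mu]_(x in D) f x <= \int[mu]_(x in D) g x.
Proof. exact: le_Rintegral. Qed.

Lemma EFin_Rintegral f : itg f ->
  (\int[mu]_(x in D) (f x)%:E = (\int[mu]_(x in D) f x)%:E)%E.
Proof. by move=> fi; rewrite /Rintegral fineK//; exact: integrable_fin_num. Qed.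

Lemma ge0_itg f : measurable_fun D f -> (forall x, D x -> 0 <= f x) ->
  (\int[mu]_(x in D) (f x)%:E < +oo)%E -> itg f.
Proof.
move=> mf f0 fi; apply/integrableP; split; first exact/measurable_EFinP.
rewrite (eq_integral (EFin \o f))// => x; rewrite inE => Dx /=.
by rewrite ger0_norm ?f0.
Qed.

Lemma sqi_meas f : sqi f -> measurable_fun D f. Proof. by case. Qed.

Lemma sqi_itg2 f : sqi f -> itg (fun x => f x ^+ 2). Proof. by case. Qed.

Lemma sqiP f : sqi f <->
  measurable_fun D f /\ (\int[mu]_(x in D) ((f x) ^+ 2)%:E < +oo)%E.
Proof.
split=> -[mf f2]; split => //; first exact: integrable_lty.
by apply: ge0_itg => //; [exact: measurable_funX|move=> x _; exact: sqr_ge0].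
Qed.

Lemma sqi_le f g : measurable_fun D f -> itg g ->
  (forall x, D x -> f x ^+ 2 <= g x) -> sqi f.
Proof.
move=> mf ig fg; split => //; apply: itg_le ig _ => //.
  exact: measurable_funX.
by move=> x Dx; rewrite ger0_norm ?sqr_ge0 ?fg.
Qed.

Lemma sqi_eq f g : {in D, f =1 g} -> sqi f -> sqi g.
Proof.
move=> fg [mf f2]; split; first exact: eq_measurable_fun mf.
by apply: itg_eq f2 => x xD; rewrite fg.
Qed.

Lemma sqiD f g : sqi f -> sqi g -> sqi (fun x => f x + g x).
Proof.
move=> [mf f2] [mg g2].
apply: (sqi_le (g := fun x => 2 * f x ^+ 2 + 2 * g x ^+ 2)).
- exact: measurable_funD.
- by apply: itgD; apply: itgZ.
- by move=> x _; exact: sqrD_le.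
Qed.

Lemma sqiZ k f : sqi f -> sqi (fun x => k * f x).
Proof.
move=> [mf f2]; apply: (sqi_le (g := fun x => k ^+ 2 * f x ^+ 2)).
- exact: measurable_funM.
- exact: itgZ.
- by move=> x _; rewrite exprMn.
Qed.

Lemma sqiN f : sqi f -> sqi (fun x => - f x).
Proof. by move=> /(sqiZ (-1)); apply: sqi_eq => x _; rewrite mulN1r. Qed.

Lemma sqiB f g : sqi f -> sqi g -> sqi (fun x => f x - g x).
Proof. by move=> ? /sqiN; exact: sqiD. Qed.

Lemma sqi0 : sqi (fun=> 0).
Proof.
split; first exact: measurable_cst.
by apply: itg_eq itg0 => x _; rewrite expr0n.
Qed.

Lemma sqi_sum (I : Type) (s : seq I) (p : pred I) (h : I -> T -> R) :
  (forall i, p i -> sqi (h i)) -> sqi (fun x => \sum_(i <- s | p i) h i x).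
Proof.
move=> ih; elim: s => [|i s IH].
  by apply: sqi_eq sqi0 => x _; rewrite big_nil.
case pi: (p i); last by apply: sqi_eq IH => x _; rewrite big_cons pi.
by apply: sqi_eq (sqiD (ih _ pi) IH) => x _; rewrite big_cons pi.
Qed.

Lemma sqiM_itg f g : sqi f -> sqi g -> itg (fun x => f x * g x).
Proof.
move=> [mf f2] [mg g2].
apply: (itg_le (g := fun x => f x ^+ 2 + g x ^+ 2)).
- exact: measurable_funM.
- exact: itgD.
- by move=> x _; exact: normM_le.
Qed.

Lemma sqi_cst k : (mu D < +oo)%E -> sqi (fun=> k).
Proof.
move=> fD; apply/sqiP; split => //.
rewrite integral_cst//.
apply: lte_mul_pinfty => //; first by rewrite lee_fin sqr_ge0.
Qed.

Lemma itg_cst k : (mu D < +oo)%E -> itg (fun=> k).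
Proof.
move=> fD; apply: (itg_le (g := fun=> `|k|)) => //.
apply: ge0_itg => //; rewrite integral_cst//.
exact: lte_mul_pinfty.
Qed.

Lemma sqi_itg f : (mu D < +oo)%E -> sqi f -> itg f.
Proof.
move=> fD fs; apply: itg_eq (sqiM_itg (sqi_cst 1 fD) fs) => x _.
by rewrite mul1r.
Qed.

(** Young's inequality is preferred to Cauchy-Schwarz because the weight [l] is
    free: it is chosen below, as a geometric sequence in the level of refinement
    of the time partition, so that both terms have the same order. *)
Lemma Rintegral_normM_le (l a b : R) f g : sqi f -> sqi g -> 0 < l ->
  \int[mu]_(x in D) f x ^+ 2 <= a -> \int[mu]_(x in D) g x ^+ 2 <= b ->
  \int[mu]_(x in D) `|f x * g x| <= l * a + l^-1 * b.
Proof.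
move=> fs gs l0 fa gb.
apply: (@le_trans _ _ (\int[mu]_(x in D) (l * f x ^+ 2 + l^-1 * g x ^+ 2))).
  apply: le_Rint => //.
  - exact/itg_norm/sqiM_itg.
  - by apply: itgD; apply: itgZ; [case: fs|case: gs].
  - by move=> x _; exact: young.
have [[_ f2] [_ g2]] := (fs, gs).
rewrite RintD ?RintZ//; [|exact: itgZ|exact: itgZ].
by apply: lerD; rewrite ler_pM2l ?invr_gt0.
Qed.

(** Jensen's inequality. With [m] the integral of [f] and [v] the measure of
    [D], expand the integral of [(v * f - m) ^+ 2], which is nonnegative. *)
Lemma sqr_Rintegral_le f : (mu D < +oo)%E -> sqi f ->
  (\int[mu]_(x in D) f x) ^+ 2 <= fine (mu D) * \int[mu]_(x in D) f x ^+ 2.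
Proof.
move=> fD fs; set m := \int[mu]_(x in D) f x; set v := fine (mu D).
have fi := sqi_itg fD fs.
have v0 : 0 <= v by rewrite fine_ge0.
have h : 0 <= \int[mu]_(x in D) (v * f x - m) ^+ 2.
  by apply: Rintegral_ge0 => x _; exact: sqr_ge0.
have : \int[mu]_(x in D) (v * f x - m) ^+ 2 =
    v ^+ 2 * (\int[mu]_(x in D) f x ^+ 2) - 2 * v * m * m + m ^+ 2 * v.
  transitivity (\int[mu]_(x in D)
      (v ^+ 2 * f x ^+ 2 + (- (2 * v * m) * f x + m ^+ 2))).
    by apply: eq_Rintegral => x _; ring.
  have i1 : itg (fun x => v ^+ 2 * f x ^+ 2) by apply: itgZ; case: fs.
  have i2 : itg (fun x => - (2 * v * m) * f x) by apply: itgZ.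
  have i3 : itg (fun=> m ^+ 2) by exact: itg_cst.
  rewrite RintD//; last by apply: itgD.
  rewrite RintD// (RintZ _ fi) (RintZ _ (sqi_itg2 fs)).
  by rewrite Rintegral_cst// -/v -/m; ring.
move=> E; rewrite {}E in h.
have [v00|vn0] := eqVneq v 0.
  have mu0 : mu D = 0%E.
    by move: v00; rewrite /v => vv; rewrite -(@fineK _ (mu D)) ?vv// ge0_fin_numE.
  rewrite v00 mul0r /m /Rintegral null_set_integral//= ?expr0n//.
  by apply/measurable_EFinP; case: fs.
have vp : 0 < v by rewrite lt_neqAle eq_sym vn0.
rewrite -(ler_pM2l vp); lra.
Qed.

(** Squares are not continuous in L1, but the square of [`|f|] truncated at
    level [L] exceeds [X n ^+ 2] by at most [2 * L * `|X n - f|]. The bound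
    thus passes to the truncations, and then to [f] by monotone convergence. *)
Lemma L1_lim_sqr_le (X : nat -> T -> R) f (c : R) :
  (mu D < +oo)%E -> measurable_fun D f ->
  (forall n, sqi (X n)) -> (forall n, \int[mu]_(x in D) X n x ^+ 2 <= c) ->
  (forall n, itg (fun x => X n x - f x)) ->
  \int[mu]_(x in D) `|X n x - f x| @[n --> \oo] --> (0 : R) ->
  sqi f /\ \int[mu]_(x in D) f x ^+ 2 <= c.
Proof.
move=> fD mf sX Xc iXf Xf.
have fi : itg f.
  have := itgB (sqi_itg fD (sX 0%N)) (iXf 0%N).
  by apply: itg_eq => x _; rewrite opprB addrC subrK.
pose t (L : nat) x := Num.min `|f x| L%:R.
have mt L : measurable_fun D (t L).
  by apply: measurable_minr => //; exact: measurableT_comp.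
have it2 L : itg (fun x => t L x ^+ 2).
  apply: (itg_le (g := fun=> L%:R ^+ 2)) => //; first exact: measurable_funX.
    exact: itg_cst.
  move=> x _; rewrite ger0_norm ?sqr_ge0//.
  have t0 : 0 <= t L x by rewrite /t le_min normr_ge0 ler0n.
  by rewrite lerXn2r ?nnegrE//= /t ge_min lexx orbT.
have hL L : \int[mu]_(x in D) t L x ^+ 2 <= c.
  suff h n : \int[mu]_(x in D) t L x ^+ 2 <=
             c + 2 * L%:R * \int[mu]_(x in D) `|X n x - f x|.
    have hc : c + 2 * L%:R * \int[mu]_(x in D) `|X n x - f x| @[n --> \oo] --> c.
      rewrite -[X in _ --> X]addr0 -[X in _ --> _ + X](mulr0 (2 * L%:R)).
      by apply: cvgD; [exact: cvg_cst|exact: cvgM (cvg_cst _) Xf].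
    have /cvgP cv := hc.
    rewrite -(cvg_lim _ hc)//; apply: limr_ge => //.
    by near=> n; exact: h.
  have ix : itg (fun x => X n x ^+ 2) by case: (sX n).
  have iy : itg (fun x => 2 * L%:R * `|X n x - f x|) by apply: itgZ; exact/itg_norm.
  apply: (@le_trans _ _
    (\int[mu]_(x in D) (X n x ^+ 2 + 2 * L%:R * `|X n x - f x|))).
    apply: le_Rint => //; first exact: itgD.
    move=> x _.
    have t0 : 0 <= t L x by rewrite /t le_min normr_ge0 ler0n.
    have tL : t L x <= L%:R by rewrite /t ge_min lexx orbT.
    have tf : t L x <= `|f x| by rewrite /t ge_min lexx.
    have : `|f x| <= `|X n x| + `|X n x - f x|.
      by rewrite -{1}[f x](subKr (X n x)) (le_trans (ler_normB _ _)).
    rewrite -[X n x ^+ 2]real_normK ?num_real//.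
    have := normr_ge0 (X n x); have := normr_ge0 (X n x - f x).
    move: `|X n x| `|X n x - f x| `|f x| tf => a b e tf a0 b0 eab.
    have [ta|ta] := leP (t L x) a; first nra.
    have : t L x - a <= b by lra.
    nra.
  rewrite RintD// RintZ//; last exact/itg_norm.
  by rewrite lerD2r.
have cv : (\int[mu]_(x in D) (t L x ^+ 2)%:E)%E @[L --> \oo] -->
          (\int[mu]_(x in D) (f x ^+ 2)%:E)%E.
  have -> : (\int[mu]_(x in D) (f x ^+ 2)%:E)%E =
      (\int[mu]_(x in D) (limn (fun L => (t L x ^+ 2)%:E)))%E.
    apply: eq_integral => x _.
    apply/esym/cvg_lim => //; apply: cvg_near_cst.
    near=> L; rewrite /t min_l ?real_normK ?num_real//.
    by near: L; exact: nbhs_infty_ger.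
  apply: cvg_monotone_convergence => //.
  - by move=> L; apply/measurable_EFinP; exact: measurable_funX.
  - by move=> L x _; rewrite lee_fin sqr_ge0.
  - move=> x _ m n mn; rewrite lee_fin lerXn2r ?nnegrE//=.
    + by rewrite /t le_min normr_ge0 ler0n.
    + by rewrite /t le_min normr_ge0 ler0n.
    + by rewrite /t le_min !ge_min lexx/= ler_nat mn orbT.
have fc : (\int[mu]_(x in D) (f x ^+ 2)%:E <= c%:E)%E.
  rewrite -(cvg_lim _ cv)//; apply: lime_le; first exact/cvgP/cv.
  by near=> L; rewrite EFin_Rintegral// lee_fin hL.
have fs : sqi f by apply/sqiP; split => //; rewrite (le_lt_trans fc)// ltry.
by split => //; rewrite -lee_fin -EFin_Rintegral//; case: fs.
Unshelve. all: by end_near. Qed.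

(** Cauchy-Schwarz for a telescoping sum with the weights [2 ^ j], whose
    inverses have geometric tails. *)
Lemma sqr_tail_le (u : nat -> R) (n m : nat) : (n <= m)%N ->
  (u m - u n) ^+ 2 <=
    2 * 2^-1 ^+ n * \sum_(n <= j < m) 2 ^+ j * (u j.+1 - u j) ^+ 2.
Proof.
move=> nm; rewrite -(subnK nm); move: (m - n)%N => {nm m} k.
elim: k n => [|k IH] n.
  by rewrite add0n subrr expr0n/= big_geq// mulr0.
rewrite addSn big_nat_recl ?leq_addl// -addnS.
have -> : u (k + n.+1)%N - u n = (u n.+1 - u n) + (u (k + n.+1)%N - u n.+1).
  by ring.
apply: (le_trans (sqrD_le _ _)); rewrite mulrDr; apply: lerD.
  rewrite -!mulrA ler_pM2l// mulrA -exprMn mulVf// expr1n mul1r.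
  exact: lexx.
apply: (@le_trans _ _ (2 * (2 * 2^-1 ^+ n.+1 *
    \sum_(n.+1 <= j < k + n.+1) 2 ^+ j * (u j.+1 - u j) ^+ 2))).
  by rewrite ler_pM2l// IH.
rewrite addnS big_add1/= exprS.
rewrite le_eqVlt; apply/orP; left; apply/eqP.
by rewrite !mulrA; have -> : (2 : R) * 2 / 2 = 2 by field.
Qed.

(** Riesz-Fischer, for sequences that are fast enough for pointwise
    convergence: the weights 2 ^ j make the squared increments summable and
    still control the tails of the telescoping sum. *)
Lemma sqi_cvg_fast (f : nat -> T -> R) (c : R) :
  (forall n, sqi (f n)) ->
  (forall n, \int[mu]_(x in D) (f n.+1 x - f n x) ^+ 2 <= c * (4^-1) ^+ n) ->
  exists g, measurable_fun D g /\
    (\int[mu]_(x in D) ((f n x - g x) ^+ 2)%:E)%E @[n --> \oo] --> 0%E.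
Proof.
move=> sf fc.
have mf n : measurable_fun D (f n) by case: (sf n).
pose h j x := 2 ^+ j * (f j.+1 x - f j x) ^+ 2.
have h0 j x : 0 <= h j x by rewrite mulr_ge0 ?sqr_ge0// exprn_ge0.
have mh j : measurable_fun D (h j).
  by apply: measurable_funM => //; apply: measurable_funX; exact: measurable_funB.
have ih j : itg (h j) by apply: itgZ; case: (sqiB (sf j.+1) (sf j)).
pose G x := (\sum_(0 <= j <oo) (h j x)%:E)%E.
have c0 : 0 <= c.
  have := fc 0%N; rewrite expr0 mulr1; apply: le_trans.
  by apply: Rintegral_ge0 => x _; exact: sqr_ge0.
have iG : (\int[mu]_(x in D) G x <= (2 * c)%:E)%E.
  rewrite integral_nneseries//; last 2 first.
  - by move=> j; exact/measurable_EFinP.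
  - by move=> j x _; rewrite lee_fin.
  apply: lime_le.
    apply: is_cvg_nneseries => j _ _; apply: integral_ge0 => x _.
    by rewrite lee_fin.
  near=> n.
  apply: (@le_trans _ _ (\sum_(0 <= j < n) (c * (2^-1) ^+ j)%:E)%E).
    apply: lee_sum => j _; rewrite EFin_Rintegral// lee_fin.
    rewrite RintZ; last by case: (sqiB (sf j.+1) (sf j)).
    apply: (@le_trans _ _ (2 ^+ j * (c * 4^-1 ^+ j))).
      by rewrite ler_wpM2l// exprn_ge0.
    rewrite mulrCA ler_wpM2l// -exprMn.
    by have -> : (2 : R) / 4 = 2^-1 by field.
  rewrite sumEFin lee_fin -mulr_sumr mulrC ler_wpM2r//.
  suff -> : \sum_(0 <= j < n) (2^-1 : R) ^+ j = 2 - 2 * 2^-1 ^+ n.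
    by rewrite gerBl mulr_ge0// exprn_ge0.
  elim: {+}n => [|m IH]; first by rewrite big_geq// expr0; ring.
  by rewrite big_nat_recr//= IH exprS; field.
pose g x := fine (limn_esup (fun n => (f n x)%:E)).
have mg : measurable_fun D g.
  apply: measurableT_comp => //.
  by apply: measurable_fun_limn_esup => n; exact/measurable_EFinP.
exists g; split => //.
have key n x : D x -> (((f n x - g x) ^+ 2)%:E <= (2 * 2^-1 ^+ n)%:E * G x)%E.
  move=> Dx.
  have Sle m : ((\sum_(0 <= j < m) h j x)%:E <= G x)%E.
    by rewrite -sumEFin; apply: nneseries_lim_ge => j _ _; rewrite lee_fin.
  have G0 : (0 <= G x)%E by apply: nneseries_ge0 => j _ _; rewrite lee_fin.
  have q0 k : 0 < 2 * (2^-1 : R) ^+ k by rewrite mulr_gt0// exprn_gt0.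
  have [Goo|Gfin] := eqVneq (G x) +oo%E.
    by rewrite Goo gt0_muley ?leey// lte_fin.
  have Gf : G x \is a fin_num by rewrite ge0_fin_numE// ltey.
  move: Sle; rewrite -(fineK Gf); set r := fine (G x) => Sle.
  have r0 : 0 <= r by rewrite fine_ge0.
  have tail k m : (k <= m)%N -> (f m x - f k x) ^+ 2 <= 2 * 2^-1 ^+ k * r.
    move=> km; apply: (le_trans (sqr_tail_le (f^~ x) km)).
    rewrite ler_pM2l//; have := Sle m; rewrite lee_fin; apply: le_trans.
    rewrite (big_cat_nat (leq0n k) km)/= lerDr.
    by apply: sumr_ge0 => j _.
  have fcv : cvgn (f^~ x).
    apply/cauchy_cvgP/cauchy_exP => e e0.
    have /cvgr0Pnorm_lt/(_ _ (exprn_gt0 2 e0)) :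
        2 * (2^-1 : R) ^+ k * r @[k --> \oo] --> 0.
      exact: cvg_half.
    move=> [k _ kP]; exists (f k x).
    have := kP k (leqnn k); rewrite ger0_norm ?mulr_ge0// ?exprn_ge0// => ke.
    exists k => // m /= km; rewrite /ball/=.
    rewrite -(ltr_pXn2r (n := 2)) ?nnegrE ?(ltW e0)//.
    rewrite real_normK ?num_real// -sqrrN opprB.
    exact: le_lt_trans (tail _ _ km) ke.
  have fg : f m x @[m --> \oo] --> g x.
    suff -> : g x = limn (f^~ x) by exact: fcv.
    rewrite /g is_cvg_limn_esupE; last first.
      by apply/cvg_ex; exists (limn (f^~ x))%:E; apply: cvg_EFin => //; near=> m.
    rewrite -[RHS]/(fine (limn (f^~ x))%:E); congr fine.
    apply/cvg_lim => //; apply: cvg_EFin => //; by near=> m.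
  rewrite -EFinM lee_fin.
  have cv : (f n x - f m x) ^+ 2 @[m --> \oo] --> (f n x - g x) ^+ 2.
    by rewrite expr2; apply: cvgM; apply: cvgB => //; exact: cvg_cst.
  rewrite -(cvg_lim _ cv)//; apply: limr_le; first exact/cvgP/cv.
  near=> m; rewrite -(sqrrN (f n x - f m x)) opprB tail//.
  by near: m; exact: nbhs_infty_ge.
have mG : measurable_fun D G.
  by apply: ge0_emeasurable_sum => [j x _ _|j _];
    [rewrite lee_fin|exact/measurable_EFinP].
apply: (@squeeze_cvge _ _ _ _ (fun=> 0%E) _
    (fun n => (2 * 2^-1 ^+ n * (2 * c))%:E)).
- near=> n; apply/andP; split.
    by apply: integral_ge0 => x _; rewrite lee_fin sqr_ge0.
  apply: (@le_trans _ _ (\int[mu]_(x in D) ((2 * 2^-1 ^+ n)%:E * G x))%E).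
    apply: ge0_le_integral => //.
    + by move=> x _; rewrite lee_fin sqr_ge0.
    + by apply/measurable_EFinP/measurable_funX/measurable_funB.
    + by apply: emeasurable_funM => //.
    + by move=> x Dx; exact: key.
  rewrite ge0_integralZl//; last first.
    by move=> x _; apply: nneseries_ge0 => j _ _; rewrite lee_fin.
  by rewrite [leRHS]EFinM lee_wpmul2l// lee_fin mulr_ge0// exprn_ge0.
- exact: cvg_cst.
- apply: cvg_EFin; first by near=> n.
  exact: cvg_half.
Unshelve. all: by end_near. Qed.

End Square_integrable.

(** * Moments of normal laws, and independence *)

Section Normal_moments.
Context {R : realType}.
Notation leb := (@lebesgue_measure R).

Lemma ge0_integral_normal (s : R) (f : R -> \bar R) :
  (forall x, (0 <= f x)%E) -> measurable_fun setT f ->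
  (\int[normal_prob 0 s]_x f x = \int[leb]_x (f x * (normal_pdf 0 s x)%:E))%E.
Proof.
move=> f0 mf.
have dom := @normal_prob_dominates R 0 s.
rewrite -(Radon_Nikodym_SigmaFinite.change_of_variables dom)//.
apply: ae_eq_integral => //.
- apply: emeasurable_funM => //; apply: (measurable_int leb).
  exact: Radon_Nikodym_SigmaFinite.f_integrable.
- apply: emeasurable_funM => //; apply/measurable_EFinP.
  exact: measurable_normal_pdf.
- apply: ae_eqe_mul2l => /=.
  apply: integral_ae_eq => //=.
  + exact: Radon_Nikodym_SigmaFinite.f_integrable.
  + by apply/measurable_EFinP; exact: measurable_normal_pdf.
  + by move=> E _ mE; rewrite -Radon_Nikodym_SigmaFinite.f_integral.
Qed.

Variable s : R.
Hypothesis s0 : 0 < s.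
Let sn0 : s != 0. Proof. by rewrite gt_eqF. Qed.

Let q (x : R) : R := normal_peak s * expR (- (x ^+ 2 / (2 * s ^+ 2))).

Lemma normal_pdf0E : normal_pdf 0 s = q.
Proof.
apply/funext => x; rewrite normal_pdfE// /q /normal_fun subr0 mulNr.
by rewrite -mulr_natl.
Qed.

Lemma is_derive_normal_pdf (x : R) : is_derive x (1:R) q (- (x / s ^+ 2) * q x).
Proof.
rewrite /q; apply: is_derive_eq.
rewrite !scaler1 /GRing.scale/=.
by field.
Qed.

(** Half of the exponent absorbs the power of [x], and the other half is that
    of a normal density with twice the variance. This yields integrability and
    a fourth moment bound with the right power of [s], without computing the
    moment. *)
Lemma normal_pdf_mul_le (x : R) :
  x ^+ 4 * q x <= 128 * s ^+ 4 * normal_pdf 0 (Num.sqrt 2 * s) x.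
Proof.
have s20 : Num.sqrt 2 * s != 0 :> R by rewrite mulf_neq0// sqrtr_eq0 -ltNge.
rewrite normal_pdfE// /q /normal_fun subr0.
set u := x ^+ 2 / (4 * s ^+ 2).
have -> : x ^+ 2 / (2 * s ^+ 2) = u + u by rewrite /u; field.
have -> : - x ^+ 2 / ((Num.sqrt 2 * s) ^+ 2 *+ 2) = - u.
  by rewrite exprMn sqr_sqrtr// /u -mulr_natl; field.
have -> : x ^+ 4 = 16 * s ^+ 4 * u ^+ 2 by rewrite /u; field.
have u0 : 0 <= u by rewrite divr_ge0 ?sqr_ge0// mulr_ge0 ?sqr_ge0.
have ue : u ^+ 2 <= 4 * expR u.
  have : u / 2 <= expR (u / 2) by rewrite (le_trans _ (expR_ge1Dx _))// lerDr.
  have u20 : 0 <= u / 2 by rewrite divr_ge0.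
  rewrite -(ler_pXn2r (n := 2)) ?nnegrE ?expR_ge0 ?u20//.
  have -> : expR u = expR (u / 2) ^+ 2.
    by rewrite -expRM_natr; congr expR; field.
  by rewrite exprMn exprVn; lra.
have pk : normal_peak s <= 2 * normal_peak (Num.sqrt 2 * s).
  rewrite /normal_peak.
  have -> : (Num.sqrt 2 * s) ^+ 2 * pi *+ 2 = 2 * (s ^+ 2 * pi *+ 2).
    by rewrite exprMn sqr_sqrtr//; ring.
  rewrite (sqrtrM _ (ler0n R 2)) invfM mulrA ler_peMl ?invr_ge0 ?sqrtr_ge0//.
  rewrite ler_pdivlMr ?sqrtr_gt0// mul1r -(ler_pXn2r (n := 2)) ?nnegrE//.
  by rewrite sqr_sqrtr//; lra.
have e0 := expR_ge0 (- u).
have h : u ^+ 2 * expR (- (u + u)) <= 4 * expR (- u).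
  rewrite opprD expRD mulrA ler_wpM2r//.
  apply: le_trans (ler_wpM2r e0 ue) _.
  by rewrite expRN -mulrA mulfV ?mulr1// gt_eqF// expR_gt0.
have p0 := normal_peak_ge0 (Num.sqrt 2 * s).
have p1 := normal_peak_ge0 s.
have s4 : 0 <= s ^+ 4 by rewrite exprn_ge0// ltW.
(* The constant is 16 * 2 * 4: the substitution [u], the ratio of the peaks and
   the bound on [u ^+ 2]. *)
have -> : 16 * s ^+ 4 * u ^+ 2 * (normal_peak s * expR (- (u + u))) =
  16 * s ^+ 4 * (normal_peak s * (u ^+ 2 * expR (- (u + u)))) by ring.
have -> : 128 * s ^+ 4 * (normal_peak (Num.sqrt 2 * s) * expR (- u)) =
  16 * s ^+ 4 * ((2 * normal_peak (Num.sqrt 2 * s)) * (4 * expR (- u))) by ring.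
apply: ler_wpM2l; first by rewrite mulr_ge0.
apply: ler_pM => //.
by rewrite mulr_ge0 ?sqr_ge0// expR_ge0.
Qed.

Let mq : measurable_fun setT q.
Proof. by rewrite -normal_pdf0E; exact: measurable_normal_pdf. Qed.

Let q0 x : 0 <= q x.
Proof. by rewrite -normal_pdf0E normal_pdf_ge0. Qed.

Let iq : itg leb setT q.
Proof. by rewrite -normal_pdf0E; exact: integrable_normal_pdf. Qed.

Lemma itg_normal4 : itg leb setT (fun x => x ^+ 4 * q x).
Proof.
apply: (@itg_le _ _ R leb setT measurableT _ (fun x => 128 * s ^+ 4 * normal_pdf 0 (Num.sqrt 2 * s) x)).
- by apply: measurable_funM => //; exact: measurable_funX.
- by apply: itgZ => //; exact: integrable_normal_pdf.
- move=> x _; rewrite ger0_norm ?normal_pdf_mul_le//.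
  by rewrite mulr_ge0// exprn_even_ge0.
Qed.

Lemma itg_normal2 : itg leb setT (fun x => x ^+ 2 * q x).
Proof.
apply: (@itg_le _ _ R leb setT measurableT _ (fun x => q x + x ^+ 4 * q x)).
- by apply: measurable_funM => //; exact: measurable_funX.
- by apply: itgD => //; exact: itg_normal4.
- move=> x _; rewrite ger0_norm; last by rewrite mulr_ge0// sqr_ge0.
  rewrite -[X in X + _]mul1r -mulrDl ler_wpM2r//.
  have -> : x ^+ 4 = x ^+ 2 * x ^+ 2 by ring.
  have := sqr_ge0 x; move: (x ^+ 2) => y y0; nra.
Qed.

Lemma itg_normal1 : itg leb setT (fun x => x * q x).
Proof.
apply: (@itg_le _ _ R leb setT measurableT _ (fun x => q x + x ^+ 2 * q x)).
- by apply: measurable_funM => //.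
- by apply: itgD => //; exact: itg_normal2.
- move=> x _; rewrite normrM (ger0_norm (q0 x)) -[X in X + _]mul1r -mulrDl.
  rewrite ler_wpM2r// -(real_normK (num_real x)).
  by move: (normr_ge0 x); move: `|x| => y; nra.
Qed.

Lemma normal_moment4 :
  \int[leb]_x (x ^+ 4 * q x) <= 128 * s ^+ 4.
Proof.
apply: (@le_trans _ _
  (\int[leb]_x (128 * s ^+ 4 * normal_pdf 0 (Num.sqrt 2 * s) x))).
  apply: le_Rint => //; first exact: itg_normal4.
    by apply: itgZ => //; exact: integrable_normal_pdf.
  by move=> x _; exact: normal_pdf_mul_le.
rewrite RintZ//; last exact: integrable_normal_pdf.
by rewrite /Rintegral integral_normal_pdf mulr1.
Qed.

Lemma normal_moment1 : \int[leb]_x (x * q x) = 0.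
Proof.
set I := \int[leb]_x (x * q x).
suff : I = - I by move=> h; lra.
rewrite {1}/I /Rintegral.
have mN : measurable_fun setT (-%R : R -> measurableTypeR R).
  exact: oppr_measurable.
have mf : measurable_fun setT (fun x : R => (x * q x)%:E).
  by apply/measurable_EFinP; apply: measurable_funM.
have qN x : q (- x) = q x by rewrite /q sqrrN.
transitivity (fine (\int[pushforward leb (-%R : R -> measurableTypeR R)]_x
   (x * q x)%:E)).
  congr fine; apply: eq_measure_integral => //= A mA AS.
  exact/esym/lebesgue_measureN.
rewrite integral_pushforward//=; last first.
  have := itgN measurableT itg_normal1.
  by apply: eq_integrable => // x _ /=; rewrite qN mulNr.
transitivity (\int[leb]_x (- 1 * (x * q x))).
  by congr fine; apply: eq_integral => x _; rewrite qN; congr (_%:E); ring.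
by rewrite RintZ ?mulN1r//; exact: itg_normal1.
Qed.

(** The function [x |-> - x * q x] vanishes at 0 and at infinity, and its
    derivative is [s ^- 2 * (x ^+ 2 * q x) - q x]. *)
Lemma normal_moment2 : \int[leb]_x (x ^+ 2 * q x) = s ^+ 2.
Proof.
pose F x := - x * q x; pose f x := (s ^- 2 * (x ^+ 2 * q x) - q x).
have dF x : is_derive x (1:R) F (f x).
  have dq := is_derive_normal_pdf x.
  apply: is_derive_eq; by rewrite /f /GRing.scale/=; field.
have Ff x : F^`()%classic x = f x by rewrite derive1E derive_val.
have cq : continuous q by rewrite -normal_pdf0E; exact: continuous_normal_pdf.
have cF : continuous F.
  move=> x; apply: differentiable_continuous; apply/derivable1_diffP.
  exact: ex_derive.
have cx2 : continuous (fun x : R => x ^+ 2 * q x).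
  by move=> x; apply: cvgM; [exact: exprn_continuous|exact: cq].
have cf : continuous f.
  move=> x; apply: cvgB; last exact: cq.
  by apply: cvgM; [exact: cvg_cst|exact: cx2].
have itf : itg leb setT f.
  by apply: itgB => //; apply: itgZ => //; exact: itg_normal2.
have Fy : F x @[x --> +oo] --> (0 : R).
  apply/cvgr0Pnorm_lt => e e0.
  near=> x.
  have x0 : 0 < x by near: x; exact: nbhs_pinfty_gt.
  have hx : normal_peak s * (2 * s ^+ 2) / e < x.
    by near: x; apply: nbhs_pinfty_gt; exact: num_real.
  rewrite /F /q mulNr normrN ger0_norm; last by apply: mulr_ge0; [exact: ltW|exact: q0].
  apply: (@le_lt_trans _ _ (normal_peak s * (2 * s ^+ 2) / x)).
    rewrite ler_pdivlMr// mulrC mulrA mulrCA -mulrA.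
    rewrite ler_wpM2l ?normal_peak_ge0//.
    set y := x ^+ 2 / (2 * s ^+ 2).
    have -> : x * (x * expR (- y)) = 2 * s ^+ 2 * (y * expR (- y)).
      by rewrite /y; field.
    rewrite ler_piMr//; first by rewrite mulr_ge0// sqr_ge0.
    rewrite expRN ler_pdivrMr ?expR_gt0// mul1r.
    by rewrite (le_trans _ (expR_ge1Dx _))// lerDr.
  by rewrite ltr_pdivrMr// -ltr_pdivrMl// mulrC.
(* The integral is cut at [s], where [f] changes sign, so that the part up to
   infinity has a nonnegative integrand. *)
have f0 : \int[leb]_(x in `[0, +oo[) f x = 0.
  have i1 : leb.-integrable `[0, +oo[ (EFin \o f).
    by apply: (integrableS _ _ _ itf).
  have := Rintegral_itvB i1 (x := s).
  rewrite !bnd_simp => /(_ (ltW s0) isT).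
  rewrite Rintegral_itv_obnd_cbnd; last first.
    by apply: (integrableS _ _ _ itf).
  rewrite (@Rintegral_ge0_continuous_FTC2y _ f F s 0)//; first last.
  - by move=> x; apply: cvg_at_right_filter; exact: cF.
  - exact: continuous_subspaceT.
  - move=> x sx; rewrite /f subr_ge0 mulrA ler_peMl// mulrC ler_pdivlMr ?exprn_gt0//.
    by rewrite mul1r lerXn2r ?nnegrE// ?(ltW s0)// (le_trans (ltW s0)).
  rewrite {2}/Rintegral (@continuous_FTC2 _ f F 0 s)//; first last.
  - split => //; first by apply: cvg_at_right_filter; exact: cF.
    by apply: cvg_at_left_filter; exact: cF.
  - exact: continuous_subspaceT.
  rewrite /= {2}/F oppr0 mul0r subr0 => /eqP.
  by rewrite subr_eq sub0r addNr => /eqP.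
have sym (g : R -> R) : (forall x, 0 <= g x) -> continuous g ->
    (forall x, g (- x) = g x) -> itg leb setT g ->
    \int[leb]_x g x = 2 * \int[leb]_(x in `[0, +oo[) g x.
  move=> g0 cg gN ig; rewrite /Rintegral ge0_symfun_integralT//; last by move=> x /=; rewrite gN.
  rewrite fineM//; last first.
    apply: integrable_fin_num => //; first by rewrite -set_itvcy.
    by apply: (integrableS _ _ _ ig) => //; rewrite -set_itvcy.
  by rewrite set_itvcy.
have qN x : q (- x) = q x by rewrite /q sqrrN.
have h1 : \int[leb]_x q x = 1.
  by rewrite -normal_pdf0E /Rintegral integral_normal_pdf.
rewrite sym//; last 3 first.
- by move=> x; rewrite mulr_ge0// sqr_ge0.
- by move=> x; rewrite qN sqrrN.
- exact: itg_normal2.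
rewrite sym// in h1.
move: f0.
have iS g : itg leb setT g -> itg leb `[0, +oo[ g.
  by move=> ig; apply: (integrableS _ _ _ ig).
rewrite /f RintB//; last 2 first.
- by apply: itgZ => //; apply: iS; exact: itg_normal2.
- exact: iS.
rewrite RintZ//; last by apply: iS; exact: itg_normal2.
move/eqP; rewrite subr_eq0 => /eqP h.
rewrite -h in h1; set J := \int[leb]_(x in _) _ in h1 *.
transitivity (s ^+ 2 * (2 * (s ^- 2 * J))); first by field.
by rewrite h1 mulr1.
Unshelve. all: by end_near. Qed.

Lemma normal_moments :
  [/\ itg leb setT (fun x => x * normal_pdf 0 s x),
    itg leb setT (fun x => x ^+ 2 * normal_pdf 0 s x),
    itg leb setT (fun x => x ^+ 4 * normal_pdf 0 s x),
    \int[leb]_x (x * normal_pdf 0 s x) = 0 &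
    \int[leb]_x (x ^+ 2 * normal_pdf 0 s x) = s ^+ 2] /\
  \int[leb]_x (x ^+ 4 * normal_pdf 0 s x) <= 128 * s ^+ 4.
Proof.
rewrite normal_pdf0E; split; last exact: normal_moment4.
split; [exact: itg_normal1|exact: itg_normal2|exact: itg_normal4|
  exact: normal_moment1|exact: normal_moment2].
Qed.

End Normal_moments.

Section Independence.
Context {R : realType} {d : measure_display} {Omega : measurableType d}.
Variable P : probability Omega R.
Implicit Types X Y Z : Omega -> R.

Definition indep2 X Y := forall A B : set R, measurable A -> measurable B ->
  P (X @^-1` A `&` Y @^-1` B) = (P (X @^-1` A) * P (Y @^-1` B))%E.

(** The joint law of independent variables is the product of their laws, so
    Fubini's theorem separates the factors. *)
Lemma Rintegral_indepM X Y :
  measurable_fun setT X -> measurable_fun setT Y -> indep2 X Y ->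
  itg P setT X -> itg P setT Y ->
  itg P setT (fun w => X w * Y w) /\
  \int[P]_w (X w * Y w) = (\int[P]_w X w) * (\int[P]_w Y w).
Proof.
move=> mX mY XY iX iY.
pose X' : {RV P >-> R} := HB.pack X (isMeasurableFun.Build _ _ _ _ X mX).
pose Y' : {RV P >-> R} := HB.pack Y (isMeasurableFun.Build _ _ _ _ Y mY).
have mXY : measurable_fun setT (fun w => (X w, Y w)).
  exact: measurable_fun_pair.
pose Z : {RV P >-> (R * R)%type} :=
  HB.pack (fun w => (X w, Y w)) (isMeasurableFun.Build _ _ _ _ _ mXY).
pose mX_ := distribution P X'; pose mY_ := distribution P Y'.
have mZ A : measurable A -> (mX_ \x mY_)%E A = distribution P Z A.
  apply: product_measure_unique => A1 A2 mA1 mA2.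
  rewrite /distribution /pushforward/= -XY//.
have iX' : mX_.-integrable setT (EFin \o id).
  by apply: integrable_pushforward => //; exact/measurable_EFinP.
have iY' : mY_.-integrable setT (EFin \o id).
  by apply: integrable_pushforward => //; exact/measurable_EFinP.
have mprod : measurable_fun setT (fun z : R * R => z.1 * z.2).
  by apply: measurable_funM.
have iprod : (mX_ \x mY_)%E.-integrable setT (EFin \o (fun z : R * R => z.1 * z.2)).
  apply/integrable12ltyP; first exact/measurable_EFinP.
  under eq_integral => x _.
    under eq_integral do rewrite /= normrM EFinM.
    rewrite ge0_integralZl//; last first.
      apply/measurable_EFinP.
      exact: (measurableT_comp (@normr_measurable R setT)).
    over.
  rewrite ge0_integralZr//; last 2 first.
  - apply/measurable_EFinP.
    exact: (measurableT_comp (@normr_measurable R setT)).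
  - by apply: integral_ge0 => x _; rewrite lee_fin.
  move/integrableP : iX' => [_ fX]; move/integrableP : iY' => [_ fY].
  by apply: lte_mul_pinfty => //; [exact: integral_ge0|
    rewrite ge0_fin_numE//; exact: integral_ge0].
have iZ : (distribution P Z).-integrable setT (EFin \o (fun z : R * R => z.1 * z.2)).
  apply/integrableP; split; first exact/measurable_EFinP.
  move/integrableP : iprod => [_].
  by rewrite (eq_measure_integral (distribution P Z))// => A mA _; exact: mZ.
have iXY : itg P setT (fun w => X w * Y w).
  apply/integrableP; split.
    by apply/measurable_EFinP; exact: measurable_funM.
  move/integrableP : iZ => [_].
  rewrite ge0_integral_distribution//.
  by apply/measurable_EFinP; exact: measurableT_comp.
split=> //.
have -> : \int[P]_w X w = fine (\int[mX_]_x x%:E).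
  by rewrite integral_distribution//; exact/measurable_EFinP.
have -> : \int[P]_w Y w = fine (\int[mY_]_x x%:E).
  by rewrite integral_distribution//; exact/measurable_EFinP.
rewrite /Rintegral.
have -> : (\int[P]_w (X w * Y w)%:E =
    \int[distribution P Z]_z (z.1 * z.2)%:E)%E.
  by rewrite integral_distribution//; exact/measurable_EFinP.
rewrite (eq_measure_integral (mX_ \x mY_)%E); last first.
  by move=> A mA _; exact/esym/mZ.
rewrite -(integral12_prod_meas1 iprod)/=.
rewrite /fubini_F/=.
under eq_integral => x _.
  under eq_integral do rewrite EFinM.
  rewrite integralZl//.
  over.
rewrite -fineM; last 2 first.
- exact: integrable_fin_num.
- exact: integrable_fin_num.
have /fineK <- : (\int[mY_]_x x%:E)%E \is a fin_num by exact: integrable_fin_num.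
by rewrite integralZr.
Qed.

(** Products of two measurable sets are stable under intersection and generate
    the product sigma-algebra, so the independence of the pair [(X, Y)] from
    [Z] extends from them to every event of the pair. *)
Lemma indep_mul X Y Z : measurable_fun setT X -> measurable_fun setT Y ->
  measurable_fun setT Z ->
  (forall A B C : set R, measurable A -> measurable B -> measurable C ->
   P (X @^-1` A `&` Y @^-1` B `&` Z @^-1` C) =
   (P (X @^-1` A `&` Y @^-1` B) * P (Z @^-1` C))%E) ->
  indep2 (fun w => X w * Y w) Z.
Proof.
move=> mX mY mZ XYZ A C mA mC.
have mXY : measurable_fun setT (fun w => (X w, Y w)).
  exact: measurable_fun_pair.
pose f : {mfun Omega >-> (R * R)%type} :=
  HB.pack (fun w => (X w, Y w)) (isMeasurableFun.Build _ _ _ _ _ mXY).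
have mZC : measurable (Z @^-1` C) by rewrite -[X in measurable X]setTI; exact: mZ.
have r0 : 0 <= fine (P (Z @^-1` C)) by rewrite fine_ge0.
pose m1 := pushforward (mrestr P mZC) f.
pose m2 := mscale (NngNum r0) (distribution P f).
pose G : set (set (R * R)) :=
  [set A1 `*` A2 | A1 in measurable & A2 in measurable].
have key E : measurable E -> m1 E = m2 E.
  apply: (measure_unique G (fun=> setT)).
  - exact: measurable_prod_measurableType.
  - move=> _ _ [A1 mA1 [A2 mA2 <-]] [B1 mB1 [B2 mB2 <-]].
    rewrite -setXI; exists (A1 `&` B1); first exact: measurableI.
    by exists (A2 `&` B2) => //; exact: measurableI.
  - by move=> _; exists setT => //; exists setT => //; rewrite setXTT.
  - by rewrite bigcup_const//; exists 0%N.
  - move=> _ [A1 mA1 [A2 mA2 <-]].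
    change (P (X @^-1` A1 `&` Y @^-1` A2 `&` Z @^-1` C) =
      ((fine (P (Z @^-1` C)))%:E * P (X @^-1` A1 `&` Y @^-1` A2))%E).
    by rewrite XYZ// muleC fineK// fin_num_measure.
  - move=> _; rewrite /m1 /pushforward /mrestr/= (le_lt_trans _ (ltry 1))//.
    apply: probability_le1; apply: measurableI => //; rewrite preimage_setT; exact: measurableT.
have mE : measurable [set z : R * R | A (z.1 * z.2)].
  have -> : [set z : R * R | A (z.1 * z.2)] = setT `&` (fun z => z.1 * z.2) @^-1` A.
    by rewrite setTI.
  by apply: measurable_funM.
have := key _ mE.
change (P ((fun w => X w * Y w) @^-1` A `&` Z @^-1` C) =
  ((fine (P (Z @^-1` C)))%:E * P ((fun w => (X w * Y w)%R) @^-1` A))%E -> 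
  P ((fun w => X w * Y w) @^-1` A `&` Z @^-1` C) =
  (P ((fun w => (X w * Y w)%R) @^-1` A) * P (Z @^-1` C))%E).
by move=> ->; rewrite muleC fineK// fin_num_measure.
Qed.

End Independence.

(** * Brownian increments and martingale transforms *)

Section Adapted.
Context {R : realType} {d : measure_display} {Omega : measurableType d}.
Variables (F : R -> set (set Omega)).
Hypothesis hF : filtration F.
Implicit Types f g : Omega -> R.

(** Adaptedness is measurability for another sigma-algebra on [Omega], so it
    inherits the closure properties of measurable functions. *)
Lemma mwrtP (G : set (set Omega)) f : sigma_algebra setT G ->
  measurable_wrt G f <->
  @measurable_fun _ _ (g_sigma_algebraType G) R setT f.
Proof.
move=> sG; split=> [h _ A mA|h A mA].
  by rewrite setTI /measurable/= (sigma_algebra_id sG); exact: h.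
have := h measurableT A mA.
by rewrite setTI /measurable/= (sigma_algebra_id sG).
Qed.

Lemma mwrt_meas t f : 0 <= t -> measurable_wrt (F t) f -> measurable_fun setT f.
Proof.
move=> t0 h _ A mA; rewrite setTI; case: hF => _ /(_ t t0) sub _.
exact/sub/h.
Qed.

Lemma mwrt_mono s t f : 0 <= s -> s <= t ->
  measurable_wrt (F s) f -> measurable_wrt (F t) f.
Proof.
by move=> s0 st h A mA; case: hF => _ _ /(_ s t s0 st); apply; exact: h.
Qed.

Lemma mwrtD t f g : 0 <= t -> measurable_wrt (F t) f -> measurable_wrt (F t) g ->
  measurable_wrt (F t) (fun w => f w + g w).
Proof.
move=> t0; have sF : sigma_algebra setT (F t) by case: hF => h _ _; exact: h.
move=> /(mwrtP _ sF) mf /(mwrtP _ sF) mg; apply/(mwrtP _ sF).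
exact: measurable_funD.
Qed.

Lemma mwrtM t f g : 0 <= t -> measurable_wrt (F t) f -> measurable_wrt (F t) g ->
  measurable_wrt (F t) (fun w => f w * g w).
Proof.
move=> t0; have sF : sigma_algebra setT (F t) by case: hF => h _ _; exact: h.
move=> /(mwrtP _ sF) mf /(mwrtP _ sF) mg; apply/(mwrtP _ sF).
exact: measurable_funM.
Qed.

Lemma mwrt_cst t (c : R) : 0 <= t -> measurable_wrt (F t) (fun=> c).
Proof.
move=> t0; have sF : sigma_algebra setT (F t) by case: hF => h _ _; exact: h.
by apply/(mwrtP _ sF).
Qed.

Lemma mwrtB t f g : 0 <= t -> measurable_wrt (F t) f -> measurable_wrt (F t) g ->
  measurable_wrt (F t) (fun w => f w - g w).
Proof.
move=> t0 mf mg.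
have -> : (fun w => f w - g w) = (fun w => f w + (-1) * g w).
  by apply/funext => w; rewrite mulN1r.
by apply: mwrtD => //; apply: mwrtM => //; exact: mwrt_cst.
Qed.

Lemma mwrt_sum t (I : Type) (s : seq I) (p : pred I) (h : I -> Omega -> R) :
  0 <= t -> (forall i, p i -> measurable_wrt (F t) (h i)) ->
  measurable_wrt (F t) (fun w => \sum_(i <- s | p i) h i w).
Proof.
move=> t0 ih; elim: s => [|i s IH].
  rewrite [X in measurable_wrt _ X](_ : _ = fun=> 0); first exact: mwrt_cst.
  by apply/funext => w; rewrite big_nil.
case pi: (p i); last first.
  rewrite [X in measurable_wrt _ X](_ : _ = fun w => \sum_(i <- s | p i) h i w)//.
  by apply/funext => w; rewrite big_cons pi.
rewrite [X in measurable_wrt _ X]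
  (_ : _ = fun w => h i w + \sum_(i <- s | p i) h i w).
  by apply: mwrtD => //; exact: ih.
by apply/funext => w; rewrite big_cons pi.
Qed.

End Adapted.

Section Brownian_increments.
Context {R : realType} {d : measure_display} {Omega : measurableType d}.
Variables (P : probability Omega R) (F : R -> set (set Omega)).
Variable B : nat -> R -> Omega -> R.
Hypothesis hF : filtration F.
Hypothesis hB : independent_brownian_motions P F B.
Implicit Types (X Y Z : Omega -> R) (m : nat) (s t : R).

Notation leb := (@lebesgue_measure R).
Notation inc m s t := (increment (B m) s t).
Notation L1 := (itg P setT).
Notation L2 := (sqi P setT).

Lemma inc_mwrt m s t : 0 <= s -> s <= t -> measurable_wrt (F t) (inc m s t).
Proof.
move=> s0 st; have t0 := le_trans s0 st.
apply: (mwrtB hF) => //; first exact: (bm_adapted hB).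
by apply: (mwrt_mono hF s0 st); exact: (bm_adapted hB).
Qed.

Lemma inc_meas m s t : 0 <= s -> s <= t -> measurable_fun setT (inc m s t).
Proof.
by move=> s0 st; apply: (mwrt_meas hF (le_trans s0 st)); exact: inc_mwrt.
Qed.

Section Law.
Variables (m : nat) (s t : R).
Hypotheses (s0 : 0 <= s) (st : s < t).
Let sg := Num.sqrt (t - s).
Let p := normal_pdf 0 sg.

Lemma ge0_integral_inc (f : R -> R) : (forall x, 0 <= f x) ->
  measurable_fun setT f ->
  (\int[P]_w (f (inc m s t w))%:E = \int[leb]_x (f x * p x)%:E)%E.
Proof.
move=> f0 mf.
have mi := inc_meas m s0 (ltW st).
have mi' : @measurable_fun _ _ Omega (measurableTypeR R) setT (inc m s t).
  by move=> _ A mA; apply: mi.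
pose X : {RV P >-> measurableTypeR R} := HB.pack
  (inc m s t : Omega -> measurableTypeR R)
  (isMeasurableFun.Build _ _ _ _ _ mi').
transitivity (\int[distribution P X]_x (f x)%:E)%E.
  by rewrite ge0_integral_distribution//; exact/measurable_EFinP.
transitivity (\int[normal_prob 0 sg]_x (f x)%:E)%E; last first.
  by rewrite ge0_integral_normal//; exact/measurable_EFinP.
by apply: eq_measure_integral => A mA _; exact: (bm_normal hB m s0 st mA).
Qed.

(** The law determines the integrals of nonnegative functions, and hence those
    of the positive and negative parts of [f]. *)
Lemma itg_inc (f : R -> R) : measurable_fun setT f ->
  itg leb setT (fun x => f x * p x) ->
  L1 (fun w => f (inc m s t w)) /\
  \int[P]_w f (inc m s t w) = \int[leb]_x (f x * p x).
Proof.
move=> mf fi.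
have mi := inc_meas m s0 (ltW st).
have p0 x : 0 <= p x by exact: normal_pdf_ge0.
have mp : measurable_fun setT p by exact: measurable_normal_pdf.
have aux (g : R -> R) : (forall x, 0 <= g x) -> (forall x, g x <= `|f x|) ->
    measurable_fun setT g ->
    [/\ L1 (fun w => g (inc m s t w)), itg leb setT (fun x => g x * p x) &
    \int[P]_w g (inc m s t w) = \int[leb]_x (g x * p x)].
  move=> g0 gf mg.
  have gi : itg leb setT (fun x => g x * p x).
    apply: (@itg_le _ _ R leb setT measurableT _ (fun x => `|f x * p x|)).
    - exact: measurable_funM.
    - exact: itg_norm.
    - move=> x _; rewrite ger0_norm ?mulr_ge0// normrM (ger0_norm (p0 x)).
      by rewrite ler_wpM2r.
  split => //; last by rewrite /Rintegral ge0_integral_inc.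
  apply: ge0_itg => //; first exact: measurableT_comp.
  rewrite ge0_integral_inc//; exact: (integrable_lty measurableT gi).
have [i1 j1 e1] := aux (fun x => Num.max (f x) 0)
  (fun x => ltac:(by rewrite le_max lexx orbT))
  (fun x => ltac:(by rewrite ge_max ler_norm normr_ge0))
  ltac:(by apply: measurable_maxr).
have [i2 j2 e2] := aux (fun x => Num.max (- f x) 0)
  (fun x => ltac:(by rewrite le_max lexx orbT))
  (fun x => ltac:(by rewrite ge_max -normrN ler_norm normr_ge0))
  ltac:(by apply: measurable_maxr => //; exact: measurableT_comp).
have fE x : f x = Num.max (f x) 0 - Num.max (- f x) 0.
  have [h|h] := leP (f x) 0.
    by rewrite max_l ?oppr_ge0// sub0r opprK.
  by rewrite max_r ?subr0// oppr_le0 ltW.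
split.
  by apply: itg_eq (itgB measurableT i1 i2) => // w _; rewrite -fE.
under eq_Rintegral => w _ do rewrite fE.
rewrite RintB// e1 e2 -RintB//; apply: eq_Rintegral => x _.
by rewrite -mulrBl -fE.
Qed.

End Law.

Lemma inc_refl m s : inc m s s = fun=> 0.
Proof. by apply/funext => w; rewrite /increment subrr. Qed.

Lemma inc_moments m s t : 0 <= s -> s <= t ->
  [/\ L1 (inc m s t), L2 (inc m s t), L1 (fun w => inc m s t w ^+ 4),
    \int[P]_w inc m s t w = 0 & \int[P]_w inc m s t w ^+ 2 = t - s] /\
    \int[P]_w inc m s t w ^+ 4 <= 128 * (t - s) ^+ 2.
Proof.
move=> s0; rewrite le_eqVlt => /predU1P[<-|st].
  have c0 : \int[P]_w (0 : R) = 0 by rewrite Rintegral_cst// mul0r.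
  have c2 : \int[P]_w ((0 : R) ^+ 2) = 0 by rewrite expr0n.
  have c4 : \int[P]_w ((0 : R) ^+ 4) = 0 by rewrite expr0n.
  rewrite inc_refl subrr; do !split => //; rewrite ?c2 ?c4 ?expr0n ?mulr0//.
  - exact: itg0.
  - by apply: itg_eq (itg0 _ _) => // x _; rewrite expr0n.
  - by apply: itg_eq (itg0 _ _) => // x _; rewrite expr0n.
have ts : 0 < t - s by rewrite subr_gt0.
have sg0 : 0 < Num.sqrt (t - s) by rewrite sqrtr_gt0.
have [[h1 h2 h4 e1 e2] e4] := normal_moments sg0.
rewrite sqr_sqrtr ?ltW// in e2.
have s4 : Num.sqrt (t - s) ^+ 4 = (t - s) ^+ 2.
  by rewrite -[4%N]/(2 * 2)%N exprM sqr_sqrtr// ltW.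
rewrite s4 in e4.
have [i1 E1] := itg_inc m s0 st (@measurable_id _ _ setT) h1.
have [i2 E2] := itg_inc m s0 st (measurable_funX 2 (@measurable_id _ _ setT)) h2.
have [i4 E4] := itg_inc m s0 st (measurable_funX 4 (@measurable_id _ _ setT)) h4.
rewrite /= in i1 i2 i4 E1 E2 E4.
by rewrite E1 E2 E4; do !split => //; exact: itg_meas i1.
Qed.

Lemma inc_indep3 Z m m' s t : 0 <= s -> s <= t -> m != m' ->
  measurable_wrt (F s) Z ->
  forall A C D : set R, measurable A -> measurable C -> measurable D ->
   P (Z @^-1` A `&` inc m s t @^-1` C `&` inc m' s t @^-1` D) =
   (P (Z @^-1` A) * P (inc m s t @^-1` C) * P (inc m' s t @^-1` D))%E.
Proof.
move=> s0 st mm mZ A C D mA mC mD.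
pose n := (maxn m m').+1.
(* Full events at the other indices turn the joint independence of all the
   motions into a statement about two of them. *)
pose E j := if j == m then C else if j == m' then D else setT.
have mE j : measurable (E j) by rewrite /E; case: ifP => // _; case: ifP.
have := bm_indep hB s0 st n (mZ _ mA) mE.
have -> : \bigcap_(j < n) (inc j s t @^-1` E j) =
    inc m s t @^-1` C `&` inc m' s t @^-1` D.
  apply/seteqP; split=> [w h|w [hC hD] j _].
    split.
      by have := h m; rewrite /E eqxx; apply; rewrite /= /n ltnS leq_maxl.
    have := h m'; rewrite /E eqxx eq_sym (negbTE mm).
    by apply; rewrite /= /n ltnS leq_maxr.
  rewrite /E; case: eqP => [->//|_]; case: eqP => [->//|_] //.
rewrite setIA => ->.
have mn : (m < n)%N by rewrite /n ltnS leq_maxl.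
have mn' : (m' < n)%N by rewrite /n ltnS leq_maxr.
rewrite (bigD1 (Ordinal mn))//= (bigD1 (Ordinal mn'))/=; last first.
  by rewrite -val_eqE/= eq_sym.
rewrite big1 ?mule1; last first.
  move=> j /andP[jm jm']; rewrite /E.
  rewrite (_ : (j == m :> nat) = false); last exact/negbTE.
  rewrite (_ : (j == m' :> nat) = false); last exact/negbTE.
  by rewrite preimage_setT probability_setT.
by rewrite {1}/E eqxx /E eqxx eq_sym (negbTE mm) muleA.
Qed.

Lemma inc_indep2 Z m s t : 0 <= s -> s <= t ->
  measurable_wrt (F s) Z -> indep2 P Z (inc m s t).
Proof.
move=> s0 st mZ A C mA mC.
have mm : m != m.+1 by rewrite neq_ltn ltnSn.
have := inc_indep3 s0 st mm mZ mA mC measurableT.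
by rewrite !preimage_setT !setIT probability_setT mule1.
Qed.

(** The factor [Z] belongs to the past of [s], hence is independent of the
    increment, which is centred. *)
Lemma Rintegral_mul_inc Z m s t : 0 <= s -> s <= t ->
  measurable_wrt (F s) Z -> L1 Z ->
  L1 (fun w => Z w * inc m s t w) /\ \int[P]_w (Z w * inc m s t w) = 0.
Proof.
move=> s0 st mZ iZ; have [[i1 _ _ e1 _] _] := inc_moments m s0 st.
have [i e] := Rintegral_indepM (itg_meas iZ) (itg_meas i1)
  (inc_indep2 _ s0 st mZ) iZ i1.
by split => //; rewrite e e1 mulr0.
Qed.

Lemma Rintegral_mul_inc_sqr Z m s t : 0 <= s -> s <= t ->
  measurable_wrt (F s) Z -> L1 Z ->
  L1 (fun w => Z w * inc m s t w ^+ 2) /\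
  \int[P]_w (Z w * inc m s t w ^+ 2) = (t - s) * \int[P]_w Z w.
Proof.
move=> s0 st mZ iZ; have [[i1 [m1 i2] _ _ e2] _] := inc_moments m s0 st.
have ind : indep2 P Z (fun w => inc m s t w ^+ 2).
  move=> A C mA mC.
  have mC' : measurable ((fun x : R => x ^+ 2) @^-1` C).
    by rewrite -[X in measurable X]setTI; apply: measurable_funX.
  exact: (inc_indep2 m s0 st mZ mA mC').
have [i e] := Rintegral_indepM (itg_meas iZ) (itg_meas i2) ind iZ i2.
by split => //; rewrite e e2 mulrC.
Qed.

Lemma Rintegral_mul_inc_inc Z m m' s t : 0 <= s -> s <= t -> m != m' ->
  measurable_wrt (F s) Z -> L1 Z ->
  L1 (fun w => Z w * inc m s t w * inc m' s t w) /\
  \int[P]_w (Z w * inc m s t w * inc m' s t w) = 0.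
Proof.
move=> s0 st mm mZ iZ.
have [iZm _] := Rintegral_mul_inc m s0 st mZ iZ.
have [[i1 _ _ e1 _] _] := inc_moments m' s0 st.
have [[im _ _ _ _] _] := inc_moments m s0 st.
have ind : indep2 P (fun w => Z w * inc m s t w) (inc m' s t).
  apply: indep_mul; [exact: itg_meas iZ|exact: itg_meas im|exact: itg_meas i1|].
  by move=> A C D mA mC mD; rewrite inc_indep3// (inc_indep2 _ s0 st mZ).
have [i e] := Rintegral_indepM (itg_meas iZm) (itg_meas i1) ind iZm i1.
by split => //; rewrite e e1 mulr0.
Qed.

End Brownian_increments.

Section Martingale_transform.
Context {R : realType} {d : measure_display} {Omega : measurableType d}.
Variables (P : probability Omega R) (F : R -> set (set Omega)).
Variable B : nat -> R -> Omega -> R.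
Hypothesis hF : filtration F.
Hypothesis hB : independent_brownian_motions P F B.

Notation inc m s t := (increment (B m) s t).
Notation L1 := (itg P setT).
Notation L2 := (sqi P setT).
Let mT := @measurableT _ Omega.

Lemma sqi_mul_inc (Y : Omega -> R) m s t : 0 <= s -> s <= t ->
  measurable_wrt (F s) Y -> L2 Y -> L2 (fun w => Y w * inc m s t w).
Proof.
move=> s0 st aY [mY iY]; split.
  by apply: measurable_funM => //; exact: (inc_meas hF hB).
have [i _] := Rintegral_mul_inc_sqr hF hB m s0 st (mwrtM hF s0 aY aY) iY.
by apply: (itg_eq mT _ i) => w _; rewrite exprMn expr2.
Qed.

(** The cross terms of the square vanish because two different motions have
    uncorrelated increments given the past. *)
Lemma sum_inc_isometry (M : nat) (Y : nat -> Omega -> R) s t :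
  0 <= s -> s <= t ->
  (forall m, (m < M)%N -> measurable_wrt (F s) (Y m)) ->
  (forall m, (m < M)%N -> L2 (Y m)) ->
  let D w := \sum_(m < M) Y m w * inc m s t w in
  [/\ L2 D,
    \int[P]_w D w ^+ 2 = \sum_(m < M) (t - s) * \int[P]_w Y m w ^+ 2 &
    forall Z, measurable_wrt (F s) Z -> L2 Z -> \int[P]_w (Z w * D w) = 0].
Proof.
move=> s0 st aY sY D.
have s1 (m : 'I_M) : L2 (fun w => Y m w * inc m s t w).
  by apply: sqi_mul_inc => //; [exact: aY|exact: sY].
split.
- by apply: (sqi_sum mT) => m _; exact: s1.
- transitivity (\int[P]_w (\sum_(m < M) \sum_(m' < M)
      (Y m w * inc m s t w) * (Y m' w * inc m' s t w))).
    by apply: eq_Rintegral => w _; rewrite expr2 /D big_distrlr.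
  have i2 (m m' : 'I_M) :
      L1 (fun w => (Y m w * inc m s t w) * (Y m' w * inc m' s t w)).
    by apply: (sqiM_itg mT); exact: s1.
  rewrite (Rintegral_sum mT); last first.
    by move=> m _; apply: (itg_sum mT) => m' _; exact: i2.
  apply: eq_bigr => m _; rewrite (Rintegral_sum mT); last by move=> m' _; exact: i2.
  rewrite (bigD1 m)//= big1 ?addr0.
    have [_ iY] := sY m (ltn_ord m).
    have aY2 := mwrtM hF s0 (aY m (ltn_ord m)) (aY m (ltn_ord m)).
    have [_ e] := Rintegral_mul_inc_sqr hF hB m s0 st aY2 iY.
    by rewrite -e; apply: eq_Rintegral => w _; ring.
  move=> m' mm'.
  have mm : (m : nat) != m' by rewrite eq_sym.
  have aYY := mwrtM hF s0 (aY m (ltn_ord m)) (aY m' (ltn_ord m')).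
  have iYY := sqiM_itg mT (sY m (ltn_ord m)) (sY m' (ltn_ord m')).
  have [_ e] := Rintegral_mul_inc_inc hF hB s0 st mm aYY iYY.
  by rewrite -e; apply: eq_Rintegral => w _; ring.
- move=> Z aZ sZ.
  transitivity (\int[P]_w (\sum_(m < M) (Z w * Y m w) * inc m s t w)).
    apply: eq_Rintegral => w _; rewrite /D mulr_sumr.
    by apply: eq_bigr => m _; ring.
  have h (m : 'I_M) := Rintegral_mul_inc hF hB m s0 st
    (mwrtM hF s0 aZ (aY m (ltn_ord m))) (sqiM_itg mT sZ (sY m (ltn_ord m))).
  rewrite (Rintegral_sum mT); last by move=> m _; case: (h m).
  by rewrite big1// => m _; case: (h m).
Qed.

(** Ito's isometry for step processes, by induction on the number of steps: the
    last step is orthogonal to all square integrable functions of its past, in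
    particular to the sum of the previous ones. *)
Lemma transform_isometry (tau : nat -> R) (n M : nat)
    (Y : nat -> nat -> Omega -> R) :
  0 <= tau 0 -> (forall i, (i < n)%N -> tau i <= tau i.+1) ->
  (forall i m, (i < n)%N -> (m < M)%N -> measurable_wrt (F (tau i)) (Y i m)) ->
  (forall i m, (i < n)%N -> (m < M)%N -> L2 (Y i m)) ->
  let S w := \sum_(i < n) \sum_(m < M) Y i m w * inc m (tau i) (tau i.+1) w in
  [/\ measurable_wrt (F (tau n)) S, L2 S, \int[P]_w S w = 0 &
    \int[P]_w S w ^+ 2 =
      \sum_(i < n) \sum_(m < M) (tau i.+1 - tau i) * \int[P]_w Y i m w ^+ 2].
Proof.
move=> t0; elim: n => [|n IH] tnd aY sY S.
  rewrite big_ord0; split.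
  - rewrite [S](_ : _ = fun=> 0); first exact: (mwrt_cst hF).
    by apply/funext => w; rewrite /S big_ord0.
  - by apply: (sqi_eq mT _ (sqi0 P mT)) => w _; rewrite /S big_ord0.
  - transitivity (\int[P]_w (0 : R)); last by rewrite Rintegral_cst// mul0r.
    by apply: eq_Rintegral => w _; rewrite /S big_ord0.
  - transitivity (\int[P]_w (0 : R)); last by rewrite Rintegral_cst// mul0r.
    by apply: eq_Rintegral => w _; rewrite /S big_ord0 expr0n.
have [|||aS sS eS eS2] := IH.
- by move=> i iln; apply: tnd; exact: leqW.
- by move=> i m iln; apply: aY; exact: leqW.
- by move=> i m iln; apply: sY; exact: leqW.
set S' := fun w => \sum_(i < n) _ in aS sS eS eS2.
have tau_ge0 k : (k <= n)%N -> 0 <= tau k.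
  elim: k => // k IHk kn; rewrite (le_trans (IHk (ltnW kn)))// tnd//.
  exact: ltnW.
have tn0 := tau_ge0 n (leqnn n).
have tn1 := tnd n (ltnSn n).
have [sD eD ZD] := sum_inc_isometry tn0 tn1
  (fun m mM => aY n m (ltnSn n) mM) (fun m mM => sY n m (ltnSn n) mM).
set D := fun w => \sum_(m < M) _ in sD eD ZD.
have SE w : S w = S' w + D w by rewrite /S big_ord_recr.
have aD : measurable_wrt (F (tau n.+1)) D.
  apply: (mwrt_sum hF); first exact: le_trans tn1.
  move=> m _; apply: (mwrtM hF); first exact: le_trans tn1.
    by apply: (mwrt_mono hF tn0 tn1); exact: aY.
  exact: (inc_mwrt hF hB).
have fP : (P setT < +oo)%E by rewrite probability_setT ltry.
split.
- rewrite [S](_ : _ = fun w => S' w + D w); last exact/funext.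
  apply: (mwrtD hF) => //; first exact: le_trans tn1.
  exact: (mwrt_mono hF tn0 tn1).
- by apply: (sqi_eq mT _ (sqiD mT sS sD)) => w _; rewrite SE.
- under eq_Rintegral do rewrite SE.
  rewrite (RintD mT)//; [|exact: (sqi_itg mT)|exact: (sqi_itg mT)].
  rewrite eS add0r -(ZD (fun=> 1)).
  + by apply: eq_Rintegral => w _; rewrite mul1r.
  + exact: (mwrt_cst hF).
  + exact: sqi_cst.
- rewrite big_ord_recr/= -eS2 -eD.
  transitivity (\int[P]_w (S' w ^+ 2 + 2 * (S' w * D w) + D w ^+ 2)).
    by apply: eq_Rintegral => w _; rewrite SE; ring.
  have iSD := sqiM_itg mT sS sD.
  rewrite (RintD mT); last 2 first.
  + by apply: (itgD mT); [exact: sqi_itg2|exact: itgZ].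
  + exact: sqi_itg2.
  rewrite (RintD mT); last 2 first.
  + exact: sqi_itg2.
  + exact: itgZ.
  by rewrite (RintZ mT)// ZD// mulr0 addr0.
Qed.

Lemma transform1_isometry (m : nat) (tau : nat -> R) (n : nat)
    (Y : nat -> Omega -> R) :
  0 <= tau 0 -> (forall i, (i < n)%N -> tau i <= tau i.+1) ->
  (forall i, (i < n)%N -> measurable_wrt (F (tau i)) (Y i)) ->
  (forall i, (i < n)%N -> L2 (Y i)) ->
  let S w := \sum_(i < n) Y i w * inc m (tau i) (tau i.+1) w in
  [/\ L2 S, \int[P]_w S w = 0 &
    \int[P]_w S w ^+ 2 =
      \sum_(i < n) (tau i.+1 - tau i) * \int[P]_w Y i w ^+ 2].
Proof.
move=> t0 tnd aY sY S.
(* A transform of a single motion is one of several motions with all other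
   integrands zero. *)
pose Y' i j : Omega -> R := if j == m then Y i else fun=> 0.
have tau_ge0 k : (k <= n)%N -> 0 <= tau k.
  by elim: k => // k IHk kn; rewrite (le_trans (IHk (ltnW kn)))// tnd.
have [||_ h1 h2 h3] := @transform_isometry tau n m.+1 Y' t0 tnd.
- move=> i j iln _; rewrite /Y'; case: ifP => _; first exact: aY.
  by apply: (mwrt_cst hF); exact: tau_ge0 (ltnW iln).
- move=> i j iln _; rewrite /Y'; case: ifP => _; first exact: sY.
  exact: (sqi0 P mT).
have SE w : \sum_(i < n) \sum_(j < m.+1) Y' i j w * inc j (tau i) (tau i.+1) w =
    S w.
  apply: eq_bigr => i _; rewrite big_ord_recr/= /Y' eqxx big1 ?add0r// => j _.
  by rewrite (ltn_eqF (ltn_ord j)) mul0r.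
split.
- by apply: (sqi_eq mT _ h1) => w _; rewrite SE.
- by rewrite -h2; apply: eq_Rintegral => w _; rewrite SE.
- transitivity (\int[P]_w (\sum_(i < n) \sum_(j < m.+1)
    Y' i j w * inc j (tau i) (tau i.+1) w) ^+ 2).
    by apply: eq_Rintegral => w _; rewrite SE.
  rewrite h3; apply: eq_bigr => i _.
  rewrite big_ord_recr/= /Y' eqxx big1 ?add0r// => j _.
  rewrite (ltn_eqF (ltn_ord j)) (_ : \int[P]_w _ = 0) ?mulr0//.
  by rewrite expr0n/= Rintegral_cst// mul0r.
Qed.

End Martingale_transform.

(** * Ito integrals of constants and of mean-square Lipschitz processes *)

Section Step_functions.
Context {R : realType}.
Variables (tau : nat -> R) (n : nat).
Hypothesis tnd : forall i, (i < n)%N -> tau i <= tau i.+1.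
Implicit Types (y : nat -> R) (s : R).

Notation ind i := (\1_(`]tau i, tau i.+1]) : R -> R).

Lemma nodes_le i j : (i <= j <= n)%N -> tau i <= tau j.
Proof.
move=> /andP[ij jn]; elim: j ij jn => [|j IH]; first by rewrite leqn0 => /eqP->.
rewrite leq_eqVlt => /predU1P[->//|]; rewrite ltnS => ij jn.
by rewrite (le_trans (IH ij (ltnW jn)))// tnd.
Qed.

(** A difference of two threshold functions, so that sums over consecutive
    intervals telescope. *)
Lemma step_indic i s : (i < n)%N ->
  ind i s = (s <= tau i.+1)%R%:R - (s <= tau i)%R%:R.
Proof.
move=> iln; rewrite indicE; have [si|si] := leP s (tau i).
  rewrite (le_trans si (tnd iln)) subrr memNset//=.
  by rewrite in_itv/= ltNge si.
have [si'|si'] := leP s (tau i.+1).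
  by rewrite mem_set ?subr0//= in_itv/= si si'.
by rewrite memNset ?subr0//= in_itv/= [X in _ && X]leNgt si' andbF.
Qed.

Lemma sum_step_indic s : \sum_(i < n) ind i s = (s <= tau n)%R%:R - (s <= tau 0)%R%:R.
Proof.
transitivity (\sum_(0 <= i < n) (((s <= tau i.+1)%R%:R : R) - (s <= tau i)%R%:R)).
  by rewrite big_mkord; apply: eq_bigr => i _; rewrite step_indic.
by rewrite telescope_sumr.
Qed.

Lemma sum_step_indic1 s : tau 0 < s -> s <= tau n -> \sum_(i < n) ind i s = 1.
Proof. by move=> s0 sn; rewrite sum_step_indic sn leNgt s0 subr0. Qed.

Lemma step_indicM i j s : (i < n)%N -> (j < n)%N -> i != j ->
  ind i s * ind j s = 0.
Proof.
move=> iln jn ij; wlog lij : i j iln jn ij / (i < j)%N.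
  move=> h; have [ij'|ji'] := ltnP i j; first exact: h.
  by rewrite mulrC h 1?eq_sym// ltn_neqAle eq_sym ij.
rewrite !indicE; case: (boolP (s \in _)); last by rewrite mul0r.
rewrite inE/= in_itv/= => /andP[_ si].
have sj : s <= tau j by apply: (le_trans si); apply: nodes_le; rewrite lij ltnW.
by rewrite memNset ?mulr0//= in_itv/= ltNge sj.
Qed.

Lemma sqr_step y s :
  (\sum_(i < n) y i * ind i s) ^+ 2 = \sum_(i < n) y i ^+ 2 * ind i s.
Proof.
rewrite expr2 big_distrlr/=; apply: eq_bigr => i _.
rewrite (bigD1 i)//= big1 ?addr0.
  have -> : y i * ind i s * (y i * ind i s) = y i ^+ 2 * (ind i s * ind i s) by ring.
  by rewrite indicE; case: (_ \in _); rewrite /= ?mulr1// mulr0.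
move=> j ji; have -> : y i * ind i s * (y j * ind j s) =
  y i * y j * (ind i s * ind j s) by ring.
by rewrite step_indicM ?mulr0// eq_sym.
Qed.

Lemma Rintegral_sqr_step y t : 0 <= tau 0 -> tau n <= t ->
  (\int[@lebesgue_measure R]_(s in `[0%R, t])
     ((\sum_(i < n) y i * ind i s) ^+ 2)%:E)%E =
  (\sum_(i < n) y i ^+ 2 * (tau i.+1 - tau i))%:E.
Proof.
move=> t0 tn.
under eq_integral => s _ do rewrite sqr_step -sumEFin.
rewrite ge0_integral_sum//; last 2 first.
- by move=> i; apply/measurable_EFinP; apply: measurable_funM.
- by move=> i s _; rewrite lee_fin mulr_ge0 ?sqr_ge0.
rewrite -sumEFin; apply: eq_bigr => i _.
under eq_integral => s _ do rewrite EFinM.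
rewrite ge0_integralZl//; last 2 first.
- by apply/measurable_EFinP; exact: measurable_indic.
- by rewrite lee_fin sqr_ge0.
rewrite integral_indic// [RHS]EFinM; congr (_ * _)%E.
have -> : `]tau i, tau i.+1] `&` `[0, t] = `]tau i, tau i.+1]%classic.
  apply/setIidPl => s /=; rewrite !in_itv/= => /andP[si si'].
  have h1 : tau i.+1 <= tau n by apply: nodes_le; rewrite leqnn andbT.
  have h2 : tau 0 <= tau i by apply: nodes_le => //=; exact: ltnW.
  by rewrite (le_trans (le_trans t0 h2) (ltW si)) (le_trans si' (le_trans h1 tn)).
etransitivity; first exact: lebesgue_measure_itv.
rewrite /= lte_fin; have := tnd (ltn_ord i).
by rewrite le_eqVlt => /predU1P[->|->//]; rewrite ltxx subrr.
Qed.

End Step_functions.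

Section Ito_integral_of_constant.
Context {R : realType} {d : measure_display} {Omega : measurableType d}.
Variables (P : probability Omega R) (F : R -> set (set Omega)).
Variable B : nat -> R -> Omega -> R.
Hypothesis hF : filtration F.
Hypothesis hB : independent_brownian_motions P F B.

Notation inc m s t := (increment (B m) s t).
Notation L2 := (sqi P setT).
Let mT := @measurableT _ Omega.

Lemma sp_time_ge0i t (H : simple_process P F t) i : (i <= sp_size H)%N ->
  0 <= sp_time H i.
Proof.
move=> iln; apply: (le_trans (sp_time_ge0 H)).
by apply: (@nodes_le _ _ (sp_size H)) => //; exact: sp_time_nd.
Qed.

Lemma sp_val_sqi t (H : simple_process P F t) i : (i < sp_size H)%N ->
  L2 (sp_val H i).
Proof.
move=> iln; apply/(sqiP _ mT); split; last exact: sp_val_L2.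
apply: (mwrt_meas hF (sp_time_ge0i (ltnW iln))).
exact: sp_val_adapted.
Qed.

Lemma sp_integral_meas m t (H : simple_process P F t) :
  L2 (sp_integral (B m) H).
Proof.
have [h _ _] := @transform1_isometry _ _ _ P F B hF hB m (sp_time H) (sp_size H)
  (sp_val H) (sp_time_ge0 H) (@sp_time_nd _ _ _ _ _ _ H)
  (@sp_val_adapted _ _ _ _ _ _ H) (@sp_val_sqi _ H).
exact: h.
Qed.

(** The difference between a simple process and the constant [c] is again a
    step process, on the nodes of the simple process completed by the end
    points 0 and [t]: this is why the isometry for step processes suffices. *)
Lemma sp_integral_cst_isometry m t (c : R) (H : simple_process P F t) :
  0 <= t ->
  (\int[P]_w \int[lebesgue_measure]_(s in `[0%R, t])
     ((sp_eval H s w - c) ^+ 2)%:E)%E =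
  (\int[P]_w ((sp_integral (B m) H w - c * inc m 0 t w) ^+ 2)%:E)%E.
Proof.
move=> t0; set n := sp_size H.
pose tau i := if i is j.+1 then (if (j <= n)%N then sp_time H j else t) else 0.
pose Y i w := if i is j.+1 then (if (j < n)%N then sp_val H j w - c else - c)
  else - c.
have tnd i : (i < n.+2)%N -> tau i <= tau i.+1.
  case: i => [_|i]; first by rewrite /tau/= sp_time_ge0.
  rewrite ltnS => iln /=; rewrite leq_eqVlt in iln.
  move: iln => /predU1P[[->]|]; first by rewrite leqnn ltnn sp_time_le.
  by rewrite ltnS => iln; rewrite (ltnW iln) iln sp_time_nd.
have tau0 i : (i <= n.+2)%N -> 0 <= tau i.
  by move=> iln; rewrite -[0]/(tau 0%N); apply: (@nodes_le _ tau n.+2).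
have aY i : (i < n.+2)%N -> measurable_wrt (F (tau i)) (Y i).
  case: i => [_|i iln]; first exact: (mwrt_cst hF).
  have ti := tau0 _ (ltnW iln).
  case: (boolP (i < n)%N) => [|/negbTE] iln'; rewrite /Y iln'; last exact: (mwrt_cst hF).
  have e : tau i.+1 = sp_time H i by rewrite /= (ltnW iln').
  rewrite e in ti *; apply: (mwrtB hF) => //; last exact: (mwrt_cst hF).
  exact: sp_val_adapted.
have sY i : (i < n.+2)%N -> L2 (Y i).
  have fP : (P setT < +oo)%E by rewrite probability_setT ltry.
  have sc : L2 (fun=> - c) := sqi_cst mT (- c) fP.
  case: i => [_|i iln]; first exact: sc.
  case: (boolP (i < n)%N) => [|/negbTE] iln'; rewrite /Y iln'; last exact: sc.
  by apply: (sqiD mT); [exact: sp_val_sqi|exact: sc].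
have YG (G : nat -> R) w : \sum_(i < n.+2) Y i w * G i =
    \sum_(i < n) sp_val H i w * G i.+1 - c * \sum_(i < n.+2) G i.
  rewrite -(big_mkord xpredT (fun i => Y i w * G i)) -(big_mkord xpredT G).
  rewrite -(big_mkord xpredT (fun i => sp_val H i w * G i.+1)).
  rewrite big_nat_recl// big_nat_recr//= ltnn.
  rewrite [X in _ - c * X]big_nat_recl// [X in _ - c * (_ + X)]big_nat_recr//=.
  rewrite (_ : \sum_(0 <= i < n) _ = \sum_(0 <= i < n) sp_val H i w * G i.+1 -
      c * \sum_(0 <= i < n) G i.+1); first by ring.
  rewrite mulr_sumr -sumrB; apply: eq_big_nat => i /andP[_ iln].
  by rewrite iln mulrBl.
have [sS _ eS] := transform1_isometry hF hB m (lexx 0) tnd aY sY.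
set S := fun w => \sum_(i < n.+2) _ in sS eS.
have SE w : S w = sp_integral (B m) H w - c * inc m 0 t w.
  have -> : inc m 0 t w = \sum_(i < n.+2) inc m (tau i) (tau i.+1) w.
    rewrite -(big_mkord xpredT (fun i => inc m (tau i) (tau i.+1) w)).
    by rewrite (telescope_sumr (fun i => B m (tau i) w))//= ltnn.
  rewrite /S (YG (fun i => inc m (tau i) (tau i.+1) w)); congr (_ - _).
  by apply: eq_bigr => i _ /=; rewrite ltn_ord (ltnW (ltn_ord i)).
transitivity (\int[P]_w (\sum_(i < n.+2) Y i w ^+ 2 * (tau i.+1 - tau i))%:E)%E.
  apply: eq_integral => w _.
  rewrite -(Rintegral_sqr_step tnd (Y^~ w) (lexx 0) (t := t)); last first.
    by rewrite /tau/= ltnn.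
  rewrite -[LHS]integral_itv_obnd_cbnd; last first.
    apply/measurable_EFinP; apply: measurable_funX; apply: measurable_funB => //.
    by apply: measurable_sum => i; apply: measurable_funM.
  rewrite -[RHS]integral_itv_obnd_cbnd; last first.
    apply/measurable_EFinP; apply: measurable_funX.
    by apply: measurable_sum => i; apply: measurable_funM.
  apply: eq_integral => s; rewrite inE/= in_itv/= => /andP[s0 st].
  congr ((_ ^+ 2)%:E).
  have e1 := @sum_step_indic1 _ tau n.+2 tnd s s0.
  transitivity (\sum_(i < n.+2) Y i w * \1_(`]tau i, tau i.+1]) s); last by [].
  rewrite (YG (fun i => \1_(`]tau i, tau i.+1]) s)).
  rewrite e1 ?mulr1; last by rewrite /tau/= ltnn.
  congr (_ - _); apply: eq_bigr => i _ /=.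
  by rewrite ltn_ord (ltnW (ltn_ord i)).
transitivity ((\int[P]_w S w ^+ 2)%:E).
  rewrite eS; under eq_integral do rewrite -sumEFin.
  rewrite integral_sum//; last first.
    move=> i; have [_ i2] := sY i (ltn_ord i).
    have := itgZ mT (tau i.+1 - tau i) i2.
    by apply: eq_integrable => // w _ /=; rewrite mulrC.
  rewrite -sumEFin; apply: eq_bigr => i _.
  have [_ i2] := sY i (ltn_ord i).
  rewrite -(RintZ mT)// -(EFin_Rintegral mT); last exact: itgZ.
  by apply: eq_integral => w _; rewrite mulrC.
rewrite -(EFin_Rintegral mT); last by case: sS.
by apply: eq_integral => w _; rewrite SE.
Qed.

Lemma L2_cvg_unique (Z : nat -> Omega -> R) (I I' : Omega -> R) :
  (forall n, measurable_fun setT (Z n)) -> measurable_fun setT I ->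
  measurable_fun setT I' -> L2_cvg P Z I -> L2_cvg P Z I' ->
  {ae P, forall w, I w = I' w}.
Proof.
move=> mZ mI mI' ZI ZI'.
have h0 : (\int[P]_w ((I w - I' w) ^+ 2)%:E = 0)%E.
  apply/eqP; rewrite eq_le; apply/andP; split; last first.
    by apply: integral_ge0 => w _; rewrite lee_fin sqr_ge0.
  have cv : (2%:E * (\int[P]_w ((Z n w - I w) ^+ 2)%:E) +
    2%:E * (\int[P]_w ((Z n w - I' w) ^+ 2)%:E))%E @[n --> \oo] --> 0%E.
    rewrite -[X in _ --> X]adde0 -[X in _ --> (X + _)%E](mule0 2%:E).
    rewrite -[X in _ --> (_ + X)%E](mule0 2%:E).
    by apply: cvgeD => //; apply: cvgeZl.
  rewrite -(cvg_lim _ cv)//; apply: lime_ge; first exact/cvgP/cv.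
  near=> n.
  rewrite -!ge0_integralZl//; last 4 first.
  - by apply/measurable_EFinP/measurable_funX/measurable_funB.
  - by move=> w _; rewrite lee_fin sqr_ge0.
  - by apply/measurable_EFinP/measurable_funX/measurable_funB.
  - by move=> w _; rewrite lee_fin sqr_ge0.
  rewrite -ge0_integralD//; last 4 first.
  - by move=> w _; rewrite -EFinM lee_fin mulr_ge0 ?sqr_ge0.
  - by apply/measurable_EFinP; apply: measurable_funM => //;
      apply/measurable_funX/measurable_funB.
  - by move=> w _; rewrite -EFinM lee_fin mulr_ge0 ?sqr_ge0.
  - by apply/measurable_EFinP; apply: measurable_funM => //;
      apply/measurable_funX/measurable_funB.
  apply: ge0_le_integral => //.
  - by move=> w _; rewrite lee_fin sqr_ge0.
  - by apply/measurable_EFinP/measurable_funX/measurable_funB.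
  - by apply: emeasurable_funD; apply/measurable_EFinP;
    apply: measurable_funM => //; apply/measurable_funX/measurable_funB.
  - move=> w _; rewrite -!EFinM -EFinD lee_fin.
    have := sqrD_le (I w - Z n w) (Z n w - I' w).
    rewrite addrA subrK -[(I w - Z n w) ^+ 2]sqrrN opprB.
    exact.
have := ae_eq_integral_abs P mT (f := fun w => ((I w - I' w) ^+ 2)%:E).
have mII : measurable_fun setT (fun w => ((I w - I' w) ^+ 2)%:E).
  by apply/measurable_EFinP/measurable_funX/measurable_funB.
move=> /(_ mII) [+ _].
under eq_integral do rewrite gee0_abs ?lee_fin ?sqr_ge0//.
move=> /(_ h0); apply: filterS => w /(_ Logic.I) /= -[] /eqP.
by rewrite sqrf_eq0 subr_eq0 => /eqP.
Unshelve. all: by end_near. Qed.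

(** By the isometry, the integrals of any simple processes that approximate the
    constant [c] converge to [c * inc m 0 t]. *)
Lemma is_ito_cst m t (c : R) (J : Omega -> R) : 0 <= t ->
  is_ito P F (B m) (fun _ _ => c) t J ->
  {ae P, forall w, J w = c * inc m 0 t w}.
Proof.
move=> t0 [_ _ mJ [H [hH HJ]]].
apply: (L2_cvg_unique _ mJ _ HJ).
- by move=> n; case: (sp_integral_meas m (H n)).
- by apply: measurable_funM => //; exact: (inc_meas hF hB).
- move: hH; rewrite /L2_cvg; apply: cvg_trans; apply: near_eq_cvg.
  by near=> n; rewrite (sp_integral_cst_isometry m).
Unshelve. all: by end_near. Qed.

End Ito_integral_of_constant.

Section Joint_measurability.
Context {R : realType} {d : measure_display} {Omega : measurableType d}.

Lemma cvg_floor_approx (s : R) :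
  (Num.floor (s * n.+1%:R))%:~R / n.+1%:R @[n --> \oo] --> s.
Proof.
apply/cvgrPdist_le => e e0.
have /cvgr0Pnorm_le/(_ _ e0) := @cvg_harmonic R.
apply: filterS => n; apply: le_trans.
have n0 : 0 < n.+1%:R :> R by rewrite ltr0n.
have /andP[h1 h2] := floor_itv (s * n.+1%:R).
rewrite /harmonic/= ger0_norm; last by rewrite subr_ge0 ler_pdivrMr.
rewrite ger0_norm ?invr_ge0 ?ler0n// lerBlDr -[X in X + _]mul1r -mulrDl.
by rewrite ler_pdivlMr// addrC -[1 in leRHS]/(1%:~R) -intrD ltW.
Qed.

(** A process with continuous paths is the pointwise limit of its values at the
    grid points preceding the time, as the grid is refined; these
    approximations are piecewise constant in time. *)
Lemma measurable_fun_caratheodory (X : R -> Omega -> R) :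
  (forall w, continuous (X^~ w)) -> (forall s, measurable_fun setT (X s)) ->
  measurable_fun setT (fun z : R * Omega => X z.1 z.2).
Proof.
move=> cX mX.
pose r n (s : R) : R := (Num.floor (s * n.+1%:R))%:~R / n.+1%:R.
apply: (@measurable_fun_cvg _ _ _ _ (fun n z => X (r n z.1) z.2)); last first.
  move=> -[s w] _ /=.
  apply: (@continuous_cvg _ _ _ _ _ (r^~ s) (X^~ w)); first exact: cX.
  exact: cvg_floor_approx.
move=> n _ A mA; rewrite setTI.
rewrite (_ : _ @^-1` A = \bigcup_(k : int)
   ([set s : R | Num.floor (s * n.+1%:R) = k] `*`
    (X (k%:~R / n.+1%:R) @^-1` A))); last first.
  apply/seteqP; split=> [[s w]/= h|[s w]/= [k _ [/= <-]]//].
  by exists (Num.floor (s * n.+1%:R)).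
apply: countable_bigcupT_measurable => // k.
apply: measurableX; last by rewrite -[X in measurable X]setTI; exact: mX.
have n0 : 0 < n.+1%:R :> R by rewrite ltr0n.
rewrite (_ : mkset _ = `[k%:~R / n.+1%:R, (k + 1)%:~R / n.+1%:R[%classic)//.
apply/seteqP; split=> s /=; rewrite in_itv/= ler_pdivrMr// ltr_pdivlMr//.
  by move=> <-; exact: floor_itv.
by move=> h; apply/eqP; rewrite floor_eq.
Qed.

Variable P : probability Omega R.
Notation leb := (@lebesgue_measure R).

Lemma tonelli_itv (f : R -> Omega -> R) (a b : R) :
  measurable_fun setT (fun z : R * Omega => f z.1 z.2) ->
  (forall s w, 0 <= f s w) ->
  (\int[P]_w \int[leb]_(s in `[a, b]) (f s w)%:E =
   \int[leb]_(s in `[a, b]) \int[P]_w (f s w)%:E)%E.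
Proof.
move=> mf f0.
pose g (z : measurableTypeR R * Omega) : \bar R :=
  (f z.1 z.2 * \1_(`[a, b]) z.1)%:E.
have mg : measurable_fun setT g.
  apply/measurable_EFinP; apply: measurable_funM.
    by move=> _ A mA; apply: mf.
  by apply: (measurableT_comp (measurable_indic _)).
have g0 z : (0 <= g z)%E by rewrite lee_fin mulr_ge0.
have := @fubini_tonelli _ _ _ _ R leb P g mg g0.
rewrite /g/= => e.
transitivity (\int[P]_w \int[leb]_s ((f s w * \1_(`[a, b]) s)%:E))%E.
  apply: eq_integral => w _; rewrite integral_mkcond; apply: eq_integral => s _.
  by rewrite patchE indicE; case: ifP; rewrite ?mulr1 ?mulr0.
rewrite -e [RHS]integral_mkcond; apply: eq_integral => s _.
rewrite patchE indicE; case: ifP => _.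
  by under eq_integral do rewrite mulr1.
by under eq_integral do rewrite mulr0; rewrite integral0.
Qed.

Lemma tonelli_itv_le (f : R -> Omega -> R) (a b c : R) :
  measurable_fun setT (fun z : R * Omega => f z.1 z.2) ->
  (forall s w, 0 <= f s w) -> a <= b ->
  (forall s, a < s -> s <= b -> (\int[P]_w (f s w)%:E <= c%:E)%E) ->
  (\int[P]_w \int[leb]_(s in `[a, b]) (f s w)%:E <= (c * (b - a))%:E)%E.
Proof.
move=> mf f0 ab fc; rewrite tonelli_itv//.
have mg : measurable_fun setT (fun s : R => \int[P]_w (f s w)%:E)%E.
  pose g (z : measurableTypeR R * Omega) : \bar R := (f z.1 z.2)%:E.
  have mg : measurable_fun setT g.
    by apply/measurable_EFinP; move=> _ A mA; apply: mf.
  have := @measurable_fun_fubini_tonelli_F _ _ _ _ R P g mg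
    (fun z => ltac:(by rewrite lee_fin)).
  by move=> h _ A mA; apply: h.
rewrite -integral_itv_obnd_cbnd; last exact: measurable_funTS.
apply: (@le_trans _ _ (\int[leb]_(s in `]a, b]) (cst c%:E s))%E).
  apply: ge0_le_integral => //.
  - by move=> s _; apply: integral_ge0 => w _; rewrite lee_fin.
  - exact: measurable_funTS.
  - by move=> s /=; rewrite in_itv/= => /andP[? ?]; exact: fc.
rewrite integral_cst//= EFinM le_eqVlt; apply/orP; left; apply/eqP.
congr (_ * _)%E.
etransitivity; first exact: lebesgue_measure_itv.
by rewrite /= lte_fin; move: ab; rewrite le_eqVlt => /predU1P[->|->//];
  rewrite ltxx subrr.
Qed.

End Joint_measurability.

Lemma big_ord_mul4 (V : zmodType) (N : nat) (g : nat -> V) :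
  \sum_(j < N * 4) g j = \sum_(i < N)
    (g (i * 4)%N + g (i * 4 + 1)%N + g (i * 4 + 2)%N + g (i * 4 + 3)%N).
Proof.
elim: N => [|N IH]; first by rewrite !big_ord0.
rewrite [RHS]big_ord_recr/= -IH -!(big_mkord xpredT g) mulSn addnC.
by rewrite 4!addnS addn0 !big_nat_recr//= !addrA.
Qed.

Section Ito_integral.
Context {R : realType} {d : measure_display} {Omega : measurableType d}.
Variables (P : probability Omega R) (F : R -> set (set Omega)).
Variable B : nat -> R -> Omega -> R.
Hypothesis hF : filtration F.
Hypothesis hB : independent_brownian_motions P F B.
Variable t : R.
Hypothesis t0 : 0 <= t.

Notation inc m s t := (increment (B m) s t).
Notation L2 := (sqi P setT).
Let mT := @measurableT _ Omega.

(** Each refinement divides the time steps by 4, so the variance of the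
    difference of two consecutive left sums decreases like [4 ^- n], as
    [sqi_cvg_fast] requires. *)
Definition mesh4 (n : nat) : R := t * 4^-1 ^+ n.
Definition node4 (n i : nat) : R := mesh4 n * i%:R.

Lemma mesh4_ge0 n : 0 <= mesh4 n.
Proof. by rewrite mulr_ge0// exprn_ge0// invr_ge0. Qed.

Lemma mesh4S n : mesh4 n = mesh4 n.+1 * 4.
Proof. by rewrite /mesh4 exprSr -!mulrA mulVf ?mulr1. Qed.

Lemma mesh4_sum n : (4 ^ n)%:R * mesh4 n = t.
Proof.
by rewrite /mesh4 natrX mulrCA -exprMn mulfV ?expr1n ?mulr1.
Qed.

Lemma node4_ge0 n i : 0 <= node4 n i.
Proof. by rewrite mulr_ge0 ?mesh4_ge0. Qed.

Lemma node4_le n i j : (i <= j)%N -> node4 n i <= node4 n j.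
Proof. by move=> ij; rewrite ler_wpM2l ?mesh4_ge0// ler_nat. Qed.

Lemma node4_last n : node4 n (4 ^ n) = t.
Proof. by rewrite /node4 mulrC mesh4_sum. Qed.

Lemma node4_let n i : (i <= 4 ^ n)%N -> node4 n i <= t.
Proof. by move=> h; rewrite -(node4_last n) node4_le. Qed.

Lemma node4_step n i : node4 n i.+1 - node4 n i = mesh4 n.
Proof. by rewrite /node4 -mulrBr -natrB// subSnn mulr1. Qed.

Lemma node4_refine n i : node4 n i = node4 n.+1 (i * 4).
Proof. by rewrite /node4 mesh4S natrM; ring. Qed.

Variables (m : nat) (X : R -> Omega -> R) (C : R).
Hypothesis cX : forall w, continuous (X^~ w).
Hypothesis mX : forall s, measurable_fun setT (X s).
Hypothesis aX : forall s, 0 <= s -> s <= t -> measurable_wrt (F s) (X s).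
Hypothesis sX : forall s, 0 <= s -> s <= t -> L2 (X s).
Hypothesis LX : forall r s, 0 <= r -> r <= s -> s <= t ->
  \int[P]_w (X s w - X r w) ^+ 2 <= C * (s - r).

Let sX' n i : (i < 4 ^ n)%N -> (\int[P]_w ((X (node4 n i) w) ^+ 2)%:E < +oo)%E.
Proof.
move=> h; have := sX (node4_ge0 n i) (node4_let (ltnW h)).
by move=> /(sqiP _ mT) [].
Qed.

Definition left_process n : simple_process P F t :=
  @SimpleProcess R d Omega P F t (4 ^ n) (node4 n) (fun i => X (node4 n i))
    (node4_ge0 n 0) (fun i _ => node4_le n (leqnSn i)) (node4_let (leqnn _))
    (fun i h => aX (node4_ge0 n i) (node4_let (ltnW h))) (@sX' n).

Definition left_sum n w : R :=
  \sum_(i < 4 ^ n) X (node4 n i) w * inc m (node4 n i) (node4 n i.+1) w.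

(* The Lipschitz bound says nothing about the sign of [C] when [t = 0]. *)
Let C_ge0 : t = 0 \/ 0 <= C.
Proof.
have [->|tn0] := eqVneq t 0; [by left|right].
have tp : 0 < t by rewrite lt_neqAle eq_sym tn0.
have := LX (lexx 0) t0 (lexx t).
rewrite subr0 => h; rewrite -(pmulr_lge0 _ tp) (le_trans _ h)//.
by apply: Rintegral_ge0 => w _; exact: sqr_ge0.
Qed.

(** On the finer partition, the difference of two consecutive left sums is a
    martingale transform, to which the isometry applies. *)
Lemma left_sum_refine n w : left_sum n w =
  \sum_(j < 4 ^ n.+1) X (node4 n (j %/ 4)) w *
     inc m (node4 n.+1 j) (node4 n.+1 j.+1) w.
Proof.
rewrite expnSr (big_ord_mul4 _ (fun j => X (node4 n (j %/ 4)) w *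
     inc m (node4 n.+1 j) (node4 n.+1 j.+1) w)).
apply: eq_bigr => i _.
rewrite mulnK// !divnMDl//= !addn0.
rewrite (node4_refine n i) (node4_refine n i.+1) mulSn addnC !addnS addn0.
rewrite /increment.
by ring.
Qed.

Lemma left_sum_sqi n : L2 (left_sum n).
Proof.
have [h _ _] := transform1_isometry hF hB m (node4_ge0 n 0)
  (fun i (_ : (i < 4 ^ n)%N) => node4_le n (leqnSn i))
  (fun i h => aX (node4_ge0 n i) (node4_let (ltnW h)))
  (fun i h => sX (node4_ge0 n i) (node4_let (ltnW h))).
exact: h.
Qed.

Lemma left_sum_fast n :
  \int[P]_w (left_sum n.+1 w - left_sum n w) ^+ 2 <= C * t ^+ 2 * 4^-1 ^+ n.
Proof.
pose Y j w := X (node4 n.+1 j) w - X (node4 n (j %/ 4)) w.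
have j4 j : (j %/ 4 * 4 <= j)%N by rewrite leq_divM.
have nj j : node4 n (j %/ 4) <= node4 n.+1 j.
  by rewrite (node4_refine n) node4_le.
have njd j : node4 n.+1 j - node4 n (j %/ 4) <= mesh4 n.
  rewrite (node4_refine n) /node4 -mulrBr (mesh4S n) ler_wpM2l ?mesh4_ge0//.
  rewrite -natrB// ler_nat {1}(divn_eq j 4) addKn.
  by rewrite ltnW// ltn_mod.
have aY j : (j < 4 ^ n.+1)%N -> measurable_wrt (F (node4 n.+1 j)) (Y j).
  move=> jn; have h := node4_let (ltnW jn).
  apply: (mwrtB hF); first exact: node4_ge0.
    by apply: aX => //; exact: node4_ge0.
  apply: (mwrt_mono hF (node4_ge0 n (j %/ 4)) (nj j)).
  by apply: aX; [exact: node4_ge0|exact: le_trans h].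
have sY j : (j < 4 ^ n.+1)%N -> L2 (Y j).
  move=> jn; have h := node4_let (ltnW jn).
  by apply: (sqiB mT); apply: sX; rewrite ?node4_ge0//; exact: le_trans h.
have [_ _ e] := transform1_isometry hF hB m (node4_ge0 n.+1 0)
  (fun i (_ : (i < 4 ^ n.+1)%N) => node4_le n.+1 (leqnSn i)) aY sY.
have -> : \int[P]_w (left_sum n.+1 w - left_sum n w) ^+ 2 =
    \int[P]_w (\sum_(j < 4 ^ n.+1) Y j w *
     inc m (node4 n.+1 j) (node4 n.+1 j.+1) w) ^+ 2.
  apply: eq_Rintegral => w _; rewrite (left_sum_refine n) /left_sum -sumrB.
  by congr (_ ^+ 2); apply: eq_bigr => j _; rewrite mulrBl.
rewrite e.
apply: (@le_trans _ _ (\sum_(j < 4 ^ n.+1) mesh4 n.+1 * (C * mesh4 n))).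
  apply: ler_sum => j _; rewrite node4_step ler_wpM2l ?mesh4_ge0//.
  have [z|c0] := C_ge0.
    have -> : mesh4 n = 0 by rewrite /mesh4 z mul0r.
    rewrite mulr0 (le_trans (LX _ (nj j) (node4_let (ltnW (ltn_ord j)))))//.
      exact: node4_ge0.
    suff -> : node4 n.+1 j - node4 n (j %/ 4) = 0 by rewrite mulr0.
    by rewrite /node4 /mesh4 z !mul0r subrr.
  rewrite (le_trans (LX _ (nj j) (node4_let (ltnW (ltn_ord j)))))//.
    exact: node4_ge0.
  by rewrite ler_wpM2l.
rewrite sumr_const card_ord -[X in X <= _]mulr_natl mulrA mesh4_sum /mesh4.
by rewrite le_eqVlt; apply/orP; left; apply/eqP; ring.
Qed.

Lemma left_process_cvg :
  (\int[P]_w \int[lebesgue_measure]_(s in `[0%R, t])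
     ((sp_eval (left_process n) s w - X s w) ^+ 2)%:E)%E @[n --> \oo] --> 0%E.
Proof.
apply: (@squeeze_cvge _ _ _ _ (fun=> 0%E) _
    (fun n => (C * t ^+ 2 * 4^-1 ^+ n)%:E)); last 2 first.
- exact: cvg_cst.
- apply: cvg_EFin; first by near=> n.
  rewrite -[X in _ --> X](mulr0 (C * t ^+ 2)).
  apply: cvgM; first exact: cvg_cst.
  by apply: cvg_expr; rewrite ger0_norm// invf_lt1// ltr1n.
near=> n; apply/andP; split.
  by apply: integral_ge0 => w _; apply: integral_ge0 => s _; rewrite lee_fin sqr_ge0.
have nd i (_ : (i < 4 ^ n)%N) := node4_le n (leqnSn i).
pose ind i s : R := \1_(`]node4 n i, node4 n i.+1]) s.
have -> : C * t ^+ 2 * 4^-1 ^+ n = (C * mesh4 n) * (t - 0) by rewrite /mesh4; ring.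
have mjX : measurable_fun setT (fun z : R * Omega => X z.1 z.2).
  exact: measurable_fun_caratheodory.
apply: tonelli_itv_le => //.
- apply: measurable_funX; apply: measurable_funB => //.
  apply: measurable_sum => i; apply: measurable_funM.
    by apply: (measurableT_comp (mX _)).
  by apply: (measurableT_comp (measurable_indic _)).
- by move=> s w; exact: sqr_ge0.
move=> s s0 st.
have e1 : \sum_(i < 4 ^ n) ind i s = 1.
  by apply: (sum_step_indic1 nd); rewrite ?node4_last// /node4 mulr0.
have E w : (sp_eval (left_process n) s w - X s w) ^+ 2 =
    \sum_(i < 4 ^ n) (X (node4 n i) w - X s w) ^+ 2 * ind i s.
  rewrite -(sqr_step nd (fun i => X (node4 n i) w - X s w)).
  congr (_ ^+ 2); rewrite /sp_eval/= -[X in _ - X]mulr1 -e1 mulr_sumr -sumrB.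
  by apply: eq_bigr => i _; rewrite mulrBl.
have sd (i : 'I_(4 ^ n)) : L2 (fun w => X (node4 n i) w - X s w).
  apply: (sqiB mT); apply: sX; rewrite ?node4_ge0 ?(ltW s0)//.
  exact/node4_let/ltnW.
have it (i : 'I_(4 ^ n)) : itg P setT
    (fun w => (X (node4 n i) w - X s w) ^+ 2 * ind i s).
  by apply: (itg_eq mT _ (itgZ mT (ind i s) (sqi_itg2 (sd i)))) => w _; rewrite mulrC.
under eq_integral do rewrite E.
rewrite EFin_Rintegral//; last exact: itg_sum.
rewrite lee_fin Rintegral_sum//.
apply: (@le_trans _ _ (\sum_(i < 4 ^ n) C * mesh4 n * ind i s)); last first.
  by rewrite -mulr_sumr e1 mulr1.
apply: ler_sum => i _.
under eq_Rintegral do rewrite mulrC.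
rewrite (RintZ mT); last exact: sqi_itg2 (sd i).
rewrite mulrC /ind indicE; case: (boolP (s \in _)); last by rewrite !mulr0.
rewrite inE/= in_itv/= => /andP[si si']; rewrite !mulr1.
have := LX (node4_ge0 n i) (ltW si) st.
under eq_Rintegral do rewrite -sqrrN opprB.
move=> h; apply: (le_trans h).
have [z|c0] := C_ge0; last by rewrite ler_wpM2l// -(node4_step n i) lerB.
by rewrite z in st; have := lt_le_trans s0 st; rewrite ltxx.
Unshelve. all: by end_near. Qed.

Theorem ito_exists : exists J : Omega -> R,
  is_ito P F (B m) X t J /\ L2_cvg P left_sum J.
Proof.
have fP : (P setT < +oo)%E by rewrite probability_setT ltry.
have [J [mJ cJ]] := sqi_cvg_fast mT left_sum_sqi left_sum_fast.
exists J; split => //; split => //.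
- apply: measurable_funTS; exact: measurable_fun_caratheodory.
- by move=> s; rewrite in_itv/= => /andP[s0 st]; exact: aX.
- exists left_process; split; first exact: left_process_cvg.
  exact: cJ.
Qed.

End Ito_integral.

(** * Gronwall's lemma, and time integrals of random paths *)

Section Finite_sums.
Variable R : realFieldType.

Lemma sqr_sum_le (I : finType) (x : I -> R) :
  (\sum_q x q) ^+ 2 <= #|I|%:R * \sum_q x q ^+ 2.
Proof.
rewrite expr2 big_distrlr/=.
apply: (@le_trans _ _ (\sum_i \sum_j (x i ^+ 2 + x j ^+ 2) / 2)).
  apply: ler_sum => i _; apply: ler_sum => j _.
  have := sqr_ge0 (x i - x j); rewrite sqrrB; lra.
have -> : \sum_i \sum_j (x i ^+ 2 + x j ^+ 2) / 2 =
   (\sum_i \sum_(j : I) x i ^+ 2 + \sum_(i : I) \sum_j x j ^+ 2) / 2.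
  rewrite -big_split/= mulr_suml; apply: eq_bigr => i _.
  by rewrite -big_split/= mulr_suml.
have -> : \sum_i \sum_(j : I) x i ^+ 2 = #|I|%:R * \sum_q x q ^+ 2.
  rewrite mulr_sumr; apply: eq_bigr => i _.
  by rewrite sumr_const mulr_natl.
have -> : \sum_(i : I) \sum_j x j ^+ 2 = #|I|%:R * \sum_q x q ^+ 2.
  by rewrite sumr_const mulr_natl.
lra.
Qed.

End Finite_sums.

Section Continuous_paths.
Context {R : realType}.
Notation leb := (@lebesgue_measure R).
Implicit Types (f u b : R -> R).

Lemma itg_continuous f (a b : R) : continuous f -> itg leb `[a, b] f.
Proof.
move=> cf; apply: continuous_compact_integrable; first exact: segment_compact.
exact: continuous_subspaceT.
Qed.

Lemma sqi_continuous f (a b : R) : continuous f -> sqi leb `[a, b] f.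
Proof.
move=> cf; split.
  by apply: measurable_funTS; exact: continuous_measurable_fun.
apply: itg_continuous => x.
apply: (@continuous_comp _ _ _ f (fun y : R => y ^+ 2)); first exact: cf.
exact: exprn_continuous.
Qed.

Lemma lebesgue_itvcc (a b : R) : a <= b ->
  leb `[a, b]%classic = (b - a)%:E.
Proof.
move=> ab; etransitivity; first exact: lebesgue_measure_itv.
rewrite /= lte_fin; move: ab; rewrite le_eqVlt => /predU1P[->|->//].
by rewrite ltxx subrr.
Qed.

Lemma sqr_Rint_itv_le f (a b : R) : continuous f -> a <= b ->
  (\int[leb]_(x in `[a, b]) f x) ^+ 2 <=
    (b - a) * \int[leb]_(x in `[a, b]) f x ^+ 2.
Proof.
move=> cf ab; have lab := lebesgue_itvcc ab.
have fD : (leb `[a, b]%classic < +oo)%E by rewrite lab ltry.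
have := @sqr_Rintegral_le _ _ R leb `[a, b]%classic (measurable_itv _) f fD
  (sqi_continuous a b cf).
by have -> : fine (leb `[a, b]%classic) = b - a by rewrite lab.
Qed.

Lemma Rintegral_split f (r s : R) : continuous f -> 0 <= r -> r <= s ->
  \int[leb]_(x in `[0, s]) f x =
  \int[leb]_(x in `[0, r]) f x + \int[leb]_(x in `[r, s]) f x.
Proof.
move=> cf r0 rs.
have := Rintegral_itvB (itg_continuous 0 s cf) (x := r).
rewrite !bnd_simp => /(_ r0 rs).
rewrite Rintegral_itv_obnd_cbnd; last first.
  apply: (integrableS _ _ _ (itg_continuous r s cf)) => //.
  by apply: subset_itvr; rewrite bnd_simp.
by move=> <-; rewrite addrC subrK.
Qed.

(** The product of [expR (- a * x)] with the primitive of [u] has a derivative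
    that is at most [b]. *)
Lemma gronwall u b (a t : R) : 0 <= a -> continuous u -> (forall s, 0 <= u s) ->
  itg leb `[0, t] b -> (forall s, 0 <= s -> s <= t -> 0 <= b s) ->
  (forall s, 0 <= s -> s <= t -> u s <= b s + a * \int[leb]_(x in `[0, s]) u x) ->
  forall s, 0 <= s -> s <= t ->
  u s <= b s + a * expR (a * t) * \int[leb]_(x in `[0, t]) b x.
Proof.
move=> a0 cu u0 ib b0 ub s s0 st.
pose U x := \int[leb]_(y in `[0, x]) u y.
have B0 : 0 <= \int[leb]_(x in `[0, t]) b x.
  by apply: Rintegral_ge0 => x /=; rewrite in_itv/= => /andP[? ?]; exact: b0.
suff Ub : U s <= expR (a * t) * \int[leb]_(x in `[0, t]) b x.
  by rewrite (le_trans (ub s s0 st))// lerD2l -mulrA ler_wpM2l.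
move: s0; rewrite le_eqVlt => /predU1P[<-|s0].
  rewrite /U set_itv1 Rintegral_set1 mulr_ge0// expR_ge0//.
have cU : {within `[0, s], continuous U}.
  apply: parameterized_integral_continuous; first exact: ltW.
  exact: itg_continuous.
have dU x : x \in `]0, s[ -> is_derive x (1:R) U (u x).
  rewrite in_itv/= => /andP[x0 xs].
  have [d1 d2] := @continuous_FTC1_closed R u 0 x s xs
    (itg_continuous 0 s cu) x0 (cu x).
  by apply: DeriveDef; [exact: d1|rewrite -derive1E; exact: d2].
pose v x := expR (- a * x) * U x.
pose dv x := expR (- a * x) * (u x - a * U x).
have dvE x : x \in `]0, s[ -> is_derive x (1:R) v (dv x).
  move=> xs; have dUx := dU x xs.
  apply: is_derive_eq.
  by rewrite /dv /GRing.scale/=; ring.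
have cexp : continuous (fun x : R => expR (- a * x)).
  move=> x; apply: continuous_comp; last exact: continuous_expR.
  by apply: cvgM; [exact: cvg_cst|exact: cvg_id].
have cv : {within `[0, s], continuous v}.
  move=> x; apply: cvgM; last exact: cU.
  exact: (continuous_subspaceT cexp).
have cdv : {within `[0, s], continuous dv}.
  move=> x; apply: cvgM; first exact: (continuous_subspaceT cexp).
  apply: cvgB; first exact: (continuous_subspaceT cu).
  by apply: cvgM; [exact: cvg_cst|exact: cU].
have FTC : (\int[leb]_(x in `[0%R, s]) (dv x)%:E = (v s)%:E - (v 0)%:E)%E.
  apply: continuous_FTC2 => //.
    have /(continuous_within_itvP _ s0)[_ c1 c2] := cv.
    by split => // x xs; exact: (@ex_derive _ _ _ _ _ _ _ (dvE x xs)).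
  by move=> x xs; rewrite derive1E; exact: (@derive_val _ _ _ _ _ _ _ (dvE x xs)).
have v0 : v 0 = 0 by rewrite /v /U set_itv1 Rintegral_set1 mulr0.
rewrite v0 sube0 in FTC.
have vs : v s <= \int[leb]_(x in `[0, t]) b x.
  have iv : itg leb `[0, s] dv.
    by apply: continuous_compact_integrable => //; exact: segment_compact.
  have -> : v s = \int[leb]_(x in `[0, s]) dv x by rewrite /Rintegral FTC.
  have ibs : itg leb `[0, s] b.
    by apply: (integrableS _ _ _ ib) => //; apply: subset_itvl; rewrite bnd_simp.
  apply: (@le_trans _ _ (\int[leb]_(x in `[0, s]) b x)).
    apply: le_Rint => // x /=; rewrite in_itv/= => /andP[x0 xs].
    have xt := le_trans xs st.
    have h := ub x x0 xt; rewrite -/(U x) in h.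
    apply: (@le_trans _ _ (expR (- a * x) * b x)).
      by rewrite /dv ler_wpM2l ?expR_ge0// lerBlDr.
    rewrite -[leRHS]mul1r ler_wpM2r ?b0// -expR0 ler_expR mulNr oppr_le0.
    by rewrite mulr_ge0.
  rewrite -lee_fin -!EFin_Rintegral//.
  apply: ge0_subset_integral => //.
  - exact: (measurable_int leb ib).
  - by move=> x /=; rewrite in_itv/= => /andP[? ?]; rewrite lee_fin b0.
  - by apply: subset_itvl; rewrite bnd_simp.
have -> : U s = expR (a * s) * v s.
  by rewrite /v mulrA -expRD mulNr subrr expR0 mul1r.
apply: (@le_trans _ _ (expR (a * s) * \int[leb]_(x in `[0, t]) b x)).
  by rewrite ler_wpM2l ?expR_ge0.
by rewrite ler_wpM2r// ler_expR ler_wpM2l.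
Qed.

End Continuous_paths.

Section Random_integrals.
Context {R : realType} {d : measure_display} {Omega : measurableType d}.
Variable P : probability Omega R.
Notation leb := (@lebesgue_measure R).
Notation L2 := (sqi P setT).
Let mT := @measurableT _ Omega.

(** The two end points become parameters of an indicator, and Tonelli's theorem
    is applied to the positive and to the negative part of the integrand. *)
Lemma measurable_fun_Rint_itv (X : R -> Omega -> R) :
  measurable_fun setT (fun z : R * Omega => X z.1 z.2) ->
  measurable_fun setT
    (fun z : (R * R) * Omega => \int[leb]_(r in `[z.1.1, z.1.2]) X r z.2).
Proof.
move=> mX.
pose T1 := ((R * R) * Omega)%type.
have m2 : measurable_fun setT (fun z : T1 * measurableTypeR R => (z.2 : R)).
  by move=> _ A mA; apply: (@measurable_snd _ _ T1 (measurableTypeR R)).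
have m11 : measurable_fun setT (fun z : T1 * measurableTypeR R => z.1.1.1).
  by do 2 apply: (measurableT_comp measurable_fst).
have m12 : measurable_fun setT (fun z : T1 * measurableTypeR R => z.1.1.2).
  apply: (measurableT_comp measurable_snd).
  exact: (measurableT_comp measurable_fst).
have mw : measurable_fun setT (fun z : T1 * measurableTypeR R => z.1.2).
  exact: (measurableT_comp measurable_snd).
pose g (z : T1 * measurableTypeR R) : R :=
  X z.2 z.1.2 * ((z.1.1.1 <= (z.2 : R)) && ((z.2 : R) <= z.1.1.2))%R%:R.
have mg : measurable_fun setT g.
  apply: measurable_funM.
    exact: (measurableT_comp mX (measurable_fun_pair m2 mw)).
  have mle : measurable_fun setT (fun z : T1 * measurableTypeR R =>
      (z.1.1.1 <= (z.2 : R)) && ((z.2 : R) <= z.1.1.2)).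
    by apply: measurable_and; apply: measurable_fun_ler.
  exact: (measurableT_comp (f := fun b : bool => b%:R : R) _ mle).
have H (h : T1 * measurableTypeR R -> R) : measurable_fun setT h ->
    (forall z, 0 <= h z) ->
    measurable_fun setT (fun z : T1 => \int[leb]_r (h (z, r))%:E)%E.
  move=> mh h0.
  have mh' : measurable_fun setT (EFin \o h) by exact/measurable_EFinP.
  have h0' z : (0 <= (EFin \o h) z)%E by rewrite lee_fin.
  exact: (@measurable_fun_fubini_tonelli_F _ _ T1 _ R leb (EFin \o h) mh' h0').
have -> : (fun z : T1 => \int[leb]_(r in `[z.1.1, z.1.2]) X r z.2) =
   (fun z => fine (\int[leb]_r (Num.max (g (z, r)) 0)%:E -
                   \int[leb]_r (Num.max (- g (z, r)) 0)%:E)%E).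
  apply/funext => z; rewrite /Rintegral integral_mkcond; congr fine.
  rewrite integralE; congr (_ - _)%E; apply: eq_integral => r _.
    rewrite funeposE patchE /g/=.
    have -> : (r \in `[z.1.1, z.1.2]%classic) = (z.1.1 <= r <= z.1.2).
      by apply/idP/idP; rewrite inE/= in_itv.
    by case: ifP => _; rewrite ?mulr1 ?mulr0 ?maxxx// EFin_max.
  rewrite funenegE patchE /g/=.
  have -> : (r \in `[z.1.1, z.1.2]%classic) = (z.1.1 <= r <= z.1.2).
    by apply/idP/idP; rewrite inE/= in_itv.
  by case: ifP => _; rewrite ?mulr1 ?mulr0 ?oppr0 ?oppe0 ?maxxx// EFin_max.
apply: measurableT_comp => //; apply: emeasurable_funB.
  apply: (H (fun z => Num.max (g z) 0)); first exact: measurable_maxr.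
  by move=> z; rewrite le_max lexx orbT.
apply: (H (fun z => Num.max (- g z) 0)).
  by apply: measurable_maxr => //; exact: measurableT_comp.
by move=> z; rewrite le_max lexx orbT.
Qed.

Lemma measurable_fun_Rint_cst (X : R -> Omega -> R) a b :
  measurable_fun setT (fun z : R * Omega => X z.1 z.2) ->
  measurable_fun setT (fun w => \int[leb]_(r in `[a, b]) X r w).
Proof.
move=> /measurable_fun_Rint_itv mX.
have h : measurable_fun setT (fun w : Omega => ((a, b), w)).
  exact: measurable_fun_pair.
exact: (measurableT_comp mX h).
Qed.

Lemma measurable_fun_Rint_var (X : R -> Omega -> R) a :
  measurable_fun setT (fun z : R * Omega => X z.1 z.2) ->
  measurable_fun setT (fun z : R * Omega => \int[leb]_(r in `[a, z.1]) X r z.2).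
Proof.
move=> /measurable_fun_Rint_itv mX.
have h : measurable_fun setT (fun z : R * Omega => ((a, z.1), z.2)).
  by apply: measurable_fun_pair => //; exact: measurable_fun_pair.
exact: (measurableT_comp mX h).
Qed.

Lemma itg_Rint_sqr (X : R -> Omega -> R) (r s c : R) :
  measurable_fun setT (fun z : R * Omega => X z.1 z.2) ->
  (forall w, sqi leb `[r, s] (X^~ w)) -> r <= s ->
  (forall x, r < x -> x <= s -> L2 (X x) /\ \int[P]_w X x w ^+ 2 <= c) ->
  itg P setT (fun w => \int[leb]_(x in `[r, s]) (X x w) ^+ 2) /\
  \int[P]_w \int[leb]_(x in `[r, s]) (X x w) ^+ 2 <= c * (s - r).
Proof.
move=> mX sX rs Xc.
have mX2 : measurable_fun setT (fun z : R * Omega => (X z.1 z.2) ^+ 2).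
  exact: measurable_funX.
have h : (\int[P]_w \int[leb]_(x in `[r, s]) ((X x w) ^+ 2)%:E <=
    (c * (s - r))%:E)%E.
  apply: tonelli_itv_le => //; first by move=> ? ?; exact: sqr_ge0.
  move=> x rx xs; have [[_ i2] h] := Xc x rx xs.
  by rewrite (EFin_Rintegral mT)// lee_fin.
have e w : (\int[leb]_(x in `[r, s]) ((X x w) ^+ 2)%:E)%E =
    (\int[leb]_(x in `[r, s]) (X x w) ^+ 2)%:E.
  by rewrite EFin_Rintegral//; case: (sX w).
have i1 : itg P setT (fun w => \int[leb]_(x in `[r, s]) (X x w) ^+ 2).
  apply: ge0_itg => //; first exact: measurable_fun_Rint_cst.
    by move=> w _; apply: Rintegral_ge0 => x _; exact: sqr_ge0.
  under eq_integral do rewrite -e.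
  by rewrite (le_lt_trans h)// ltry.
split => //; rewrite -lee_fin -(EFin_Rintegral mT)//.
by under eq_integral do rewrite -e.
Qed.

Lemma sqi_Rint (X : R -> Omega -> R) (r s c : R) :
  measurable_fun setT (fun z : R * Omega => X z.1 z.2) ->
  (forall w, continuous (X^~ w)) -> r <= s ->
  (forall x, r < x -> x <= s -> L2 (X x) /\ \int[P]_w X x w ^+ 2 <= c) ->
  L2 (fun w => \int[leb]_(x in `[r, s]) X x w) /\
  \int[P]_w (\int[leb]_(x in `[r, s]) X x w) ^+ 2 <= c * (s - r) ^+ 2.
Proof.
move=> mX cX rs Xc.
have rs0 : 0 <= s - r by rewrite subr_ge0.
have [i1 h1] := itg_Rint_sqr mX (fun w => sqi_continuous r s (cX w)) rs Xc.
have i2 := itgZ mT (s - r) i1.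
have sI : L2 (fun w => \int[leb]_(x in `[r, s]) X x w).
  apply: (sqi_le mT _ i2); first exact: measurable_fun_Rint_cst.
  by move=> w _; exact: sqr_Rint_itv_le.
split => //.
apply: (@le_trans _ _ (\int[P]_w ((s - r) *
    \int[leb]_(x in `[r, s]) (X x w) ^+ 2))).
  by apply: (le_Rint mT) => //; [case: sI|move=> w _; exact: sqr_Rint_itv_le].
rewrite (RintZ mT)//.
have -> : c * (s - r) ^+ 2 = (s - r) * (c * (s - r)) by ring.
by rewrite ler_wpM2l.
Qed.

End Random_integrals.

(** * Ito's formula for the energy of an antisymmetric linear system *)

Lemma cvg_sumr (R : realType) (T J : Type) (F : set_system T) (r : seq J)
    (f : J -> T -> R) (l : J -> R) : Filter F ->
  (forall j, f j x @[x --> F] --> l j) ->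
  \sum_(j <- r) f j x @[x --> F] --> \sum_(j <- r) l j.
Proof.
move=> FF fl; elim: r => [|j r IH].
  by under eq_fun do rewrite big_nil; rewrite big_nil; exact: cvg_cst.
by under eq_fun do rewrite big_cons; rewrite big_cons; exact: cvgD.
Qed.

Lemma norm_Rint_le (R : realType) (a b : R) (f : R -> R) :
  itg lebesgue_measure `[a, b] f ->
  `|\int[lebesgue_measure]_(x in `[a, b]) f x| <=
    \int[lebesgue_measure]_(x in `[a, b]) `|f x|.
Proof. exact: le_normr_Rintegral. Qed.

Section L2_limits.
Context {R : realType} {d : measure_display} {Omega : measurableType d}.
Variable P : probability Omega R.
Notation L1 := (itg P setT).
Notation L2 := (sqi P setT).
Let mT := @measurableT _ Omega.
Let fP : (P setT < +oo)%E. Proof. by rewrite probability_setT ltry. Qed.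
Implicit Types (f g : Omega -> R) (X Z : nat -> Omega -> R).

Lemma itg_ae f g : measurable_fun setT f -> {ae P, forall w, f w = g w} ->
  L1 g -> L1 f /\ \int[P]_w f w = \int[P]_w g w.
Proof.
move=> mf fg ig; have mg := itg_meas ig.
split; last first.
  congr fine; apply: ae_eq_integral => //; try exact/measurable_EFinP.
  by apply: filterS fg => w -> _.
apply/integrableP; split; first exact/measurable_EFinP.
move/integrableP : ig => [_].
have -> : (\int[P]_w `|(EFin \o g) w| = \int[P]_w `|(EFin \o f) w|)%E.
  apply: ae_eq_integral => //.
  - by apply: measurableT_comp => //; exact/measurable_EFinP.
  - by apply: measurableT_comp => //; exact/measurable_EFinP.
  - by apply: filterS fg => w /= -> _.
by [].
Qed.

Lemma sqi_ae f g : measurable_fun setT f -> {ae P, forall w, f w = g w} ->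
  L2 g -> L2 f /\ \int[P]_w f w ^+ 2 = \int[P]_w g w ^+ 2.
Proof.
move=> mf fg [mg ig].
have fg2 : {ae P, forall w, f w ^+ 2 = g w ^+ 2}.
  by apply: filterS fg => w ->.
by have [i e] := itg_ae (measurable_funX 2 mf) fg2 ig.
Qed.

Lemma Rint_cst_prob (c : R) : \int[P]_w c = c.
Proof.
rewrite Rintegral_cst//; have -> : fine (P setT) = 1 by rewrite probability_setT.
by rewrite mulr1.
Qed.

Lemma sqr_Rint_prob_le f : L2 f -> (\int[P]_w f w) ^+ 2 <= \int[P]_w f w ^+ 2.
Proof.
move=> sf; have := sqr_Rintegral_le mT fP sf.
have -> : fine (P setT) = 1 by rewrite probability_setT.
by rewrite mul1r.
Qed.

Lemma cvg_L1_of_L2 X : (forall n, L2 (X n)) ->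
  \int[P]_w X n w ^+ 2 @[n --> \oo] --> (0 : R) ->
  \int[P]_w `|X n w| @[n --> \oo] --> (0 : R).
Proof.
move=> sX X0; apply/cvgr0Pnorm_lt => e e0.
have /cvgr0Pnorm_lt/(_ _ (exprn_gt0 2 e0)) := X0.
apply: filterS => n; rewrite ger0_norm; last first.
  by apply: Rintegral_ge0 => w _; exact: sqr_ge0.
have I0 : 0 <= \int[P]_w `|X n w| by exact: Rintegral_ge0.
move=> h; rewrite ger0_norm// -(ltr_pXn2r (n := 2)) ?nnegrE ?(ltW e0)//.
have sa : L2 (fun w => `|X n w|).
  have [mX i2] := sX n; split; first exact: measurableT_comp.
  by apply: (itg_eq mT _ i2) => w _; rewrite real_normK ?num_real.
apply: le_lt_trans (sqr_Rint_prob_le sa) _.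
by under eq_Rintegral do rewrite real_normK ?num_real//.
Qed.

Lemma L2_cvg_real Z f : (forall n, L2 (Z n)) -> measurable_fun setT f ->
  L2_cvg P Z f ->
  [/\ L2 f, \int[P]_w (Z n w - f w) ^+ 2 @[n --> \oo] --> (0 : R) &
    \int[P]_w `|Z n w - f w| @[n --> \oo] --> (0 : R)].
Proof.
move=> sZ mf Zf.
have sf : L2 f.
  have : \forall n \near \oo, (\int[P]_w ((Z n w - f w) ^+ 2)%:E < +oo)%E.
    have := Zf => /fine_cvgP[+ _].
    by apply: filterS => n; rewrite ge0_fin_numE// integral_ge0// => w _;
      rewrite lee_fin sqr_ge0.
  move=> [N _ /(_ N (leqnn N)) h].
  have : L2 (fun w => Z N w - f w).
    apply/(sqiP _ mT); split => //.
    by apply: measurable_funB => //; case: (sZ N).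
  move=> /(sqiB mT (sZ N)); apply: (sqi_eq mT) => w _.
  by rewrite opprB addrC subrK.
have c2 : \int[P]_w (Z n w - f w) ^+ 2 @[n --> \oo] --> (0 : R).
  by have /fine_cvgP[_] := Zf.
split => //; apply: cvg_L1_of_L2 => // n; exact: sqiB.
Qed.

Lemma L2_cvg_ereal Z f : (forall n, L2 (Z n)) -> L2 f ->
  \int[P]_w (Z n w - f w) ^+ 2 @[n --> \oo] --> (0 : R) -> L2_cvg P Z f.
Proof.
move=> sZ sf h; rewrite /L2_cvg.
have e n : (\int[P]_w ((Z n w - f w) ^+ 2)%:E)%E =
    (\int[P]_w (Z n w - f w) ^+ 2)%:E.
  by rewrite (EFin_Rintegral mT)//; case: (sqiB mT (sZ n) sf).
under eq_fun do rewrite e.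
by apply: cvg_EFin => //; exact: nearW.
Qed.

Lemma sqi_lin (I : finType) (a : I -> R) (x : I -> Omega -> R) (c : R) :
  (forall q, L2 (x q)) -> (forall q, \int[P]_w x q w ^+ 2 <= c) ->
  L2 (fun w => \sum_q a q * x q w) /\
  \int[P]_w (\sum_q a q * x q w) ^+ 2 <= #|I|%:R * (\sum_q a q ^+ 2) * c.
Proof.
move=> sx xc.
have s1 : L2 (fun w => \sum_q a q * x q w).
  by apply: (sqi_sum mT) => q _; apply: (sqiZ mT).
have i1 : L1 (fun w => \sum_q a q ^+ 2 * x q w ^+ 2).
  by apply: (itg_sum mT) => q _; apply: (itgZ mT); case: (sx q).
split => //.
apply: (@le_trans _ _ (\int[P]_w (#|I|%:R * \sum_q a q ^+ 2 * x q w ^+ 2))).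
  apply: (le_Rint mT); [by case: s1|exact: itgZ|].
  move=> w _; apply: le_trans (sqr_sum_le _) _.
  by rewrite ler_wpM2l//; apply: ler_sum => q _; rewrite exprMn.
rewrite (RintZ mT)// -mulrA ler_wpM2l// (Rintegral_sum mT); last first.
  by move=> q _; apply: (itgZ mT); case: (sx q).
rewrite mulr_suml; apply: ler_sum => q _.
by rewrite (RintZ mT) ?ler_wpM2l ?sqr_ge0//; case: (sx q).
Qed.

End L2_limits.

Section Linear_system.
Context {R : realType} {d : measure_display} {Omega : measurableType d}.
Variables (P : probability Omega R) (F : R -> set (set Omega)).
Variable B : nat -> R -> Omega -> R.
Hypothesis hF : filtration F.
Hypothesis hB : independent_brownian_motions P F B.
Variable t : R.
Hypothesis t0 : 0 <= t.

Variables (I : finType) (z : I -> R -> Omega -> R) (z0 : I -> R).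
Variables (A : I -> I -> R) (G : I -> nat -> R).

Notation leb := (@lebesgue_measure R).
Notation inc m s t := (increment (B m) s t).
Notation L1 := (itg P setT).
Notation L2 := (sqi P setT).
Let mT := @measurableT _ Omega.

Hypothesis cz : forall q w, continuous (z q ^~ w).
Hypothesis az : forall q s, 0 <= s -> measurable_wrt (F s) (z q s).
Hypothesis mz : forall q s, measurable_fun setT (z q s).
Hypothesis zinit : forall q w, z q 0 w = z0 q.
Hypothesis sumG : forall q, cvgn (series (fun m => G q m ^+ 2)).

Definition drift q s w : R := \sum_r A q r * z r s w.

Hypothesis eqz : forall q s, 0 <= s -> s <= t -> exists N : Omega -> R,
  [/\ measurable_fun setT N,
    L2_cvg P (fun M w => \sum_(m < M) G q m * inc m 0 s w) N &
    {ae P, forall w, z q s w =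
       z0 q + \int[leb]_(x in `[0, s]) drift q x w + N w}].

(** The noise is read off the path, so that it is defined and continuous for
    every outcome; the equation identifies it almost surely, time by time. *)
Definition noise q s w : R :=
  z q s w - z0 q - \int[leb]_(x in `[0, s]) drift q x w.

Definition tail q M : R :=
  limn (series (fun m => G q m ^+ 2)) - series (fun m => G q m ^+ 2) M.

Lemma tail_ge q M M' : \sum_(M <= m < M') G q m ^+ 2 <= tail q M.
Proof.
have nd := @nondecreasing_cvgn_le _ _ _ (@sumG q).
have ndS : {homo series (fun m => G q m ^+ 2) : n m / (n <= m)%N >-> n <= m}.
  by apply: nondecreasing_series => i _ _; exact: sqr_ge0.
have [MM|MM] := leqP M M'; last first.
  by rewrite big_geq ?(ltnW MM)// subr_ge0; exact: nd.
have := nd ndS M'; rewrite /tail lerBrDr; apply: le_trans.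
by rewrite /series/= addrC (big_cat_nat (leq0n M) MM).
Qed.

Lemma tail_ge0 q M : 0 <= tail q M.
Proof. by have := tail_ge q M M; rewrite big_geq. Qed.

Lemma cvg_tail q : tail q M @[M --> \oo] --> (0 : R).
Proof.
rewrite -(subrr (limn (series (fun m => G q m ^+ 2)))).
by apply: cvgB; [exact: cvg_cst|exact: sumG].
Qed.

Lemma cvg_sum_tail : \sum_q tail q M @[M --> \oo] --> (0 : R).
Proof.
have s0 : \sum_(q : I) (0 : R) = 0 by rewrite big1.
by rewrite -[X in _ --> X]s0; apply: cvg_sumr => q; exact: cvg_tail.
Qed.

Lemma cdrift q w : continuous (drift q ^~ w).
Proof.
move=> s; apply: cvg_sumr => r.
by apply: cvgM; [exact: cvg_cst|exact: cz].
Qed.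

Lemma mdrift q s : measurable_fun setT (drift q s).
Proof.
by apply: measurable_sum => r; apply: measurable_funM.
Qed.

Lemma mjdrift q : measurable_fun setT (fun x : R * Omega => drift q x.1 x.2).
Proof.
apply: measurable_fun_caratheodory; [exact: cdrift|exact: mdrift].
Qed.

Lemma mnoise q s : measurable_fun setT (noise q s).
Proof.
apply: measurable_funB; first by apply: measurable_funB.
by apply: measurable_fun_Rint_cst; exact: mjdrift.
Qed.

Lemma mjnoise q : measurable_fun setT (fun x : R * Omega => noise q x.1 x.2).
Proof.
apply: measurable_funB.
  by apply: measurable_funB => //; exact: measurable_fun_caratheodory.
by apply: measurable_fun_Rint_var; exact: mjdrift.
Qed.

Lemma noise0 q w : noise q 0 w = 0.
Proof. by rewrite /noise zinit subrr set_itv1 Rintegral_set1 subr0. Qed.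

Lemma sqi_inc_sum q s r M : 0 <= r -> r <= s ->
  L2 (fun w => \sum_(m < M) G q m * inc m r s w).
Proof.
move=> r0 rs; apply: (sqi_sum mT) => m _; apply: (sqiZ mT).
by have [[_ h _ _ _] _] := inc_moments hF hB m r0 rs.
Qed.

(** The increments of the noise are limits of weighted sums of Brownian
    increments, which are orthogonal, so the error is bounded by the tail of
    the squared weights. *)
Lemma noise_increment q r s M : 0 <= r -> r <= s -> s <= t ->
  let D w := noise q s w - noise q r w - \sum_(m < M) G q m * inc m r s w in
  L2 D /\ \int[P]_w D w ^+ 2 <= tail q M * (s - r).
Proof.
move=> r0 rs st D.
have fP : (P setT < +oo)%E by rewrite probability_setT ltry.
have s0 := le_trans r0 rs; have rt := le_trans rs st.
have [Ns [mNs cNs eNs]] := eqz q s0 st.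
have [Nr [mNr cNr eNr]] := eqz q r0 rt.
have sp u M' : 0 <= u -> L2 (fun w => \sum_(m < M') G q m * inc m 0 u w).
  by move=> u0; exact: sqi_inc_sum.
have [sNs _ lNs] := L2_cvg_real (fun M' => sp s M' s0) mNs cNs.
have [sNr _ lNr] := L2_cvg_real (fun M' => sp r M' r0) mNr cNr.
pose E w := Ns w - Nr w - \sum_(m < M) G q m * inc m r s w.
have DE : {ae P, forall w, D w = E w}.
  near=> w; rewrite /D /E /noise.
  have -> : z q s w = z0 q + \int[leb]_(x in `[0, s]) drift q x w + Ns w.
    by near: w.
  have -> : z q r w = z0 q + \int[leb]_(x in `[0, r]) drift q x w + Nr w.
    by near: w.
  ring.
have sE : L2 E.
  by apply: (sqiB mT); [exact: sqiB|exact: sqi_inc_sum].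
have mD : measurable_fun setT D.
  apply: measurable_funB; first by apply: measurable_funB; exact: mnoise.
  by case: (sqi_inc_sum q M r0 rs).
have [sD ->] := sqi_ae mD DE sE; split => //.
pose X M' w := \sum_(M <= m < M + M') G q m * inc m r s w.
have XE M' w : X M' w = \sum_(m < M + M') G q m * inc m r s w -
                        \sum_(m < M) G q m * inc m r s w.
  rewrite -!(big_mkord xpredT (fun m => G q m * inc m r s w)).
  by rewrite (big_cat_nat (leq0n M) (leq_addr M' M))/= addrC addrK.
have sX M' : L2 (X M').
  apply: (sqi_eq mT (fun w _ => esym (XE M' w))).
  by apply: (sqiB mT); exact: sqi_inc_sum.
have X2 M' : \int[P]_w X M' w ^+ 2 <= tail q M * (s - r).
  pose Y m : Omega -> R := if (m < M)%N then fun=> 0 else fun=> G q m.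
  have aY m : (m < M + M')%N -> measurable_wrt (F r) (Y m).
    by move=> _; rewrite /Y; case: ifP => _; exact: (mwrt_cst hF).
  have sY m : (m < M + M')%N -> L2 (Y m).
    move=> _; rewrite /Y; case: ifP => _; first exact: (sqi0 _ mT).
    exact: (sqi_cst mT (G q m) fP).
  have [_ e _] := sum_inc_isometry hF hB r0 rs aY sY.
  have E1 w : X M' w = \sum_(m < M + M') Y m w * inc m r s w.
    rewrite -(big_mkord xpredT (fun m => Y m w * inc m r s w)).
    rewrite (big_cat_nat (leq0n M) (leq_addr M' M))/= big_nat big1 ?add0r.
      rewrite /X !big_nat; apply: eq_bigr => m /andP[Mm _].
      by rewrite /Y ltnNge Mm.
    by move=> m /andP[_ mM]; rewrite /Y mM mul0r.
  under eq_Rintegral do rewrite E1.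
  rewrite e -mulr_sumr mulrC ler_wpM2r ?subr_ge0//.
  apply: le_trans (tail_ge q M (M + M')).
  rewrite -(big_mkord xpredT (fun m => \int[P]_w Y m w ^+ 2)).
  rewrite (big_cat_nat (leq0n M) (leq_addr M' M))/= big_nat big1 ?add0r.
    rewrite !big_nat; apply: ler_sum => m /andP[Mm _].
    by rewrite /Y ltnNge Mm/= Rint_cst_prob.
  by move=> m /andP[_ mM]; rewrite /Y mM expr0n/= Rintegral_cst// mul0r.
have [] // := L1_lim_sqr_le mT fP (sqi_meas sE) sX X2.
- move=> M'; apply: (sqi_itg mT fP); exact: sqiB.
- have inc_split M' w : \sum_(m < M') G q m * inc m r s w =
      \sum_(m < M') G q m * inc m 0 s w - \sum_(m < M') G q m * inc m 0 r w.
    by rewrite -sumrB; apply: eq_bigr => m _; rewrite /increment; ring.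
  apply: (@squeeze_cvgr _ _ _ _ (fun=> 0) (fun M' =>
     \int[P]_w `|\sum_(m < M + M') G q m * inc m 0 s w - Ns w| +
     \int[P]_w `|\sum_(m < M + M') G q m * inc m 0 r w - Nr w|)).
  + near=> M'; apply/andP; split; first exact: Rintegral_ge0.
    have i1 : L1 (fun w => \sum_(m < M + M') G q m * inc m 0 s w - Ns w).
      by apply: (sqi_itg mT fP); apply: (sqiB mT) => //; exact: sp.
    have i2 : L1 (fun w => \sum_(m < M + M') G q m * inc m 0 r w - Nr w).
      by apply: (sqi_itg mT fP); apply: (sqiB mT) => //; exact: sp.
    rewrite -(RintD mT); [|exact: itg_norm|exact: itg_norm].
    apply: (le_Rint mT).
    * by apply: itg_norm => //; apply: (sqi_itg mT fP); exact: sqiB.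
    * by apply: (itgD mT); exact: itg_norm.
    * move=> w _; rewrite XE /E !inc_split.
      set a := \sum_(m < M + M') _; set b := \sum_(m < M + M') _.
      apply: le_trans (ler_normB _ _); rewrite le_eqVlt; apply/orP; left.
      by apply/eqP; congr (`| _ |); ring.
  + exact: cvg_cst.
  + have sh (u : nat -> R) : u n @[n --> \oo] --> (0 : R) ->
        u (M + n)%N @[n --> \oo] --> (0 : R).
      by move=> h; have := h; rewrite -(cvg_shiftn M); under eq_fun do rewrite addnC.
    rewrite -[X in _ --> X]addr0.
    exact: (cvgD (sh _ lNs) (sh _ lNr)).
Unshelve. all: by end_near. Qed.

Lemma noise_sqr q r s : 0 <= r -> r <= s -> s <= t ->
  L2 (fun w => noise q s w - noise q r w) /\
  \int[P]_w (noise q s w - noise q r w) ^+ 2 <= tail q 0 * (s - r).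
Proof.
move=> r0 rs st; have [h1 h2] := noise_increment q 0 r0 rs st.
split.
  by apply: (sqi_eq mT _ h1) => w _; rewrite big_ord0 subr0.
by apply: le_trans h2; under [leRHS]eq_Rintegral do rewrite big_ord0 subr0.
Qed.

Lemma sqi_noise_path q w : sqi leb `[0, t] (noise q ^~ w).
Proof.
have mI : measurable (`[0, t]%classic : set (measurableTypeR R)) by exact: measurable_itv.
pose c := `|z0 q| + \int[leb]_(x in `[0, t]) `|drift q x w|.
have mN : measurable_fun `[0, t] (noise q ^~ w).
  apply: measurable_funTS.
  have h : measurable_fun setT
      ((fun x : R * Omega => noise q x.1 x.2) \o (fun s : R => (s, w))).
    apply: measurableT_comp; first exact: mjnoise.
    exact: measurable_fun_pair.
  by move=> _ Y mY; apply: h.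
have ca : continuous (fun s => `|z q s w| + c).
  move=> s; apply: cvgD; last exact: cvg_cst.
  by apply: cvg_norm; exact: cz.
apply: (@sqi_le _ _ R leb _ mI _ _ mN (sqi_itg2 (sqi_continuous 0 t ca))) => s.
rewrite /= in_itv/= => /andP[s0 st].
rewrite -(real_normK (num_real (noise q s w))).
rewrite ler_pXn2r ?nnegrE//; last first.
  by rewrite addr_ge0// addr_ge0// Rintegral_ge0.
rewrite /noise -addrA; apply: le_trans (ler_normD _ _) _.
rewrite lerD2l -opprD normrN; apply: le_trans (ler_normD _ _) _.
rewrite lerD2l.
have id := itg_continuous 0 s (@cdrift q w).
apply: le_trans (norm_Rint_le id) _.
have cn : continuous (fun x => `|drift q x w|).
  by move=> x; apply: cvg_norm; exact: cdrift.
by rewrite (Rintegral_split cn s0 st) lerDl; apply: Rintegral_ge0.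
Qed.

(** Gronwall's lemma, applied path by path, transfers the second moments of the
    noise to the solution. *)
Lemma moment_bound : exists C : R, 0 <= C /\ forall q s, 0 <= s -> s <= t ->
  L2 (z q s) /\ \int[P]_w z q s w ^+ 2 <= C.
Proof.
have fP : (P setT < +oo)%E by rewrite probability_setT ltry.
have mI : measurable (`[0, t]%classic : set (measurableTypeR R)) by exact: measurable_itv.
have fI : (leb `[0%R, t]%classic < +oo)%E by rewrite lebesgue_itvcc// ltry.
pose a := \sum_q \sum_r `|A q r|.
have a0 : 0 <= a by apply: sumr_ge0 => q _; apply: sumr_ge0.
pose Z := \sum_q `|z0 q|.
pose b s w := Z + \sum_q `|noise q s w|.
pose u s w := \sum_q `|z q s w|.
have cu w : continuous (u ^~ w).
  by move=> s; apply: cvg_sumr => q; apply: cvg_norm; exact: cz.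
have u0 s w : 0 <= u s w by apply: sumr_ge0.
have b0 s w : 0 <= b s w by rewrite addr_ge0//; apply: sumr_ge0.
have sb w : sqi leb `[0, t] (b ^~ w).
  apply: (@sqiD _ _ _ leb _ mI (fun=> Z) (fun s => \sum_q `|noise q s w|)).
    exact: (@sqi_cst _ _ R leb _ mI Z fI).
  apply: (@sqi_sum _ _ R leb _ mI) => q _; have [mN iN] := sqi_noise_path q w.
  split; first exact: measurableT_comp.
  by apply: (@itg_eq _ _ R leb _ mI _ _ _ iN) => s _; rewrite real_normK ?num_real.
have ineq s w : 0 <= s -> s <= t ->
    u s w <= b s w + a * \int[leb]_(x in `[0, s]) u x w.
  move=> s0 st.
  apply: (@le_trans _ _ (\sum_q (`|z0 q| + `|noise q s w| +
     (\sum_r `|A q r|) * \int[leb]_(x in `[0, s]) u x w))).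
    apply: ler_sum => q _.
    have -> : z q s w = z0 q + noise q s w + \int[leb]_(x in `[0, s]) drift q x w.
      by rewrite /noise; ring.
    apply: le_trans (ler_normD _ _) _; apply: lerD; first exact: ler_normD.
    have id := itg_continuous 0 s (@cdrift q w).
    apply: le_trans (norm_Rint_le id) _.
    have iu := itg_continuous 0 s (cu w).
    have ms := measurable_itv `[0, s] : measurable (_ : set (measurableTypeR R)).
    rewrite -(@RintZ _ _ R leb _ ms _ _ iu).
    apply: (@le_Rint _ _ R leb _ ms).
    - exact: (itg_norm id).
    - exact: (@itgZ _ _ R leb _ ms).
    move=> x _; apply: le_trans (ler_norm_sum _ _ _) _.
    rewrite mulr_suml; apply: ler_sum => r _; rewrite normrM ler_wpM2l//.
    by rewrite /u (bigD1 r)//= lerDl sumr_ge0.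
  by rewrite !big_split/= -mulr_suml.
pose c := 2 * Z ^+ 2 + 2 * (#|I|%:R * \sum_q tail q 0 * t).
have mN2 q s : 0 <= s -> s <= t ->
    L2 (noise q s) /\ \int[P]_w noise q s w ^+ 2 <= tail q 0 * t.
  move=> s0 st; have [h1 h2] := noise_sqr q (lexx 0) s0 st.
  have e w : noise q s w - noise q 0 w = noise q s w by rewrite noise0 subr0.
  split; first by apply: (sqi_eq mT _ h1) => w _; rewrite e.
  apply: (@le_trans _ _ (tail q 0 * (s - 0))).
    by move: h2; under eq_Rintegral do rewrite e.
  by rewrite subr0 ler_wpM2l// tail_ge0.
have b2 s : 0 <= s -> s <= t -> L2 (b s) /\ \int[P]_w b s w ^+ 2 <= c.
  move=> s0 st.
  have sN q : L2 (fun w => `|noise q s w|).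
    have [[m1 i1] _] := mN2 q s s0 st.
    split; first exact: measurableT_comp.
    by apply: (itg_eq mT _ i1) => w _; rewrite real_normK ?num_real.
  have sbs : L2 (b s).
    apply: (sqiD mT); first exact: (sqi_cst mT _ fP).
    by apply: (sqi_sum mT) => q _.
  split => //.
  have iN q : L1 (fun w => noise q s w ^+ 2) by have [[]] := mN2 q s s0 st.
  have iS : L1 (fun w => \sum_q noise q s w ^+ 2) by apply: (itg_sum mT).
  apply: (@le_trans _ _ (\int[P]_w (2 * Z ^+ 2 +
     2 * (#|I|%:R * \sum_q noise q s w ^+ 2)))).
    apply: (le_Rint mT); first by case: sbs.
      apply: (itgD mT); first exact: (itg_cst mT _ fP).
      by do 2 apply: (itgZ mT).
    move=> w _; apply: le_trans (sqrD_le _ _) _; rewrite lerD2l.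
    rewrite ler_wpM2l//; apply: le_trans (sqr_sum_le _) _.
    by rewrite ler_wpM2l//; apply: ler_sum => q _; rewrite real_normK ?num_real.
  rewrite (RintD mT)//; last by do 2 apply: (itgZ mT).
    rewrite Rint_cst_prob !(RintZ mT)//; last by apply: (itgZ mT).
    rewrite lerD2l ler_wpM2l// ler_wpM2l// (Rintegral_sum mT)//.
    by apply: ler_sum => q _; have [] := mN2 q s s0 st.
  exact: (itg_cst mT _ fP).
have mb : measurable_fun setT (fun x : R * Omega => b x.1 x.2).
  apply: measurable_funD => //; apply: measurable_sum => q.
  by apply: measurableT_comp => //; exact: mjnoise.
have [iB2 eB2] := itg_Rint_sqr mb sb t0 (fun x x0 xt => b2 x (ltW x0) xt).
pose g := a * expR (a * t).
have c0 : 0 <= c.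
  apply: addr_ge0; first by rewrite mulr_ge0 ?sqr_ge0.
  rewrite mulr_ge0// mulr_ge0//.
  by apply: sumr_ge0 => q _; rewrite mulr_ge0 ?tail_ge0.
exists (2 * c + 2 * (g ^+ 2 * (t * (c * t)))); split.
  apply: addr_ge0; first by rewrite mulr_ge0.
  by rewrite mulr_ge0// mulr_ge0 ?sqr_ge0// mulr_ge0// mulr_ge0.
move=> q s s0 st; have [[mbs ibs] ebs] := b2 s s0 st.
have i2 : L1 (fun w => 2 * b s w ^+ 2 +
    2 * (g ^+ 2 * (t * \int[leb]_(x in `[0, t]) (b x w) ^+ 2))).
  by apply: (itgD mT); do ?apply: (itgZ mT).
have le2 w : z q s w ^+ 2 <= 2 * b s w ^+ 2 +
    2 * (g ^+ 2 * (t * \int[leb]_(x in `[0, t]) (b x w) ^+ 2)).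
  have uz : `|z q s w| <= u s w by rewrite /u (bigD1 q)//= lerDl sumr_ge0.
  have gr := gronwall a0 (cu w) (u0 ^~ w) (sqi_itg mI fI (sb w))
    (fun x _ _ => b0 x w) (fun x x0 xt => ineq x w x0 xt) s0 st.
  have I0 : 0 <= \int[leb]_(x in `[0, t]) b x w by apply: Rintegral_ge0.
  have g0 : 0 <= g by rewrite mulr_ge0// expR_ge0.
  rewrite -(real_normK (num_real (z q s w))).
  apply: (@le_trans _ _ ((b s w + g * \int[leb]_(x in `[0, t]) b x w) ^+ 2)).
    rewrite ler_pXn2r ?nnegrE//; first exact: le_trans uz gr.
    by rewrite addr_ge0// mulr_ge0.
  apply: le_trans (sqrD_le _ _) _; rewrite lerD2l ler_wpM2l// exprMn.
  rewrite ler_wpM2l ?sqr_ge0//.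
  have := @sqr_Rintegral_le _ _ R leb _ mI _ fI (sb w).
  have -> : fine (leb `[0, t]%classic) = t by rewrite lebesgue_itvcc// subr0.
  by [].
have sz : L2 (z q s) by apply: (sqi_le mT _ i2).
split => //; apply: (@le_trans _ _ (\int[P]_w (2 * b s w ^+ 2 +
    2 * (g ^+ 2 * (t * \int[leb]_(x in `[0, t]) (b x w) ^+ 2))))).
  by apply: (le_Rint mT) => //; case: sz.
rewrite (RintD mT); [|by apply: (itgZ mT)|by do 3 apply: (itgZ mT)].
rewrite !(RintZ mT)//; [|by apply: (itgZ mT)|by do 2 apply: (itgZ mT)].
apply: lerD; first by rewrite ler_wpM2l.
rewrite ler_wpM2l// ler_wpM2l ?sqr_ge0// ler_wpM2l//.
by move: eB2; rewrite subr0.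
Qed.

Lemma sol_increment q r s w : 0 <= r -> r <= s ->
  z q s w = z q r w + \int[leb]_(x in `[r, s]) drift q x w +
    (noise q s w - noise q r w).
Proof.
move=> r0 rs; rewrite /noise (Rintegral_split (@cdrift q w) r0 rs); ring.
Qed.

(** The increments of the solution are of order 1/2 in the time step because of
    the noise, those of the integrated drift of order 1, and the error of
    freezing the drift at the left end point of order 3/2. *)
Lemma increment_bounds : exists C : R, 0 <= C /\
  forall q r s, 0 <= r -> r <= s -> s <= t ->
  [/\ \int[P]_w (z q s w - z q r w) ^+ 2 <= C * (s - r),
    L2 (fun w => \int[leb]_(x in `[r, s]) drift q x w) /\
    \int[P]_w (\int[leb]_(x in `[r, s]) drift q x w) ^+ 2 <= C * (s - r) ^+ 2 &
    L2 (fun w => \int[leb]_(x in `[r, s]) (drift q x w - drift q r w)) /\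
    \int[P]_w (\int[leb]_(x in `[r, s]) (drift q x w - drift q r w)) ^+ 2
      <= C * (s - r) ^+ 3].
Proof.
have [C1 [C10 mo]] := moment_bound.
pose CA := #|I|%:R * \sum_q \sum_r A q r ^+ 2.
have CA0 : 0 <= CA.
  rewrite mulr_ge0//; apply: sumr_ge0 => q _; apply: sumr_ge0 => r _.
  exact: sqr_ge0.
have CAq q : #|I|%:R * (\sum_r A q r ^+ 2) <= CA.
  rewrite ler_wpM2l// [leRHS](bigD1 q)//= lerDl; apply: sumr_ge0 => p _.
  by apply: sumr_ge0 => r _; exact: sqr_ge0.
pose Tt := \sum_q tail q 0.
have Ttq q : tail q 0 <= Tt.
  by rewrite /Tt (bigD1 q)//= lerDl; apply: sumr_ge0 => p _; exact: tail_ge0.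
have Tt0 : 0 <= Tt by apply: sumr_ge0 => q _; exact: tail_ge0.
pose Cd := CA * C1; have Cd0 : 0 <= Cd by exact: mulr_ge0.
pose Cz := 2 * (Cd * t) + 2 * Tt.
have Cz0 : 0 <= Cz by rewrite addr_ge0// mulr_ge0// mulr_ge0.
have dr q s : 0 <= s -> s <= t ->
    L2 (drift q s) /\ \int[P]_w drift q s w ^+ 2 <= Cd.
  move=> s0 st.
  have [h1 h2] := sqi_lin (A q) (fun r => (mo r s s0 st).1)
    (fun r => (mo r s s0 st).2).
  by split => //; apply: le_trans h2 _; rewrite ler_wpM2r.
have di q r s : 0 <= r -> r <= s -> s <= t ->
    L2 (fun w => \int[leb]_(x in `[r, s]) drift q x w) /\
    \int[P]_w (\int[leb]_(x in `[r, s]) drift q x w) ^+ 2 <= Cd * (s - r) ^+ 2.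
  move=> r0 rs st; apply: sqi_Rint => //; [exact: mjdrift|exact: cdrift|].
  move=> x rx xs; apply: dr; [exact: le_trans r0 (ltW rx)|exact: le_trans st].
have zi q r s : 0 <= r -> r <= s -> s <= t ->
    \int[P]_w (z q s w - z q r w) ^+ 2 <= Cz * (s - r).
  move=> r0 rs st; have sr0 : 0 <= s - r by rewrite subr_ge0.
  have [d1 d2] := di q r s r0 rs st.
  have [n1 n2] := noise_sqr q r0 rs st.
  apply: (@le_trans _ _ (\int[P]_w
    (2 * (\int[leb]_(x in `[r, s]) drift q x w) ^+ 2 +
     2 * (noise q s w - noise q r w) ^+ 2))).
    apply: (le_Rint mT).
    - apply: sqi_itg2; apply: (sqiB mT); apply: (mo _ _ _ _).1 => //.
        exact: le_trans rs.
      exact: le_trans rs st.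
    - by apply: (itgD mT); apply: (itgZ mT); exact: sqi_itg2.
    - move=> w _; rewrite (sol_increment q w r0 rs).
      apply: le_trans _ (sqrD_le _ _); rewrite le_eqVlt; apply/orP; left.
      by apply/eqP; congr (_ ^+ 2); ring.
  rewrite (RintD mT); [|by apply: (itgZ mT); exact: sqi_itg2..].
  rewrite !(RintZ mT); [|exact: sqi_itg2..].
  rewrite /Cz [leRHS]mulrDl -[X in _ <= X + _]mulrA -[X in _ <= _ + X]mulrA.
  apply: lerD; rewrite ler_wpM2l//.
    apply: le_trans d2 _; rewrite expr2 -mulrA ler_wpM2l// ler_wpM2r//.
    by rewrite lerBlDr (le_trans st)// lerDl.
  by apply: le_trans n2 _; rewrite ler_wpM2r.
exists (Cz + Cd + CA * Cz); split.
  by apply: addr_ge0; [exact: addr_ge0|exact: mulr_ge0].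
move=> q r s r0 rs st; have sr0 : 0 <= s - r by rewrite subr_ge0.
split.
- apply: le_trans (zi q r s r0 rs st) _; rewrite ler_wpM2r//.
  by rewrite -addrA lerDl addr_ge0// mulr_ge0.
- have [d1 d2] := di q r s r0 rs st; split => //; apply: le_trans d2 _.
  rewrite ler_wpM2r ?sqr_ge0// addrAC lerDr addr_ge0// mulr_ge0//.
have cs0 : 0 <= Cz * (s - r) by rewrite mulr_ge0.
have [] // := @sqi_Rint _ _ _ P (fun x w => drift q x w - drift q r w) r s
  (CA * (Cz * (s - r))) _ _ rs _.
- apply: (@measurable_fun_caratheodory _ _ _ (fun x w => drift q x w - drift q r w)).
    by move=> w x; apply: cvgB; [exact: cdrift|exact: cvg_cst].
  by move=> x; apply: measurable_funB; exact: mdrift.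
- by move=> w x; apply: cvgB; [exact: cdrift|exact: cvg_cst].
- move=> x rx xs; have x0 := le_trans r0 (ltW rx); have xt := le_trans xs st.
  have e w : drift q x w - drift q r w = \sum_p A q p * (z p x w - z p r w).
    by rewrite /drift -sumrB; apply: eq_bigr => p _; rewrite mulrBr.
  have [h1 h2] := @sqi_lin _ _ _ P I (A q) (fun p w => z p x w - z p r w)
    (Cz * (s - r))
    (fun p => sqiB mT (mo p x x0 xt).1 (mo p r r0 (le_trans rs st)).1)
    (fun p => le_trans (zi p r x r0 (ltW rx) xt)
      (ler_wpM2l Cz0 (lerB xs (lexx r)))).
  split; first by apply: (sqi_eq mT _ h1) => w _; rewrite e.
  under eq_Rintegral do rewrite e.
  by apply: le_trans h2 _; rewrite ler_wpM2r.
move=> h1 h2; split => //; apply: le_trans h2 _.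
have -> : CA * (Cz * (s - r)) * (s - r) ^+ 2 = CA * Cz * (s - r) ^+ 3 by ring.
by rewrite ler_wpM2r ?exprn_ge0// lerDr addr_ge0.
Qed.

Hypothesis anti : forall x : I -> R, \sum_q x q * (\sum_r A q r * x r) = 0.

Notation tau n i := (node4 t n i).
Notation dN n q i w := (noise q (tau n i.+1) w - noise q (tau n i) w).

(** There are [4 ^ n] time intervals, so contributions of order [8 ^- n] add up
    to order [2 ^- n]. *)
Lemma Rint_sum_mesh n (J : finType) (f : 'I_(4 ^ n) -> J -> Omega -> R) (c : R) :
  (forall i q, L1 (f i q)) -> (forall i q, \int[P]_w f i q w <= c * 8^-1 ^+ n) ->
  \int[P]_w (\sum_(i < 4 ^ n) \sum_q f i q w) <= #|J|%:R * c * 2^-1 ^+ n.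
Proof.
move=> fi fc; rewrite (Rintegral_sum mT); last first.
  by move=> i _; exact: (itg_sum mT).
apply: (@le_trans _ _ (\sum_(i < 4 ^ n) \sum_(q : J) c * 8^-1 ^+ n)).
  apply: ler_sum => i _; rewrite (Rintegral_sum mT)//.
  by apply: ler_sum => q _.
rewrite big_const_ord big_const !iter_addr_0.
have -> : (2^-1 : R) ^+ n = (4 ^ n)%:R * 8^-1 ^+ n.
  by rewrite natrX -exprMn; congr (_ ^+ _); field.
have -> : c * 8^-1 ^+ n *+ #|J| *+ 4 ^ n = #|J|%:R * c * ((4 ^ n)%:R * 8^-1 ^+ n).
  by rewrite -!(mulr_natl (_ *+ _)) -(mulr_natl (_ * _)); ring.
by [].
Qed.

Lemma mesh4_pow n : mesh4 t n ^+ 3 * 8 ^+ n = t ^+ 3 * 8^-1 ^+ n /\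
  mesh4 t n ^+ 2 * 2 ^+ n = t ^+ 2 * 8^-1 ^+ n /\
  mesh4 t n * 2^-1 ^+ n = t * 8^-1 ^+ n.
Proof.
rewrite /mesh4; split; [|split].
- rewrite exprMn -exprM mulnC exprM -mulrA -exprMn; congr (_ * _ ^+ _).
  by field.
- rewrite exprMn -exprM mulnC exprM -mulrA -exprMn; congr (_ * _ ^+ _).
  by field.
- by rewrite -mulrA -exprMn; congr (_ * _ ^+ _); field.
Qed.

(** By antisymmetry the drift does no work to first order, so over a time
    interval the energy grows by twice the martingale increment plus the square
    of the noise increment, up to terms that are small in mean. *)
Lemma energy_remainder : exists K : R, forall n,
  let Rn w := \sum_q (z q t w ^+ 2 - z0 q ^+ 2)
    - 2 * (\sum_(i < 4 ^ n) \sum_q z q (tau n i) w * dN n q i w)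
    - \sum_(i < 4 ^ n) \sum_q dN n q i w ^+ 2 in
  L1 Rn /\ \int[P]_w `|Rn w| <= K * 2^-1 ^+ n.
Proof.
have fP : (P setT < +oo)%E by rewrite probability_setT ltry.
have [C1 [C10 mo]] := moment_bound.
have [C [C0 ib]] := increment_bounds.
pose Tt := \sum_q tail q 0.
have Tt0 : 0 <= Tt by apply: sumr_ge0 => q _; exact: tail_ge0.
pose c := 2 * (C1 + C * t ^+ 3) + C * t ^+ 2 + 2 * (C * t ^+ 2 + Tt * t).
exists (#|I|%:R * c) => n Rn.
pose a q i w := \int[leb]_(x in `[tau n i, tau n i.+1]) drift q x w.
pose b q i w := \int[leb]_(x in `[tau n i, tau n i.+1])
  (drift q x w - drift q (tau n i) w).
pose f (i : 'I_(4 ^ n)) q w :=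
  2 * (z q (tau n i) w * b q i w) + a q i w ^+ 2 + 2 * (a q i w * dN n q i w).
have t_ge i : 0 <= tau n i by exact: node4_ge0.
have t_le i : tau n i <= tau n i.+1 by exact: node4_le.
have mh0 := mesh4_ge0 t0 n.
have ab q i w : a q i w = b q i w + mesh4 t n * drift q (tau n i) w.
  have mI := measurable_itv `[tau n i, tau n i.+1] :
    measurable (_ : set (measurableTypeR R)).
  have fI : (leb `[tau n i, tau n i.+1]%classic < +oo)%E.
    by rewrite lebesgue_itvcc// ltry.
  rewrite /b (@RintB _ _ R leb _ mI); last 2 first.
  - exact: itg_continuous (@cdrift q w).
  - exact: (@itg_cst _ _ R leb _ mI).
  rewrite Rintegral_cst//.
  have -> : fine (leb `[tau n i, tau n i.+1]%classic) = mesh4 t n.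
    by rewrite lebesgue_itvcc// node4_step.
  by rewrite mulrC subrK.
have cellE i w : \sum_q f i q w = \sum_q (z q (tau n i.+1) w ^+ 2
    - z q (tau n i) w ^+ 2 - 2 * (z q (tau n i) w * dN n q i w)
    - dN n q i w ^+ 2).
  transitivity (\sum_q (f i q w +
      2 * mesh4 t n * (z q (tau n i) w * drift q (tau n i) w))).
    have an : \sum_q z q (tau n i) w * drift q (tau n i) w = 0.
      exact: (anti (fun q => z q (tau n i) w)).
    by rewrite [RHS]big_split/= -[X in _ = _ + X]mulr_sumr an mulr0 addr0.
  apply: eq_bigr => q _; rewrite /f (sol_increment q w (t_ge i) (t_le i)).
  rewrite -/(a q i w) ab; ring.
have RnE w : Rn w = \sum_(i < 4 ^ n) \sum_q f i q w.
  under eq_bigr do rewrite cellE.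
  have e1 : \sum_q (z q t w ^+ 2 - z0 q ^+ 2) =
      \sum_(i < 4 ^ n) \sum_q (z q (tau n i.+1) w ^+ 2 - z q (tau n i) w ^+ 2).
    rewrite exchange_big/=; apply: eq_bigr => q _.
    rewrite -(big_mkord xpredT
      (fun i => z q (tau n i.+1) w ^+ 2 - z q (tau n i) w ^+ 2)).
    rewrite telescope_sumr ?leq0n// node4_last; congr (_ - _ ^+ 2).
    by rewrite /node4 mulr0 zinit.
  rewrite /Rn e1 mulr_sumr -!sumrB; apply: eq_bigr => i _.
  by rewrite mulr_sumr -!sumrB.
have [p3 [p2 p1]] := mesh4_pow n.
have le1 : (1 : R) <= 2 ^+ n by rewrite exprn_ege1// ler1n.
have e8 : (0 : R) < 8^-1 ^+ n by rewrite exprn_gt0.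
have fb (i : 'I_(4 ^ n)) q : L1 (f i q) /\
    \int[P]_w `|f i q w| <= c * 8^-1 ^+ n.
  have it : tau n i.+1 <= t by exact: node4_let.
  have [_ [sa a2] [sb b2]] := ib q _ _ (t_ge i) (t_le i) it.
  have [sN N2] := noise_sqr q (t_ge i) (t_le i) it.
  have [sz z2] := mo q _ (t_ge i) (le_trans (t_le i) it).
  rewrite -/(a q i) -/(b q i) node4_step in sa a2 sb b2 N2.
  have izb := sqiM_itg mT sz sb.
  have iaN := sqiM_itg mT sa sN.
  have i2 := sqi_itg2 sa.
  have fi : L1 (f i q).
    by apply: (itgD mT); [apply: (itgD mT) => //|]; apply: (itgZ mT).
  split => //.
  apply: (@le_trans _ _ (\int[P]_w (2 * `|z q (tau n i) w * b q i w| +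
     a q i w ^+ 2 + 2 * `|a q i w * dN n q i w|))).
    apply: (le_Rint mT); first exact: itg_norm.
      by apply: (itgD mT); [apply: (itgD mT) => //|]; apply: (itgZ mT);
        exact: itg_norm.
    move=> w _; rewrite /f; apply: le_trans (ler_normD _ _) _.
    apply: lerD; last by rewrite normrM ger0_norm.
    apply: le_trans (ler_normD _ _) _; apply: lerD.
      by rewrite normrM ger0_norm.
    by rewrite ger0_norm// sqr_ge0.
  rewrite (RintD mT); last 2 first.
  - by apply: (itgD mT) => //; apply: (itgZ mT); exact: itg_norm.
  - by apply: (itgZ mT); exact: itg_norm.
  rewrite (RintD mT)//; last by apply: (itgZ mT); exact: itg_norm.
  rewrite !(RintZ mT); [|exact: itg_norm..].
  rewrite /c [leRHS]mulrDl [X in _ <= X + _]mulrDl -[X in _ <= X + _ + _]mulrA -[X in _ <= _ + X]mulrA.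
  apply: lerD; first apply: lerD.
  (* The weight [8 ^- n] matches the order [mesh ^ 3] of the second factor, since
     [mesh ^ 3 * 8 ^ n] is of order [8 ^- n]. *)
  - rewrite ler_wpM2l//; apply: le_trans
      (Rintegral_normM_le mT sz sb e8 z2 b2) _.
    rewrite exprVn invrK -exprVn mulrCA (mulrC (8 ^+ n)) p3 mulrDl.
    by rewrite (mulrC _ C1) mulrA.
  - apply: le_trans a2 _; rewrite -mulrA -p2 ler_wpM2l// ler_peMr//.
    exact: sqr_ge0.
  (* The weight [2 ^ n] balances the orders [mesh ^ 2] and [mesh] of the two
     factors. *)
  - have e2 : (0 : R) < 2 ^+ n by rewrite exprn_gt0.
    have tl : tail q 0 * mesh4 t n <= Tt * mesh4 t n.
      rewrite ler_wpM2r// /Tt (bigD1 q)//= lerDl.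
      by apply: sumr_ge0 => p _; exact: tail_ge0.
    rewrite ler_wpM2l//; apply: le_trans
      (Rintegral_normM_le mT sa sN e2 a2 (le_trans N2 tl)) _.
    have -> : 2 ^+ n * (C * mesh4 t n ^+ 2) + (2 ^+ n)^-1 * (Tt * mesh4 t n) =
        C * (mesh4 t n ^+ 2 * 2 ^+ n) + Tt * (mesh4 t n * 2^-1 ^+ n).
      by rewrite exprVn; ring.
    by rewrite p2 p1 mulrDl !mulrA.
have iR : L1 Rn.
  apply: (itg_eq mT (f := fun w => \sum_(i < 4 ^ n) \sum_q f i q w)).
    by move=> w _; rewrite RnE.
  by apply: (itg_sum mT) => i _; apply: (itg_sum mT) => q _; exact: (fb i q).1.
split => //.
apply: le_trans (Rint_sum_mesh (f := fun i q w => `|f i q w|) _ (c := c) _).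
- apply: (le_Rint mT); first exact: itg_norm.
    apply: (itg_sum mT) => i _; apply: (itg_sum mT) => q _.
    by apply: itg_norm; exact: (fb i q).1.
  move=> w _; rewrite RnE; apply: le_trans (ler_norm_sum _ _ _) _.
  by apply: ler_sum => i _; exact: ler_norm_sum.
- by move=> i q; apply: itg_norm; exact: (fb i q).1.
- by move=> i q; exact: (fb i q).2.
Qed.

(** The terms of the sum are orthogonal because each one is centred given its
    past, and fourth moments bound their squares. The constant is 2 * (128 +
    128) + 2: the two fourth moments, and the mean that is subtracted. *)
Lemma cross_variation_sqr m m' n k : (k <= 4 ^ n)%N ->
  let V w := \sum_(i < k) (inc m (tau n i) (tau n i.+1) w *
    inc m' (tau n i) (tau n i.+1) w - (m == m')%:R * mesh4 t n) in
  [/\ measurable_wrt (F (tau n k)) V, L2 V &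
    \int[P]_w V w ^+ 2 <= k%:R * (514 * mesh4 t n ^+ 2)].
Proof.
have fP : (P setT < +oo)%E by rewrite probability_setT ltry.
elim: k => [_|k IH kn] V.
  have V0 w : V w = 0 by rewrite /V big_ord0.
  split.
  - rewrite [V](_ : _ = fun=> 0); last exact/funext.
    by apply: (mwrt_cst hF); exact: node4_ge0.
  - by apply: (sqi_eq mT _ (sqi0 P mT)) => w _.
  - under eq_Rintegral do rewrite V0 expr0n/=.
    by rewrite Rintegral_cst// !mul0r.
have [] := IH (ltnW kn).
set S := fun w => \sum_(i < k) _; move=> aS sS eS.
have r0 : 0 <= tau n k by exact: node4_ge0.
have rs : tau n k <= tau n k.+1 by exact: node4_le.
set r := tau n k in r0 rs aS *; set s := tau n k.+1 in rs *.
have dE : s - r = mesh4 t n by exact: node4_step.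
pose de : R := (m == m')%:R * mesh4 t n.
pose x w := inc m r s w * inc m' r s w - de.
have VE w : V w = S w + x w by rewrite /V big_ord_recr.
have [[i1 i2 i4 _ _] b4] := inc_moments hF hB m r0 rs.
have [[i1' i2' i4' _ _] b4'] := inc_moments hF hB m' r0 rs.
have mh0 := mesh4_ge0 t0 n.
have de2 : de ^+ 2 <= mesh4 t n ^+ 2.
  by rewrite /de; case: eqP => _; rewrite ?mul1r// mul0r expr0n/= sqr_ge0.
have mx : measurable_fun setT x.
  apply: measurable_funB => //.
  exact: measurable_funM (itg_meas i1) (itg_meas i1').
have ib : L1 (fun w => 2 * (inc m r s w ^+ 4 + inc m' r s w ^+ 4) +
    2 * mesh4 t n ^+ 2).
  by apply: (itgD mT); [apply: (itgZ mT); exact: itgD|exact: itg_cst].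
have xb w : x w ^+ 2 <= 2 * (inc m r s w ^+ 4 + inc m' r s w ^+ 4) +
    2 * mesh4 t n ^+ 2.
  apply: le_trans (_ : 2 * (inc m r s w * inc m' r s w) ^+ 2 + 2 * (- de) ^+ 2 <= _).
    exact: sqrD_le.
  rewrite sqrrN; apply: lerD; rewrite ler_wpM2l//.
  rewrite exprMn; apply: le_trans (ler_norm _) _.
  by apply: le_trans (normM_le _ _) _; rewrite -!exprM.
have sx : L2 x by apply: (sqi_le mT mx ib) => w _.
have x2 : \int[P]_w x w ^+ 2 <= 514 * mesh4 t n ^+ 2.
  apply: le_trans (le_Rint mT _ ib (fun w _ => xb w)) _; first exact: sqi_itg2.
  rewrite (RintD mT); [|by apply: (itgZ mT); exact: itgD|exact: itg_cst].
  rewrite (RintZ mT); last exact: itgD.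
  rewrite (RintD mT)// Rint_cst_prob; rewrite dE in b4 b4'; lra.
have Sx : \int[P]_w (S w * x w) = 0.
  have iS := sqi_itg mT fP sS.
  rewrite /x /de; have [->|mm] := eqVneq m m'.
    have [j1 j2] := Rintegral_mul_inc_sqr hF hB m' r0 rs aS iS.
    transitivity (\int[P]_w (S w * inc m' r s w ^+ 2 - mesh4 t n * S w)).
      by apply: eq_Rintegral => w _; rewrite /=; ring.
    by rewrite (RintB mT)//; [rewrite j2 dE (RintZ mT)// subrr|exact: itgZ].
  have [j1 j2] := Rintegral_mul_inc_inc hF hB r0 rs mm aS iS.
  rewrite -[RHS]j2; apply: eq_Rintegral => w _.
  by rewrite /=; ring.
have s0 : 0 <= s by exact: node4_ge0.
split.
- rewrite [V](_ : _ = fun w => S w + x w); last exact/funext.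
  apply: (mwrtD hF) => //; first exact: (mwrt_mono hF r0 rs).
  apply: (mwrtB hF) => //; last exact: (mwrt_cst hF).
  by apply: (mwrtM hF) => //; exact: (inc_mwrt hF hB).
- by apply: (sqi_eq mT _ (sqiD mT sS sx)) => w _; rewrite VE.
- have -> : \int[P]_w V w ^+ 2 =
      \int[P]_w (S w ^+ 2 + 2 * (S w * x w) + x w ^+ 2).
    by apply: eq_Rintegral => w _; rewrite VE; ring.
  have iSx := sqiM_itg mT sS sx.
  rewrite (RintD mT); last 2 first.
  + by apply: (itgD mT); [exact: sqi_itg2|exact: itgZ].
  + exact: sqi_itg2.
  rewrite (RintD mT); last 2 first.
  + exact: sqi_itg2.
  + exact: itgZ.
  rewrite (RintZ mT)// Sx mulr0 addr0 -natr1 mulrDl mul1r.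
  exact: lerD.
Qed.

Lemma cvg_cross_variation m m' :
  \int[P]_w `|\sum_(i < 4 ^ n) (inc m (tau n i) (tau n i.+1) w *
    inc m' (tau n i) (tau n i.+1) w - (m == m')%:R * mesh4 t n)|
  @[n --> \oo] --> (0 : R).
Proof.
have h n := cross_variation_sqr m m' (leqnn (4 ^ n)).
apply: cvg_L1_of_L2; first by move=> n; have [] := h n.
apply: (@squeeze_cvgr _ _ _ _ (fun=> 0) (fun n => 514 * t ^+ 2 * 4^-1 ^+ n)).
- near=> n; apply/andP; split.
    by apply: Rintegral_ge0 => w _; exact: sqr_ge0.
  have [_ _ V2] := h n; apply: le_trans V2 _.
  rewrite le_eqVlt; apply/orP; left; apply/eqP.
  have e4 : (4 : R) ^+ n * 4^-1 ^+ n = 1 by rewrite -exprMn mulfV// expr1n.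
  rewrite /mesh4 natrX; set x := 4 ^+ n in e4 *; set y := 4^-1 ^+ n in e4 *.
  have -> : x * (514 * (t * y) ^+ 2) = 514 * t ^+ 2 * y * (x * y) by ring.
  by rewrite e4 mulr1.
- exact: cvg_cst.
- rewrite -(mulr0 (514 * t ^+ 2)); apply: cvgM; first exact: cvg_cst.
  by apply: cvg_expr; rewrite ger0_norm// invf_lt1// ltr1n.
Unshelve. all: by end_near. Qed.

(** The quadratic variation of the noise per unit of time. *)
Definition bracket q : R := limn (series (fun m => G q m ^+ 2)).

Lemma sqr_diff_le (x y l : R) : 0 < l ->
  `|x ^+ 2 - y ^+ 2| <= (2 * l^-1 + 1) * (x - y) ^+ 2 + 2 * l * x ^+ 2.
Proof.
move=> l0; have -> : x ^+ 2 - y ^+ 2 = 2 * (x * (x - y)) - (x - y) ^+ 2 by ring.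
apply: le_trans (ler_normB _ _) _.
rewrite (ger0_norm (sqr_ge0 _)) normrM ger0_norm//.
have := young x (x - y) l0; lra.
Qed.

(** With the noise truncated to its first [M] motions this is
    [cvg_cross_variation], and the truncation costs, uniformly in the
    partition, a multiple of [l] plus a multiple of [tail q M] that depends on
    [l]. So [l] is chosen first, then [M], then [n]. *)
Lemma quadratic_variation q :
  \int[P]_w `|\sum_(i < 4 ^ n) dN n q i w ^+ 2 - bracket q * t|
    @[n --> \oo] --> (0 : R).
Proof.
have fP : (P setT < +oo)%E by rewrite probability_setT ltry.
pose V m m' n w := \sum_(i < 4 ^ n) (inc m (tau n i) (tau n i.+1) w *
    inc m' (tau n i) (tau n i.+1) w - (m == m')%:R * mesh4 t n).
have sV m m' n : L2 (V m m' n).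
  by have [] := cross_variation_sqr m m' (leqnn (4 ^ n)).
have t_ge n i : 0 <= tau n i by exact: node4_ge0.
have t_le n i : tau n i <= tau n i.+1 by exact: node4_le.
have T0 := tail_ge0 q 0.
have bound l M n : 0 < l ->
    \int[P]_w `|\sum_(i < 4 ^ n) dN n q i w ^+ 2 - bracket q * t| <=
    t * ((2 * l^-1 + 1) * tail q M + 2 * l * tail q 0) + tail q M * t +
    \sum_(m < M) \sum_(m' < M) `|G q m * G q m'| * \int[P]_w `|V m m' n w|.
  move=> l0.
  pose b (i : nat) w := \sum_(m < M) G q m * inc m (tau n i) (tau n i.+1) w.
  pose u (i : 'I_(4 ^ n)) w := (2 * l^-1 + 1) * (dN n q i w - b i w) ^+ 2 +
    2 * l * dN n q i w ^+ 2.
  pose v w := \sum_(m < M) \sum_(m' < M) `|G q m * G q m'| * `|V m m' n w|.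
  have cu : 0 <= 2 * l^-1 + 1 by rewrite addr_ge0// mulr_ge0// invr_ge0 ltW.
  have cl : 0 <= 2 * l by rewrite mulr_ge0// ltW.
  have dNi (i : 'I_(4 ^ n)) : L2 (fun w => dN n q i w) /\
      \int[P]_w dN n q i w ^+ 2 <= tail q 0 * mesh4 t n.
    rewrite -(node4_step t n i); apply: noise_sqr => //; exact: node4_let.
  have ui i : L1 (u i) /\ \int[P]_w u i w <=
      ((2 * l^-1 + 1) * tail q M + 2 * l * tail q 0) * mesh4 t n.
    have it : tau n i.+1 <= t by exact: node4_let.
    have [s1 h1] := noise_increment q M (t_ge n i) (t_le n i) it.
    have [s2 h2] := dNi i.
    rewrite node4_step in h1.
    split; first by apply: (itgD mT); apply: (itgZ mT); exact: sqi_itg2.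
    rewrite (RintD mT); [|by apply: (itgZ mT); exact: sqi_itg2..].
    rewrite !(RintZ mT); [|exact: sqi_itg2..].
    by rewrite [leRHS]mulrDl -!mulrA !(mulrA 2); apply: lerD; rewrite ler_wpM2l.
  have vi : L1 v.
    apply: (itg_sum mT) => m _; apply: (itg_sum mT) => m' _.
    by apply: (itgZ mT); apply: itg_norm; exact: (sqi_itg mT fP).
  have path w : `|\sum_(i < 4 ^ n) dN n q i w ^+ 2 - bracket q * t| <=
      (\sum_(i < 4 ^ n) u i w + tail q M * t) + v w.
    have -> : \sum_(i < 4 ^ n) dN n q i w ^+ 2 - bracket q * t =
        \sum_(i < 4 ^ n) (dN n q i w ^+ 2 - b i w ^+ 2) - tail q M * t +
        (\sum_(i < 4 ^ n) b i w ^+ 2 - series (fun m => G q m ^+ 2) M * t).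
      by rewrite sumrB /bracket /tail; ring.
    apply: le_trans (ler_normD _ _) _; apply: lerD.
      apply: le_trans (ler_normB _ _) _; apply: lerD; last first.
        by rewrite ger0_norm// mulr_ge0// tail_ge0.
      apply: le_trans (ler_norm_sum _ _ _) _; apply: ler_sum => i _.
      exact: sqr_diff_le.
    have -> : \sum_(i < 4 ^ n) b i w ^+ 2 - series (fun m => G q m ^+ 2) M * t =
        \sum_(m < M) \sum_(m' < M) (G q m * G q m') * V m m' n w.
      have e1 : series (fun m => G q m ^+ 2) M * t =
          \sum_(i < 4 ^ n) \sum_(m < M) \sum_(m' < M)
            G q m * G q m' * ((m == m' :> nat)%:R * mesh4 t n).
        rewrite big_const_ord iter_addr_0 -mulr_natl /series/= big_mkord.
        have -> : \sum_(m < M) \sum_(m' < M)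
            G q m * G q m' * ((m == m' :> nat)%:R * mesh4 t n) =
            (\sum_(m < M) G q m ^+ 2) * mesh4 t n.
          rewrite mulr_suml; apply: eq_bigr => m _.
          rewrite (bigD1 m)//= eqxx mul1r big1 ?addr0// => m' mm'.
          by rewrite eq_sym (inj_eq val_inj) (negbTE mm') mul0r mulr0.
        by rewrite mulrCA mesh4_sum.
      rewrite e1 -sumrB.
      transitivity (\sum_(i < 4 ^ n) \sum_(m < M) \sum_(m' < M)
         G q m * G q m' * (inc m (tau n i) (tau n i.+1) w *
           inc m' (tau n i) (tau n i.+1) w - (m == m' :> nat)%:R * mesh4 t n)).
        apply: eq_bigr => i _; rewrite expr2 /b mulr_suml -sumrB.
        apply: eq_bigr => m _; rewrite mulr_sumr -sumrB.
        by apply: eq_bigr => m' _; ring.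
      rewrite exchange_big/=; apply: eq_bigr => m _.
      rewrite exchange_big/=; apply: eq_bigr => m' _.
      by rewrite -mulr_sumr.
    apply: le_trans (ler_norm_sum _ _ _) _; apply: ler_sum => m _.
    apply: le_trans (ler_norm_sum _ _ _) _; apply: ler_sum => m' _.
    by rewrite normrM.
  have iu : L1 (fun w => \sum_(i < 4 ^ n) u i w).
    by apply: (itg_sum mT) => i _; exact: (ui i).1.
  have ic : L1 (fun=> tail q M * t) by exact: itg_cst.
  apply: (@le_trans _ _ (\int[P]_w
    ((\sum_(i < 4 ^ n) u i w + tail q M * t) + v w))).
    apply: (le_Rint mT); [|by do 2 apply: (itgD mT) => //|by move=> w _].
    apply: itg_norm; apply: (itgB mT) => //; last exact: itg_cst.
    by apply: (itg_sum mT) => i _; exact: (sqi_itg2 (dNi i).1).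
  rewrite (RintD mT)//; last exact: itgD.
  rewrite (RintD mT)// Rint_cst_prob; apply: lerD; first apply: lerD.
  - rewrite (Rintegral_sum mT); last by move=> i _; exact: (ui i).1.
    apply: (@le_trans _ _ (\sum_(i < 4 ^ n)
      ((2 * l^-1 + 1) * tail q M + 2 * l * tail q 0) * mesh4 t n)).
      by apply: ler_sum => i _; exact: (ui i).2.
    rewrite big_const_ord iter_addr_0 -[X in X <= _]mulr_natl.
    by rewrite [X in X <= _]mulrCA mesh4_sum [X in X <= _]mulrC.
  - by [].
  - rewrite (Rintegral_sum mT); last first.
      move=> m _; apply: (itg_sum mT) => m' _.
      by apply: (itgZ mT); apply: itg_norm; exact: (sqi_itg mT fP).
    apply: ler_sum => m _; rewrite (Rintegral_sum mT); last first.
      move=> m' _; apply: (itgZ mT); apply: itg_norm; exact: (sqi_itg mT fP).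
    apply: ler_sum => m' _; rewrite (RintZ mT)//.
    by apply: itg_norm; exact: (sqi_itg mT fP).
apply/cvgr0Pnorm_lt => e e0.
pose l := e / (8 * (t * tail q 0 + 1)).
have tT : 0 < t * tail q 0 + 1 by rewrite ltr_wpDl// mulr_ge0.
have l0 : 0 < l by rewrite divr_gt0// mulr_gt0.
have l1 : t * (2 * l * tail q 0) <= e / 4.
  have -> : t * (2 * l * tail q 0) = (e / 4) * (t * tail q 0 / (t * tail q 0 + 1)).
    by rewrite /l; field; rewrite gt_eqF.
  by rewrite ler_piMr// ?divr_ge0 ?(ltW e0)// ler_pdivrMr// mul1r lerDl.
have [M Me] : exists M, (t * (2 * l^-1 + 1) + t) * tail q M < e / 4.
  have c1 : (t * (2 * l^-1 + 1) + t) * tail q M @[M --> \oo] --> (0 : R).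
    rewrite -(mulr0 (t * (2 * l^-1 + 1) + t)).
    by apply: cvgM; [exact: cvg_cst|exact: cvg_tail].
  have e4 : 0 < e / 4 by rewrite divr_gt0.
  have /cvgr0Pnorm_lt/(_ _ e4) [M _ /(_ M (leqnn M)) h] := c1.
  by exists M; apply: le_lt_trans h; exact: ler_norm.
have c2 : \sum_(m < M) \sum_(m' < M)
    `|G q m * G q m'| * \int[P]_w `|V m m' n w| @[n --> \oo] --> (0 : R).
  have s0 : \sum_(m < M) \sum_(m' < M) (`|G q m * G q m'| * 0) = 0.
    by rewrite big1// => m _; rewrite big1// => m' _; rewrite mulr0.
  rewrite -[X in _ --> X]s0.
  apply: cvg_sumr => m; apply: cvg_sumr => m'.
  by apply: cvgM; [exact: cvg_cst|exact: cvg_cross_variation].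
have e4 : 0 < e / 4 by rewrite divr_gt0.
have /cvgr0Pnorm_lt/(_ _ e4) := c2.
apply: filterS => n hn; rewrite ger0_norm; last exact: Rintegral_ge0.
apply: le_lt_trans (bound l M n l0) _.
have := le_lt_trans (ler_norm _) hn; nra.
Qed.

Variables (sg : nat -> R) (c : I -> nat -> R).
Hypothesis GE : forall q m, G q m = sg m * c q m.

Notation Xm m := (fun s w => \sum_q c q m * z q s w).

Definition truncated_sum M n w :=
  \sum_(i < 4 ^ n) \sum_q z q (tau n i) w *
    \sum_(m < M) G q m * inc m (tau n i) (tau n i.+1) w.

Lemma truncated_sumE M n w :
  truncated_sum M n w = \sum_(m < M) sg m * left_sum B t m (Xm m) n w.
Proof.
rewrite /truncated_sum /left_sum.
under [RHS]eq_bigr do rewrite mulr_sumr.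
rewrite [RHS]exchange_big/=; apply: eq_bigr => i _.
under eq_bigr do rewrite mulr_sumr.
rewrite exchange_big/=; apply: eq_bigr => m _.
rewrite mulr_suml mulr_sumr; apply: eq_bigr => q _.
by rewrite GE; ring.
Qed.

(** On each time interval the truncation error is as small as one likes for [M]
    large, so a level depending on [n] makes the error small after summation
    over the [4 ^ n] intervals. *)
Lemma truncation_level : exists (K : R) (N : nat -> nat), forall n M, (N n <= M)%N ->
  let S w := \sum_(i < 4 ^ n) \sum_q z q (tau n i) w * dN n q i w in
  [/\ L1 S, L1 (truncated_sum M n) &
    \int[P]_w `|S w - truncated_sum M n w| <= K * 2^-1 ^+ n].
Proof.
have [C1 [C10 mo]] := moment_bound.
have /choice[N hN] : forall n, exists N, forall M, (N <= M)%N ->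
    forall q, tail q M * mesh4 t n <= 8^-1 ^+ n * 8^-1 ^+ n.
  move=> n.
  have e0 : (0 : R) < 8^-1 ^+ n * 8^-1 ^+ n by rewrite mulr_gt0 ?exprn_gt0.
  have c1 : (\sum_q tail q M) * mesh4 t n @[M --> \oo] --> (0 : R).
    rewrite -[X in _ --> X](mul0r (mesh4 t n)); apply: cvgM; last exact: cvg_cst.
    exact: cvg_sum_tail.
  have /cvgr0Pnorm_lt/(_ _ e0) [N _ hN] := c1; exists N => M NM q.
  have := ltW (le_lt_trans (ler_norm _) (hN M NM)); apply: le_trans.
  rewrite ler_wpM2r ?mesh4_ge0// (bigD1 q)//= lerDl.
  by apply: sumr_ge0 => p _; exact: tail_ge0.
exists (#|I|%:R * (C1 + 1)), N => n M NM S.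
have t_ge i : 0 <= tau n i by exact: node4_ge0.
have t_le i : tau n i <= tau n i.+1 by exact: node4_le.
have e8 : (0 : R) < 8^-1 ^+ n by rewrite exprn_gt0.
pose b q (i : nat) w := \sum_(m < M) G q m * inc m (tau n i) (tau n i.+1) w.
have sz q (i : 'I_(4 ^ n)) : L2 (z q (tau n i)) /\
    \int[P]_w z q (tau n i) w ^+ 2 <= C1.
  by apply: mo => //; apply: node4_let => //; exact: ltnW.
have iS : L1 S.
  apply: (itg_sum mT) => i _; apply: (itg_sum mT) => q _.
  apply: (sqiM_itg mT (sz q i).1); apply: (noise_sqr q _ _ _).1 => //.
  exact: node4_let.
have iT : L1 (truncated_sum M n).
  apply: (itg_sum mT) => i _; apply: (itg_sum mT) => q _.
  by apply: (sqiM_itg mT (sz q i).1); exact: sqi_inc_sum.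
split => //.
pose f (i : 'I_(4 ^ n)) q w := `|z q (tau n i) w * (dN n q i w - b q i w)|.
have fb i q : L1 (f i q) /\ \int[P]_w f i q w <= (C1 + 1) * 8^-1 ^+ n.
  have it : tau n i.+1 <= t by exact: node4_let.
  have [sN N2] := noise_increment q M (t_ge i) (t_le i) it.
  have [s1 z2] := sz q i.
  split; first by apply: itg_norm; exact: (sqiM_itg mT s1 sN).
  rewrite node4_step in N2.
  apply: le_trans (Rintegral_normM_le mT s1 sN e8 z2
    (le_trans N2 (hN n M NM q))) _.
  rewrite mulrA mulVf ?gt_eqF// mul1r mulrDl mul1r.
  by rewrite [X in X + _ <= _]mulrC.
have := Rint_sum_mesh (fun i q => (fb i q).1) (fun i q => (fb i q).2).
apply: le_trans; apply: (le_Rint mT).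
- by apply: itg_norm; exact: itgB.
- by apply: (itg_sum mT) => i _; apply: (itg_sum mT) => q _; exact: (fb i q).1.
move=> w _; rewrite /S /truncated_sum -sumrB.
apply: le_trans (ler_norm_sum _ _ _) _; apply: ler_sum => i _.
rewrite -sumrB; apply: le_trans (ler_norm_sum _ _ _) _.
by apply: ler_sum => q _; rewrite -mulrBr.
Qed.

Let kap := \sum_q bracket q.

(** What the energy identity forces the stochastic integral to be;
    [energy_identity] shows that it is one. *)
Definition energy_martingale w : R :=
  (\sum_q z q t w ^+ 2 - \sum_q z0 q ^+ 2 - kap * t) / 2.

Lemma itg_energy : L1 energy_martingale.
Proof.
have fP : (P setT < +oo)%E by rewrite probability_setT ltry.
have [C1 [C10 mo]] := moment_bound.
apply: (itg_eq mT (f := fun w =>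
  2^-1 * (\sum_q z q t w ^+ 2 - \sum_q z0 q ^+ 2 - kap * t))).
  by move=> w _; rewrite /energy_martingale mulrC.
apply: (itgZ mT); apply: (itgB mT); last exact: itg_cst.
apply: (itgB mT); last exact: itg_cst.
by apply: (itg_sum mT) => q _; apply: sqi_itg2; exact: (mo q t t0 (lexx t)).1.
Qed.

(** The error has three parts, bounded by [truncation_level],
    [energy_remainder] and [quadratic_variation]. *)
Lemma truncated_sum_cvg : exists N : nat -> nat, forall M' : nat -> nat,
  (forall n, (N n <= M' n)%N) ->
  (forall n, L1 (truncated_sum (M' n) n)) /\
  \int[P]_w `|truncated_sum (M' n) n w - energy_martingale w|
    @[n --> \oo] --> (0 : R).
Proof.
have fP : (P setT < +oo)%E by rewrite probability_setT ltry.
have [K1 [N hN]] := truncation_level; have [K2 er] := energy_remainder.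
exists N => M' NM'; split; first by move=> n; have [] := hN n _ (NM' n).
pose S n w := \sum_(i < 4 ^ n) \sum_q z q (tau n i) w * dN n q i w.
pose Rn n w := \sum_q (z q t w ^+ 2 - z0 q ^+ 2) - 2 * S n w
    - \sum_(i < 4 ^ n) \sum_q dN n q i w ^+ 2.
pose Q n q w := \sum_(i < 4 ^ n) dN n q i w ^+ 2 - bracket q * t.
have iQ n q : L1 (Q n q).
  apply: (itgB mT); last exact: itg_cst.
  apply: (itg_sum mT) => i _; apply: sqi_itg2.
  apply: (noise_sqr q _ _ _).1; [exact: node4_ge0|exact: node4_le|].
  exact: node4_let.
apply: (@squeeze_cvgr _ _ _ _ (fun=> 0) (fun n => K1 * 2^-1 ^+ n +
  (K2 * 2^-1 ^+ n + \sum_q \int[P]_w `|Q n q w|))).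
- near=> n; apply/andP; split; first exact: Rintegral_ge0.
  have [iS iT TS] := hN n _ (NM' n); have [iR eR] := er n.
  have iQs : L1 (fun w => \sum_q `|Q n q w|).
    by apply: (itg_sum mT) => q _; exact: itg_norm.
  have iST : L1 (fun w => `|S n w - truncated_sum (M' n) n w|).
    by apply: itg_norm; exact: itgB.
  have iRn : L1 (fun w => `|Rn n w|) by exact: itg_norm.
  apply: (@le_trans _ _ (\int[P]_w (`|S n w - truncated_sum (M' n) n w| +
    (`|Rn n w| + \sum_q `|Q n q w|)))).
    apply: (le_Rint mT).
    + by apply: itg_norm; apply: (itgB mT) => //; exact: itg_energy.
    + by apply: (itgD mT) => //; exact: itgD.
    move=> w _.
    have -> : truncated_sum (M' n) n w - energy_martingale w =
        - (S n w - truncated_sum (M' n) n w) + - ((Rn n w + \sum_q Q n q w) / 2).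
      rewrite /energy_martingale /Rn /Q sumrB [in RHS]sumrB -mulr_suml -/kap.
      have -> : \sum_q \sum_(i < 4 ^ n) dN n q i w ^+ 2 =
          \sum_(i < 4 ^ n) \sum_q dN n q i w ^+ 2 by rewrite exchange_big.
      by field.
    apply: le_trans (ler_normD _ _) _; rewrite !normrN lerD2l.
    rewrite normrM [ `|2^-1|]ger0_norm ?invr_ge0//.
    apply: (@le_trans _ _ `|Rn n w + \sum_q Q n q w|).
      by rewrite ler_piMr// invf_le1// ler1n.
    by apply: le_trans (ler_normD _ _) _; rewrite lerD2l ler_norm_sum.
  rewrite (RintD mT)//; last exact: itgD.
  rewrite (RintD mT)//; apply: lerD => //; apply: lerD => //.
  by rewrite (Rintegral_sum mT)// => q _; exact: itg_norm.
- exact: cvg_cst.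
- have h K : K * 2^-1 ^+ n @[n --> \oo] --> (0 : R).
    by under eq_fun do rewrite -[_ * _]mulr1; exact: cvg_half.
  rewrite -[X in _ --> X](addr0 0); apply: cvgD; first exact: h.
  rewrite -[X in _ --> X](addr0 0); apply: cvgD; first exact: h.
  have s0 : \sum_(q : I) (0 : R) = 0 by rewrite big1.
  by rewrite -[X in _ --> X]s0; apply: cvg_sumr => q; exact: quadratic_variation.
Unshelve. all: by end_near. Qed.

(** The difference is a martingale transform of the motions of index at least
    [M]. The bound depends neither on the partition nor on the larger level, so
    it survives both limits. *)
Lemma truncated_sum_diff : exists K : R, forall n M M', (M <= M')%N ->
  let D w := truncated_sum M' n w - truncated_sum M n w in
  [/\ L2 D, \int[P]_w D w = 0 & \int[P]_w D w ^+ 2 <= K * \sum_q tail q M].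
Proof.
have [C1 [C10 mo]] := moment_bound.
exists (#|I|%:R * C1 * t) => n M M' MM' D.
pose Y i m : Omega -> R := if (m < M)%N then fun=> 0
  else fun w => \sum_q G q m * z q (tau n i) w.
have aY i m : (i < 4 ^ n)%N -> (m < M')%N -> measurable_wrt (F (tau n i)) (Y i m).
  move=> iln _; rewrite /Y; case: ifP => _.
    by apply: (mwrt_cst hF); exact: node4_ge0.
  apply: (mwrt_sum hF); first exact: node4_ge0.
  move=> q _; apply: (mwrtM hF); first exact: node4_ge0.
    by apply: (mwrt_cst hF); exact: node4_ge0.
  by apply: az; exact: node4_ge0.
have zl i (iln : (i < 4 ^ n)%N) q := mo q _ (node4_ge0 t0 n i)
  (node4_let t0 (ltnW iln)).
have sY i m : (i < 4 ^ n)%N -> (m < M')%N -> L2 (Y i m).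
  move=> iln _; rewrite /Y; case: ifP => _; first exact: (sqi0 P mT).
  exact: (sqi_lin (G ^~ m) (fun q => (zl i iln q).1) (fun q => (zl i iln q).2)).1.
have [_ s1 s2 s3] := transform_isometry hF hB (node4_ge0 t0 n 0)
  (fun i (_ : (i < 4 ^ n)%N) => node4_le t0 n (leqnSn i)) aY sY.
have DE w : D w = \sum_(i < 4 ^ n) \sum_(m < M') Y i m w *
    inc m (tau n i) (tau n i.+1) w.
  rewrite /D /truncated_sum -sumrB; apply: eq_bigr => i _.
  rewrite -sumrB.
  transitivity (\sum_q \sum_(M <= m < M') z q (tau n i) w *
      (G q m * inc m (tau n i) (tau n i.+1) w)).
    apply: eq_bigr => q _; rewrite -mulrBr -mulr_sumr; congr (_ * _).
    rewrite -!(big_mkord xpredT (fun m => G q m * inc m (tau n i) (tau n i.+1) w)).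
    by rewrite (big_cat_nat (leq0n M) MM')/= addrC addrK.
  rewrite exchange_big/=.
  rewrite -(big_mkord xpredT (fun m => Y i m w * inc m (tau n i) (tau n i.+1) w)).
  have -> : \sum_(0 <= m < M') Y i m w * inc m (tau n i) (tau n i.+1) w =
      \sum_(M <= m < M') Y i m w * inc m (tau n i) (tau n i.+1) w.
    rewrite (big_cat_nat (leq0n M) MM')/= big_nat big1 ?add0r//.
    by move=> m /andP[_ mM]; rewrite /Y mM mul0r.
  rewrite !big_nat; apply: eq_bigr => m /andP[Mm _].
  by rewrite /Y ltnNge Mm/= mulr_suml; apply: eq_bigr => q _; ring.
split.
- by apply: (sqi_eq mT _ s1) => w _; rewrite DE.
- by rewrite -[RHS]s2; apply: eq_Rintegral => w _; rewrite DE.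
- under eq_Rintegral do rewrite DE.
  rewrite s3; apply: (@le_trans _ _ (\sum_(i < 4 ^ n)
      mesh4 t n * (#|I|%:R * C1 * \sum_q tail q M))); last first.
    rewrite big_const_ord iter_addr_0 -[X in X <= _]mulr_natl mulrA mesh4_sum.
    by rewrite [X in _ <= X * _]mulrC mulrA.
  apply: ler_sum => i _; rewrite -mulr_sumr node4_step ler_wpM2l ?mesh4_ge0//.
  rewrite -(big_mkord xpredT (fun m => \int[P]_w Y i m w ^+ 2)).
  rewrite (big_cat_nat (leq0n M) MM')/= big_nat big1 ?add0r; last first.
    move=> m /andP[_ mM]; rewrite /Y mM expr0n/= Rintegral_cst// mul0r//.
  apply: (@le_trans _ _ (\sum_(M <= m < M') #|I|%:R * (\sum_q G q m ^+ 2) * C1)).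
    rewrite big_nat [leRHS]big_nat; apply: ler_sum => m /andP[Mm _].
    rewrite /Y ltnNge Mm/=.
    exact: (sqi_lin (G ^~ m) (fun q => (zl i (ltn_ord i) q).1)
      (fun q => (zl i (ltn_ord i) q).2)).2.
  rewrite -mulr_suml -mulr_sumr mulrAC ler_wpM2l ?mulr_ge0//.
  rewrite exchange_big/=; apply: ler_sum => q _; exact: tail_ge.
Qed.

(** At a fixed level [M] the truncated sums converge to a combination of [M]
    Ito integrals; at levels that grow fast enough with [n] they converge to
    the energy martingale. The distance of the two limits inherits the uniform
    bound of [truncated_sum_diff], which tends to 0 with [M]. *)
Theorem energy_identity : exists J : nat -> Omega -> R,
  [/\ forall m, is_ito P F (B m) (Xm m) t (J m),
    L2_cvg P (fun M w => \sum_(m < M) sg m * J m w) energy_martingale,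
    \int[P]_w energy_martingale w = 0 &
    forall w, \sum_q z q t w ^+ 2 =
      2 * energy_martingale w + \sum_q z0 q ^+ 2 + kap * t].
Proof.
have fP : (P setT < +oo)%E by rewrite probability_setT ltry.
have [C1 [C10 mo]] := moment_bound.
have [C [C0 ib]] := increment_bounds.
have [K tsd] := truncated_sum_diff.
have [N tsc] := truncated_sum_cvg.
have sX m s : 0 <= s -> s <= t -> L2 (Xm m s).
  move=> s0 st; exact: (sqi_lin (c ^~ m) (fun q => (mo q s s0 st).1)
    (fun q => (mo q s s0 st).2)).1.
have ito m : exists J, is_ito P F (B m) (Xm m) t J /\
    L2_cvg P (left_sum B t m (Xm m)) J.
  apply: (@ito_exists _ _ _ P F B hF hB t t0 m (Xm m)
    (#|I|%:R * (\sum_q c q m ^+ 2) * C)).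
  - by move=> w s; apply: cvg_sumr => q; apply: cvgM; [exact: cvg_cst|exact: cz].
  - by move=> s; apply: measurable_sum => q; exact: measurable_funM.
  - move=> s s0 _; apply: (mwrt_sum hF) => // q _.
    by apply: (mwrtM hF) => //; [exact: (mwrt_cst hF)|exact: az].
  - exact: sX.
  - move=> r s r0 rs st; have s0 := le_trans r0 rs.
    have e w : \sum_q c q m * z q s w - \sum_q c q m * z q r w =
        \sum_q c q m * (z q s w - z q r w).
      by rewrite -sumrB; apply: eq_bigr => q _; rewrite mulrBr.
    under eq_Rintegral do rewrite e.
    rewrite -mulrA; apply: (sqi_lin (c ^~ m) _ _).2.
    + move=> q; apply: (sqiB mT); apply: (mo _ _ _ _).1 => //.
      exact: le_trans st.
    + by move=> q; have [] := ib q r s r0 rs st.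
have [J hJ] := choice ito.
have sL m n : L2 (left_sum B t m (Xm m) n).
  apply: (@left_sum_sqi _ _ _ P F B hF hB t t0).
  - move=> s s0 _; apply: (mwrt_sum hF) => // q _.
    by apply: (mwrtM hF) => //; [exact: (mwrt_cst hF)|exact: az].
  - exact: sX.
have Jl m : L2 (J m) /\
    \int[P]_w `|left_sum B t m (Xm m) n w - J m w| @[n --> \oo] --> (0 : R).
  have [[_ _ mJ _] cJ] := hJ m.
  by have [] := L2_cvg_real (sL m) mJ cJ.
have sJ M : L2 (fun w => \sum_(m < M) sg m * J m w).
  by apply: (sqi_sum mT) => m _; apply: (sqiZ mT); exact: (Jl m).1.
have iJ M := sqi_itg mT fP (sJ M).
have tsJ M : \int[P]_w `|truncated_sum M n w - \sum_(m < M) sg m * J m w|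
    @[n --> \oo] --> (0 : R).
  apply: (@squeeze_cvgr _ _ _ _ (fun=> 0) (fun n => \sum_(m < M)
    `|sg m| * \int[P]_w `|left_sum B t m (Xm m) n w - J m w|)).
  - near=> n; apply/andP; split; first exact: Rintegral_ge0.
    have il m : L1 (fun w => `|left_sum B t m (Xm m) n w - J m w|).
      by apply: itg_norm; apply: (sqi_itg mT fP); apply: (sqiB mT) => //;
        exact: (Jl m).1.
    apply: (@le_trans _ _ (\int[P]_w (\sum_(m < M)
      `|sg m| * `|left_sum B t m (Xm m) n w - J m w|))).
      apply: (le_Rint mT).
      + apply: itg_norm; apply: (itgB mT) => //.
        apply: (itg_eq mT (fun w _ => esym (truncated_sumE M n w))).
        by apply: (itg_sum mT) => m _; apply: (itgZ mT); exact: (sqi_itg mT fP).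
      + by apply: (itg_sum mT) => m _; exact: itgZ.
      move=> w _; rewrite truncated_sumE -sumrB.
      apply: le_trans (ler_norm_sum _ _ _) _; apply: ler_sum => m _.
      by rewrite -mulrBr normrM.
    rewrite (Rintegral_sum mT); last by move=> m _; exact: itgZ.
    by apply: ler_sum => m _; rewrite (RintZ mT).
  - exact: cvg_cst.
  - have s0 : \sum_(m < M) (`|sg m| * 0) = 0.
      by rewrite big1// => m _; rewrite mulr0.
    rewrite -[X in _ --> X]s0; apply: cvg_sumr => m.
    by apply: cvgM; [exact: cvg_cst|exact: (Jl m).2].
have its M n : L1 (truncated_sum M n).
  apply: (itg_eq mT (fun w _ => esym (truncated_sumE M n w))).
  by apply: (itg_sum mT) => m _; apply: (itgZ mT); exact: (sqi_itg mT fP).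
have iE := itg_energy.
have key M : L2 (fun w => energy_martingale w - \sum_(m < M) sg m * J m w) /\
    \int[P]_w (energy_martingale w - \sum_(m < M) sg m * J m w) ^+ 2 <=
      K * \sum_q tail q M.
  pose M' n := maxn (N n) M.
  have [_ c1] := tsc M' (fun n => leq_maxl _ _).
  pose Z n w := truncated_sum (M' n) n w - truncated_sum M n w.
  apply: (L1_lim_sqr_le mT fP (X := Z)).
  - exact: measurable_funB (itg_meas iE) (itg_meas (iJ M)).
  - by move=> n; have [] := tsd n M (M' n) (leq_maxr _ _).
  - by move=> n; have [] := tsd n M (M' n) (leq_maxr _ _).
  - by move=> n; apply: (itgB mT); exact: itgB.
  - apply: (@squeeze_cvgr _ _ _ _ (fun=> 0) (fun n =>
      \int[P]_w `|truncated_sum (M' n) n w - energy_martingale w| +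
      \int[P]_w `|truncated_sum M n w - \sum_(m < M) sg m * J m w|)).
    + near=> n; apply/andP; split; first exact: Rintegral_ge0.
      have i1 : L1 (fun w => `|truncated_sum (M' n) n w - energy_martingale w|).
        by apply: itg_norm; exact: itgB.
      have i2 : L1 (fun w => `|truncated_sum M n w - \sum_(m < M) sg m * J m w|).
        by apply: itg_norm; exact: itgB.
      rewrite -(RintD mT)//; apply: (le_Rint mT); [|exact: itgD|].
        by apply: itg_norm; apply: (itgB mT); exact: itgB.
      move=> w _; apply: le_trans (ler_normB _ _).
      rewrite le_eqVlt; apply/orP; left; apply/eqP; congr (`| _ |).
      by rewrite /Z; ring.
    + exact: cvg_cst.
    + by rewrite -[X in _ --> X](addr0 0); exact: cvgD.
have sE : L2 energy_martingale.
  by apply: (sqi_eq mT _ (key 0%N).1) => w _; rewrite big_ord0 subr0.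
exists J; split.
- by move=> m; exact: (hJ m).1.
- apply: L2_cvg_ereal => //.
  apply: (@squeeze_cvgr _ _ _ _ (fun=> 0) (fun M => K * \sum_q tail q M)).
  + near=> M; apply/andP; split.
      by apply: Rintegral_ge0 => w _; exact: sqr_ge0.
    apply: le_trans (key M).2; rewrite le_eqVlt; apply/orP; left; apply/eqP.
    by apply: eq_Rintegral => w _; rewrite -sqrrN opprB.
  + exact: cvg_cst.
  + rewrite -[X in _ --> X](mulr0 K); apply: cvgM; first exact: cvg_cst.
    exact: cvg_sum_tail.
- have [_ c1] := tsc N (fun n => leqnn _).
  have z0' n : \int[P]_w truncated_sum (N n) n w = 0.
    have [_ h _] := tsd n 0%N (N n) (leq0n _).
    rewrite -[RHS]h; apply: eq_Rintegral => w _.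
    rewrite [X in _ = _ - X](_ : _ = 0) ?subr0//.
    by rewrite truncated_sumE big_ord0.
  apply/eqP; rewrite -normr_le0.
  apply: (@ler_cvg_to _ _ _ _ (fun=> `|\int[P]_w energy_martingale w|) _ _ _
    _ c1); first exact: cvg_cst.
  near=> n.
  have -> : `|\int[P]_w energy_martingale w| =
      `|\int[P]_w (truncated_sum (N n) n w - energy_martingale w)|.
    by rewrite (RintB mT)// z0' sub0r normrN.
  by apply: le_normr_Rintegral => //; exact: itgB.
- by move=> w; rewrite /energy_martingale; field.
Unshelve. all: by end_near. Qed.

End Linear_system.

(** * Legendre polynomials on an interval *)

Lemma derivn_comp_lin (R : comNzRingType) (p q : {poly R}) (c : R) n :
  q^`() = c%:P -> (p \Po q)^`(n) = c ^+ n *: (p^`(n) \Po q).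
Proof.
move=> qc; elim: n => [|n IH]; first by rewrite !derivn0 expr0 scale1r.
rewrite derivnS IH derivZ deriv_comp qc -mulrC mul_polyC scalerA -exprSr.
by rewrite derivnS.
Qed.

Lemma size_derivn_char0 (R : numDomainType) (p : {poly R}) n :
  size (p^`(n)) = (size p - n)%N.
Proof.
have s1 (q : {poly R}) : size q^`() = (size q).-1.
  have [->|q0] := eqVneq q 0; first by rewrite deriv0 size_poly0.
  have [s1|s1] := leqP (size q) 1.
    by rewrite [q]size1_polyC// derivC size_poly0 size_polyC; case: eqP.
  rewrite size_poly_eq//; have -> : (size q).-1.-1.+1 = (size q).-1 by lia.
  by rewrite -lead_coefE mulrn_eq0 lead_coef_eq0 (negbTE q0) orbF; lia.
by elim: n => [|n IH]; rewrite ?subn0// derivnS s1 IH; lia.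
Qed.

Section Polynomials_on_interval.
Context {R : realType}.
Variables a b : R.
Hypothesis ab : a < b.
Notation leb := (@lebesgue_measure R).
Implicit Types p q r : {poly R}.

Definition pint p : R := \int[leb]_(x in `]a, b[) p.[x].

Let mI : measurable (`]a, b[%classic : set (measurableTypeR R)) :=
  measurable_itv _.

Lemma lebesgue_itvoo : leb `]a, b[%classic = (b - a)%:E.
Proof.
by etransitivity; [exact: lebesgue_measure_itv|rewrite /= lte_fin ab].
Qed.

Lemma itg_poly p : itg leb `]a, b[ (horner p).
Proof.
have := itg_continuous a b (@continuous_horner R p).
by apply: integrableS => //; exact: subset_itv_oo_cc.
Qed.

Lemma pintD p q : pint (p + q) = pint p + pint q.
Proof.
rewrite /pint; under eq_Rintegral do rewrite hornerD.
by rewrite (@RintD _ _ R leb _ mI)//; exact: itg_poly.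
Qed.

Lemma pintZ c p : pint (c *: p) = c * pint p.
Proof.
rewrite /pint; under eq_Rintegral do rewrite hornerZ.
by rewrite (@RintZ _ _ R leb _ mI)//; exact: itg_poly.
Qed.

Lemma pint0 : pint 0 = 0.
Proof. by rewrite -(scale0r (0 : {poly R})) pintZ mul0r. Qed.

Lemma pint_sum (I : Type) (s : seq I) (P : pred I) (f : I -> {poly R}) :
  pint (\sum_(i <- s | P i) f i) = \sum_(i <- s | P i) pint (f i).
Proof. exact: (big_morph pint pintD pint0). Qed.

Lemma pint_deriv p : pint p^`() = p.[b] - p.[a].
Proof.
rewrite /pint Rintegral_itv_obnd_cbnd; last exact: itg_poly.
rewrite Rintegral_itv_bndo_bndc; last first.
  have := itg_continuous a b (@continuous_horner R p^`()).
  by apply: integrableS => //; exact: subset_itv_co_cc.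
rewrite /Rintegral (continuous_FTC2 (F := horner p)) ?EFinN//.
- by apply: continuous_subspaceT; exact: continuous_horner.
- split.
  + by move=> x _; exact: derivable_horner.
  + by apply: cvg_at_right_filter; exact: continuous_horner.
  + by apply: cvg_at_left_filter; exact: continuous_horner.
- by move=> x _; rewrite derivE.
Qed.

Lemma pint_by_parts p q :
  pint (p^`() * q) = (p * q).[b] - (p * q).[a] - pint (p * q^`()).
Proof. by rewrite -pint_deriv derivM pintD addrK. Qed.

(** A polynomial vanishing almost everywhere on the interval has infinitely many
    roots. *)
Lemma pint_sqr_gt0 p : p != 0 -> 0 < pint (p ^+ 2).
Proof.
move=> p0; rewrite lt_neqAle; apply/andP; split; last first.
  by apply: Rintegral_ge0 => x _; rewrite horner_exp sqr_ge0.
apply/eqP => /esym h.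
have ip := itg_poly (p ^+ 2).
have : (\int[leb]_(x in `]a, b[) `|((p ^+ 2).[x])%:E| = 0)%E.
  under eq_integral => x _ do rewrite gee0_abs ?lee_fin ?horner_exp ?sqr_ge0//.
  have := @EFin_Rintegral _ _ R leb _ mI _ ip.
  by rewrite -/(pint _) h; under eq_integral do rewrite horner_exp.
move=> /(ae_eq_integral_abs leb mI (measurable_int leb ip)).
move=> [N [mN N0 sN]].
have fr : finite_set [set x | root p x].
  apply: contrapT => /(infinite_set_fset (size p))[C Cp Cs].
  have := max_poly_roots p0 _ (finmap.fset_uniq C); rewrite ltnNge Cs => /(_ _)/negP.
  by apply => //; apply/allP => x xC; exact: Cp.
have sub : `]a, b[ `<=` N `|` [set x | root p x].
  move=> x xab; have [px|px] := boolP (root p x); [by right|left].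
  apply: sN => /(_ xab)[]; rewrite horner_exp => /eqP.
  by rewrite sqrf_eq0 => px0; move: px; rewrite /root px0.
have r0 : leb [set x | root p x] = 0%E.
  by apply: countable_lebesgue_measure0; exact: finite_set_countable.
have mr : measurable ([set x | root p x] : set (measurableTypeR R)).
  apply: countable_measurable; last exact: finite_set_countable.
  by move=> x; exact: measurable_set1.
have := le_measure leb; rewrite /= => /(_ `]a, b[%classic (N `|` [set x | root p x])).
rewrite !inE => /(_ mI (measurableU _ _ mN mr) sub).
rewrite lebesgue_itvoo leNgt => /negP; apply.
apply: (@le_lt_trans _ _ (leb N + leb [set x | root p x])%E).
  exact: measureU2.
by rewrite N0 r0 add0e lte_fin subr_gt0.
Qed.

Notation Q := (('X - a%:P) * ('X - b%:P)).

(** A derivation lowers the multiplicity of a factor by one at most. *)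
Lemma dvdp_derivn_exp n j : (j <= n)%N -> Q ^+ (n - j) %| (Q ^+ n)^`(j).
Proof.
elim: j => [|j IH] jn; first by rewrite subn0 derivn0.
have /dvdpP[r] := IH (ltnW jn); rewrite derivnS => ->.
have -> : (n - j)%N = (n - j.+1).+1 by lia.
rewrite derivM deriv_exp/=; apply: dvdp_add.
  by rewrite exprS mulrA dvdp_mull.
by rewrite mulrnAr mulrA -mulrnAl dvdp_mull.
Qed.

(** Rodrigues' formula makes the polynomial an n-th derivative of one that
    vanishes to order n at both ends, so n integrations by parts move all the
    derivatives onto a factor of smaller degree. *)
Lemma pint_rodrigues n q : (size q <= n)%N -> pint ((Q ^+ n)^`(n) * q) = 0.
Proof.
move=> qn.
have van j : (j < n)%N -> (Q ^+ n)^`(j).[a] = 0 /\ (Q ^+ n)^`(j).[b] = 0.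
  move=> jn; have /dvdpP[r ->] := dvdp_derivn_exp (ltnW jn).
  have -> : (n - j)%N = (n - j.+1).+1 by lia.
  by rewrite exprS !hornerM !hornerXsubC !subrr !(mul0r, mulr0).
have step j : (j <= n)%N ->
    pint ((Q ^+ n)^`(n) * q) = (-1) ^+ j * pint ((Q ^+ n)^`(n - j) * q^`(j)).
  elim: j => [|j IH] jn; first by rewrite subn0 derivn0 expr0 mul1r.
  rewrite (IH (ltnW jn)).
  have -> : (n - j)%N = (n - j.+1).+1 by lia.
  rewrite [in LHS]derivnS pint_by_parts !hornerM.
  have [|-> ->] := van (n - j.+1)%N; first by lia.
  by rewrite !mul0r subrr sub0r exprS -derivnS mulrN mulN1r mulNr.
by rewrite (step n (leqnn n)) (derivn_poly0 qn) mulr0 pint0 mulr0.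
Qed.

Let aff : {poly R} := (2 / (b - a)) *: 'X - ((a + b) / (b - a))%:P.

Let ba0 : b - a != 0. Proof. by rewrite subr_eq0 gt_eqF. Qed.

Definition legp n : {poly R} := legendre R n \Po aff.

Lemma legendre_onE n x : legendre_on a b n x = (legp n).[x].
Proof.
rewrite /legendre_on /legp horner_comp; congr (_.[_]).
by rewrite /aff !hornerE; field.
Qed.

(** The affine map of the interval onto [-1, 1] pulls [X^2 - 1] back to a
    multiple of [Q]. *)
Lemma legp_rodrigues n : exists2 c, c != 0 & legp n = c *: (Q ^+ n)^`(n).
Proof.
have affd : aff^`() = (2 / (b - a))%:P.
  by rewrite /aff derivB derivZ derivX derivC subr0 alg_polyC.
have affQ : ('X^2 - 1) \Po aff = (4 / (b - a) ^+ 2) *: Q.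
  have e1 : aff - 1 = (2 / (b - a)) *: ('X - b%:P).
    rewrite scalerBr /aff -addrA -opprD -polyC1 -polyCD -[X in _ = _ - X]mul_polyC.
    by rewrite -polyCM; congr (_ - _%:P); field.
  have e2 : aff + 1 = (2 / (b - a)) *: ('X - a%:P).
    rewrite scalerBr /aff -addrA; congr (_ + _); apply: oppr_inj.
    rewrite opprD !opprK -polyC1 -polyCB -mul_polyC -polyCM.
    by congr _%:P; field.
  rewrite rmorphB/= rmorphXn/= comp_polyX rmorph1 subr_sqr_1 e1 e2.
  rewrite -scalerAl -scalerAr scalerA mulrC; congr (_ *: _); last by rewrite mulrC.
  by field.
have e : (('X^2 - 1) ^+ n \Po aff) = (4 / (b - a) ^+ 2) ^+ n *: Q ^+ n.
  by rewrite rmorphXn/= affQ exprZn.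
have c0 : (2 / (b - a)) ^+ n != 0 by rewrite expf_neq0// mulf_neq0// invr_eq0.
exists ((2 ^+ n * n`!%:R)^-1 * (((2 / (b - a)) ^+ n)^-1 * (4 / (b - a) ^+ 2) ^+ n)).
  have c4 : (4 / (b - a) ^+ 2) ^+ n != 0.
    by rewrite expf_neq0// mulf_neq0// invr_eq0 expf_neq0.
  have f0 : (2 ^+ n * n`!%:R : R) != 0.
    by rewrite mulf_neq0 ?expf_neq0// pnatr_eq0 -lt0n fact_gt0.
  by rewrite mulf_neq0 ?invr_eq0// mulf_neq0 ?invr_eq0.
rewrite /legp /legendre comp_polyZ -scalerA; congr (_ *: _).
have := derivn_comp_lin (('X^2 - 1) ^+ n) n affd.
rewrite e derivnZ => /(congr1 (fun p => ((2 / (b - a)) ^+ n)^-1 *: p)).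
by rewrite !scalerA mulVf// scale1r => <-.
Qed.

Lemma size_legp n : size (legp n) = n.+1.
Proof.
have [c c0 ->] := legp_rodrigues n.
rewrite size_scale// size_derivn_char0 exprMn.
rewrite size_monicM ?monic_exp ?monicXsubC ?expf_neq0 ?polyXsubC_eq0//.
by rewrite !size_exp_XsubC; lia.
Qed.

Lemma pint_legp_lower n q : (size q <= n)%N -> pint (legp n * q) = 0.
Proof.
move=> qn; have [c _ ->] := legp_rodrigues n.
by rewrite -scalerAl pintZ pint_rodrigues// mulr0.
Qed.

Lemma legp_neq0 n : legp n != 0.
Proof. by rewrite -size_poly_eq0 size_legp. Qed.

Definition legn n : {poly R} := (Num.sqrt (pint (legp n ^+ 2)))^-1 *: legp n.

Lemma legnE n : legp n = Num.sqrt (pint (legp n ^+ 2)) *: legn n.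
Proof.
by rewrite scalerA mulfV ?scale1r// sqrtr_eq0 -ltNge pint_sqr_gt0// legp_neq0.
Qed.

Lemma size_legn n : size (legn n) = n.+1.
Proof.
rewrite size_scale ?size_legp// invr_eq0 sqrtr_eq0 -ltNge.
by rewrite pint_sqr_gt0// legp_neq0.
Qed.

Lemma legn_orthonormal m n : pint (legn m * legn n) = (m == n)%:R.
Proof.
have lt i j : (i < j)%N -> pint (legn i * legn j) = 0.
  move=> ij; rewrite -scalerAl pintZ -scalerAr pintZ.
  have -> : pint (legp i * legp j) = 0.
    by rewrite mulrC pint_legp_lower// size_legp.
  by rewrite !mulr0.
have [mn|nm|->] := ltngtP m n; first exact: lt.
  by rewrite mulrC; exact: lt.
have p0 := pint_sqr_gt0 (legp_neq0 n).
rewrite -scalerAl pintZ -scalerAr pintZ mulrA -invfM -expr2.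
by rewrite sqr_sqrtr ?ltW// -expr2 mulVf// gt_eqF.
Qed.

Lemma legn_span n p : (size p <= n)%N -> exists c : nat -> R,
  p = \sum_(m < n) c m *: legn m.
Proof.
elim: n p => [|n IH] p pn.
  exists (fun=> 0); rewrite big_ord0; apply/eqP.
  by rewrite -size_poly_leq0.
pose r := p - (p`_n / (legn n)`_n) *: legn n.
have l0 : (legn n)`_n != 0.
  have := lead_coef_eq0 (legn n); rewrite lead_coefE size_legn/= => ->.
  by rewrite -size_poly_eq0 size_legn.
have rn : (size r <= n)%N.
  apply/leq_sizeP => j nj; rewrite coefB coefZ.
  move: nj; rewrite leq_eqVlt => /predU1P[<-|nj]; first by rewrite divfK// subrr.
  have -> : p`_j = 0 by rewrite nth_default// (leq_trans pn nj).
  have -> : (legn n)`_j = 0 by rewrite nth_default// size_legn.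
  by rewrite mulr0 subrr.
have [c rE] := IH r rn.
exists (fun m => if m == n then p`_n / (legn n)`_n else c m).
rewrite big_ord_recr/= eqxx.
rewrite (eq_bigr (fun m : 'I_n => c m *: legn m)); last first.
  by move=> m _; rewrite ltn_eqF.
by rewrite -rE /r subrK.
Qed.

Lemma legn_expand n p : (size p <= n)%N ->
  p = \sum_(m < n) pint (p * legn m) *: legn m.
Proof.
move=> /legn_span[c pE]; rewrite [LHS]pE; apply: eq_bigr => m _.
congr (_ *: _); rewrite pE mulr_suml pint_sum (bigD1 m)//= big1.
  by rewrite addr0 -scalerAl pintZ legn_orthonormal eqxx mulr1.
move=> j jm; rewrite -scalerAl pintZ legn_orthonormal.
by rewrite (inj_eq val_inj) (negbTE jm) mulr0.
Qed.

(** Interpolation nodes in the open interval, where the values of a discrete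
    solution are continuous in time and adapted. *)
Definition sample (i : nat) : R := a + (b - a) / i.+2%:R.

Lemma sample_itv i : `]a, b[%classic (sample i).
Proof.
have ba : 0 < b - a by rewrite subr_gt0.
rewrite /= in_itv/= /sample ltrDl divr_gt0//=.
rewrite -ltrBrDl ltr_pdivrMr// ltr_pMr// ltr1n//.
Qed.

Lemma sample_inj : injective sample.
Proof.
by move=> i j /addrI /(mulfI ba0) /invr_inj /eqP; rewrite eqr_nat => /eqP[].
Qed.

(** The weights are the integrals of the Lagrange polynomials against [g]. *)
Lemma quadrature n (g : {poly R}) : exists om : 'I_n.+1 -> R,
  forall p, (size p <= n.+1)%N ->
    pint (p * g) = \sum_i om i * p.[sample i].
Proof.
exists (fun i =>
  pint ((tnth (qpoly.lagrange n.+1 sample) i : {poly R}) * g)) => p pn.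
rewrite [in LHS](qpoly.lagrange_gen (ltn0Sn n) sample_inj pn).
rewrite mulr_suml pint_sum; apply: eq_bigr => i _.
by rewrite mul_polyC -scalerAl pintZ mulrC.
Qed.

End Polynomials_on_interval.

(** * The flux form on a one-dimensional periodic mesh *)

Section Mesh_1D.
Context {R : realType}.
Variables (lo hi : R) (s : seq R).
Hypothesis lohi : lo < hi.
Hypothesis sP : itv_partition lo hi s.
Notation leb := (@lebesgue_measure R).
Notation N := (size s).
Notation x_ i := (node lo s i).
Implicit Types (u v : nat -> {poly R}) (f g : R -> R) (i j : nat).

Lemma size_mesh_gt0 : (0 < N)%N.
Proof.
case: s sP => //= /itv_partition_nil h; by move: lohi; rewrite h ltxx.
Qed.

Lemma node0 : x_ 0 = lo. Proof. by []. Qed.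

Lemma node_size : x_ N = hi.
Proof. exact: itv_partition_nth_size. Qed.

Lemma node_lt i : (i < N)%N -> x_ i < x_ i.+1.
Proof. by case: sP => /(pathP lo) h _ iN; exact: h. Qed.

Lemma node_homo i j : (i <= j)%N -> (j <= N)%N -> x_ i <= x_ j.
Proof.
elim: j => [|j IH]; first by rewrite leqn0 => /eqP->.
rewrite leq_eqVlt => /predU1P[->//|ij] jN.
by rewrite (le_trans (IH ij (ltnW jN)))// ltW// node_lt.
Qed.

Lemma cell_sub_open i : (i < N)%N -> cell lo s i `<=` `]lo, hi[.
Proof.
move=> iN x; rewrite /cell/= !in_itv/= => /andP[h1 h2]; apply/andP; split.
  by apply: le_lt_trans h1; rewrite -node0 node_homo// ltnW.
by apply: (lt_le_trans h2); rewrite -node_size node_homo.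
Qed.

Lemma cell_sub i : (i < N)%N -> cell lo s i `<=` `[lo, hi].
Proof.
by move=> iN; apply: subset_trans (cell_sub_open iN) _; exact: subset_itv_oo_cc.
Qed.

Lemma sum_indic_cell x : x \in `[lo, hi] -> (forall i, (i <= N)%N -> x != x_ i) ->
  \sum_(i < N) \1_(cell lo s i) x = 1 :> R.
Proof.
rewrite in_itv/= => /andP[lx xh] xn.
rewrite -(sum_step_indic1 (tau := fun i => x_ i) (n := N)
  (fun i h => ltW (node_lt h)) (s := x)).
- apply: eq_bigr => i _; rewrite !indicE; congr (nat_of_bool _)%:R.
  apply/idP/idP; rewrite !inE /cell/= !in_itv/= => /andP[-> h] //=.
    exact: ltW.
  by rewrite lt_neqAle h andbT xn.
- by rewrite lt_neqAle node0 lx andbT eq_sym -node0 xn.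
- by rewrite node_size.
Qed.

Lemma nodes_null : leb [set x | exists2 i, (i <= N)%N & x = x_ i] = 0%E /\
  measurable ([set x | exists2 i, (i <= N)%N & x = x_ i] : set (measurableTypeR R)).
Proof.
have e : [set x | exists2 i, (i <= N)%N & x = x_ i] =
    (fun i => x_ i) @` `I_N.+1.
  by apply/seteqP; split => [x [i iN ->]|x [i iN <-]]; exists i.
have c : countable [set x : R | exists2 i, (i <= N)%N & x = x_ i].
  rewrite e; apply: finite_set_countable; exact: finite_image.
split; first exact: countable_lebesgue_measure0.
by apply: countable_measurable => // x; exact: measurable_set1.
Qed.

(** Periodicity: the cell to the right of the last node is the first cell, and
    the cell to the left of the first node is the last one. *)
Definition next i : nat := if i == N then 0%N else i.
Definition prev i : nat := if i == 0%N then N.-1 else i.-1.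

Definition tracer u i : R := (u (next i)).[x_ (next i)].
Definition tracel u i : R := (u (prev i)).[x_ (prev i).+1].

Definition pflux a u i : R :=
  (tracer u i + tracel u i) / 2 + a * (tracer u i - tracel u i).

(** The flux form when the first argument is the polynomial [u j] on each cell
    [j]: traces become values of polynomials. *)
Definition pform i u (q : {poly R}) a : R :=
  pint (x_ i) (x_ i.+1) (u i * q^`()) -
  pflux a u i.+1 * q.[x_ i.+1] + pflux a u i * q.[x_ i].

Definition piecewise f u := forall i x, (i < N)%N -> cell lo s i x -> f x = (u i).[x].

Lemma next_lt i : (i <= N)%N -> (next i < N)%N.
Proof.
rewrite /next leq_eqVlt => /predU1P[->|iN]; first by rewrite eqxx size_mesh_gt0.
by rewrite (ltn_eqF iN).
Qed.

Lemma prev_lt i : (i <= N)%N -> (prev i < N)%N.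
Proof.
move=> iN; rewrite /prev; case: eqP => [_|/eqP i0].
  by have := size_mesh_gt0; lia.
by lia.
Qed.

Lemma trace_right_poly f u i : piecewise f u -> (i <= N)%N ->
  trace_right lo s f i = tracer u i.
Proof.
move=> fu iN; rewrite /trace_right -/(next i); apply: cvg_lim => //.
have nN := next_lt iN; have xx := node_lt nN.
have h : (u (next i)).[x] @[x --> (x_ (next i))^'+] --> tracer u i.
  by apply: cvg_at_right_filter; exact: continuous_horner.
apply: cvg_trans h; apply: near_eq_cvg; near=> x; apply/esym.
apply: fu => //; rewrite /cell/= in_itv/=; apply/andP; split.
  by near: x; exact: nbhs_right_gt.
by near: x; exact: nbhs_right_lt.
Unshelve. all: by end_near. Qed.

Lemma trace_left_poly f u i : piecewise f u -> (i <= N)%N ->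
  trace_left lo s f i = tracel u i.
Proof.
move=> fu iN; rewrite /trace_left.
have -> : (if i == 0%N then N else i) = (prev i).+1.
  rewrite /prev; case: eqP => [_|]; last by lia.
  by have := size_mesh_gt0; lia.
apply: cvg_lim => //.
have nN := prev_lt iN; have xx := node_lt nN.
have h : (u (prev i)).[x] @[x --> (x_ (prev i).+1)^'-] --> tracel u i.
  by apply: cvg_at_left_filter; exact: continuous_horner.
apply: cvg_trans h; apply: near_eq_cvg; near=> x; apply/esym.
apply: fu => //; rewrite /cell/= in_itv/=; apply/andP; split.
  by near: x; exact: nbhs_left_gt.
by near: x; exact: nbhs_left_lt.
Unshelve. all: by end_near. Qed.

Lemma dgform_poly f u q a i : piecewise f u -> (i < N)%N ->
  dgform lo s i f (horner q) a = pform i u q a.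
Proof.
move=> fu iN; rewrite /dgform /pform /flux.
have qq : piecewise (horner q) (fun=> q) by [].
rewrite !(trace_right_poly fu)// ?(ltnW iN)// !(trace_left_poly fu)// ?(ltnW iN)//.
have -> : trace_left lo s (horner q) i.+1 = q.[x_ i.+1].
  by rewrite (trace_left_poly qq).
have -> : trace_right lo s (horner q) i = q.[x_ i].
  by rewrite (trace_right_poly qq) ?(ltnW iN)// /tracer /next (ltn_eqF iN).
congr (_ - _ + _).
rewrite /pint; apply: eq_Rintegral => x; rewrite inE => xc.
by rewrite (fu i x iN xc) -derivE hornerM.
Qed.

Lemma pform_sum (I : finType) (c : I -> R) (w : I -> nat -> {poly R}) i q a :
  pform i (fun j => \sum_r c r *: w r j) q a = \sum_r c r * pform i (w r) q a.
Proof.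
have er j : tracer (fun j => \sum_r c r *: w r j) j = \sum_r c r * tracer (w r) j.
  by rewrite /tracer horner_sum; apply: eq_bigr => r _; rewrite hornerZ.
have el j : tracel (fun j => \sum_r c r *: w r j) j = \sum_r c r * tracel (w r) j.
  by rewrite /tracel horner_sum; apply: eq_bigr => r _; rewrite hornerZ.
have ef j : pflux a (fun j => \sum_r c r *: w r j) j = \sum_r c r * pflux a (w r) j.
  rewrite /pflux er el -big_split/= -sumrB mulr_suml mulr_sumr -big_split/=.
  by apply: eq_bigr => r _; field.
have ep : pint (x_ i) (x_ i.+1) ((\sum_r c r *: w r i) * q^`()) =
    \sum_r c r * pint (x_ i) (x_ i.+1) (w r i * q^`()).
  rewrite mulr_suml pint_sum; apply: eq_bigr => r _.
  by rewrite -scalerAl pintZ.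
rewrite /pform !ef ep !mulr_suml -sumrB -big_split/=.
by apply: eq_bigr => r _; ring.
Qed.

Lemma pformZ c i u q a : pform i u (c *: q) a = c * pform i u q a.
Proof.
by rewrite /pform derivZ -scalerAr pintZ !hornerZ; ring.
Qed.

(** Discrete integration by parts: the cell integrals add up to jumps at the
    nodes, which the numerical fluxes of opposite parameters cancel. *)
Lemma pform_antisym u v a :
  \sum_(i < N) (pform i u (v i) a + pform i v (u i) (- a)) = 0.
Proof.
(* The opposite parameters cancel in [Th i], so that right traces in place of
   left traces give the same value; this is what makes the sum over the cells
   telescope. *)
pose Th i := tracel u i * tracel v i - pflux a u i * tracel v i
  - pflux (- a) v i * tracel u i.
transitivity (\sum_(0 <= i < N) (Th i.+1 - Th i)).
  rewrite big_mkord; apply: eq_bigr => i _.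
  have xx := node_lt (ltn_ord i).
  have ni : next i = i by rewrite /next ltn_eqF.
  have -> : Th i.+1 - Th i = Th i.+1 + (- (tracer u i * tracer v i) +
      pflux a u i * tracer v i + pflux (- a) v i * tracer u i).
    by rewrite /Th /pflux; field.
  rewrite /pform (mulrC (v i)).
  have := pint_by_parts xx (u i) (v i); rewrite !hornerM.
  have tl w : tracel w i.+1 = (w i).[x_ i.+1] by [].
  have tr w : tracer w i = (w i).[x_ i] by rewrite /tracer ni.
  by rewrite /Th !tl !tr => ->; ring.
rewrite telescope_sumr//.
have nN : next N = next 0.
  by rewrite /next eqxx; case: eqP.
have pN : prev N = prev 0 by rewrite /prev eqxx; case: eqP => // ->.
by rewrite /Th /pflux /tracer /tracel nN pN subrr.
Qed.

Variable k : nat.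

Definition cellbasis i p : {poly R} := legn (x_ i) (x_ i.+1) p.

Definition single (y : 'I_N * 'I_k.+1) : nat -> {poly R} :=
  fun j => if j == y.1 then cellbasis y.1 y.2 else 0.

(** The matrix of the flux form in the normalized Legendre basis, whose
    elements are extended by 0 outside of their cells. *)
Definition stencil a (x y : 'I_N * 'I_k.+1) : R :=
  pform x.1 (single y) (cellbasis x.1 x.2) a.

Lemma stencil_antisym a x y : stencil a x y + stencil (- a) y x = 0.
Proof.
rewrite -[RHS](pform_antisym (single y) (single x) a) big_split/=.
have p0 i u b : pform i u 0 b = 0.
  by rewrite -(scale0r (0 : {poly R})) pformZ mul0r.
congr (_ + _).
  rewrite (bigD1 x.1)//= /single eqxx big1 ?addr0// => i ix.
  by rewrite (inj_eq val_inj) (negbTE ix) p0.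
rewrite (bigD1 y.1)//= /single eqxx big1 ?addr0// => i iy.
by rewrite (inj_eq val_inj) (negbTE iy) p0.
Qed.

Lemma dgform_cellbasis f (c : 'I_N * 'I_k.+1 -> R) a (x : 'I_N * 'I_k.+1) :
  piecewise f (fun j => \sum_y c y *: single y j) ->
  forall b, dgform lo s x.1 f (fun t => b * (cellbasis x.1 x.2).[t]) a =
  b * \sum_y c y * stencil a x y.
Proof.
move=> fc b; have -> : (fun t => b * (cellbasis x.1 x.2).[t]) =
    horner (b *: cellbasis x.1 x.2).
  by apply/funext => t; rewrite hornerZ.
by rewrite (dgform_poly _ _ fc)// pformZ// pform_sum.
Qed.

End Mesh_1D.

(** * Coordinates in the tensor Legendre basis *)

Section Integral_over_cells.
Context {d : measure_display} {T : measurableType d} {R : realType}.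
Variables (mu : {measure set T -> \bar R}) (D : set T).
Hypothesis mD : measurable D.

Lemma sqiS (C : set T) (f : T -> R) : measurable C -> C `<=` D ->
  sqi mu D f -> sqi mu C f.
Proof.
move=> mC CD [mf i2]; split; first exact: measurable_funS mf.
exact: integrableS i2.
Qed.

(** The cells cover [D] only up to their interfaces, which form the null set
    [N]. *)
Lemma Rintegral_cells (I : finType) (C : I -> set T) (N : set T) (f : T -> R) :
  (forall i, measurable (C i)) -> (forall i, C i `<=` D) ->
  measurable N -> mu N = 0%E ->
  (forall x, D x -> ~ N x -> \sum_i \1_(C i) x = 1 :> R) ->
  itg mu D f -> \int[mu]_(x in D) f x = \sum_i \int[mu]_(x in C i) f x.
Proof.
move=> mC CD mN N0 C1 fi.
have iC i : itg mu D (f \_ (C i)).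
  rewrite /itg -restrict_EFin; apply/integrable_restrict => //.
  by rewrite (setIidr (CD i)); exact: integrableS fi.
transitivity (\int[mu]_(x in D) (\sum_i (f \_ (C i)) x)).
  congr fine; apply: ae_eq_integral => //.
  - exact: measurable_int fi.
  - by apply: measurable_int; exact: itg_sum.
  exists N; split => // x /= h; apply: contrapT => Nx; apply: h => Dx.
  congr EFin; rewrite -[LHS]mulr1 -(C1 x Dx Nx) mulr_sumr.
  apply: eq_bigr => i _; rewrite patchE indicE.
  by case: ifP; rewrite ?mulr1 ?mulr0.
rewrite (Rintegral_sum mD)//; apply: eq_bigr => i _.
by rewrite -Rintegral_mkcondr (setIidr (CD i)).
Qed.

End Integral_over_cells.

Section Product_integrals.
Context {R : realType}.
Notation leb := (@lebesgue_measure R).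
Notation RR := (measurableTypeR R).
Implicit Types (X Y : set RR) (f g : R -> R).

Lemma restrict_tensor X Y f g (z : RR * RR) :
  ((fun z : RR * RR => f z.1 * g z.2) \_ (X `*` Y)) z =
  (f \_ X) z.1 * (g \_ Y) z.2.
Proof.
case: z => x y; rewrite !patchE/= in_setX/=.
by case: (x \in X); case: (y \in Y); rewrite /= ?mulr0 ?mul0r.
Qed.

Lemma itg_tensor X Y f g : measurable X -> measurable Y ->
  itg leb X f -> itg leb Y g ->
  itg leb2 (X `*` Y) (fun z => f z.1 * g z.2) /\
  int2 X Y (fun x y => f x * g y) =
    (\int[leb]_(x in X) f x) * (\int[leb]_(y in Y) g y).
Proof.
move=> mX mY fi gi; have mXY := measurableX mX mY.
have f'i : itg leb setT (f \_ X).
  by have := fi; rewrite /itg integrable_mkcond// restrict_EFin.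
have g'i : itg leb setT (g \_ Y).
  by have := gi; rewrite /itg integrable_mkcond// restrict_EFin.
set f' := f \_ X in f'i *; set g' := g \_ Y in g'i *.
pose h (z : RR * RR) := f' z.1 * g' z.2.
have mh : measurable_fun setT (EFin \o h).
  apply/measurable_EFinP; apply: measurable_funM.
    by apply: measurableT_comp => //; exact: itg_meas f'i.
  by apply: measurableT_comp => //; exact: itg_meas g'i.
have mT := @measurableT _ RR.
have hi : itg leb2 setT h.
  apply/(integrable12ltyP leb leb mh).
  rewrite [X in (X < _)%E](_ : _ =
    (\int[leb]_x (`|f' x| * \int[leb]_y `|g' y|)%:E)%E); last first.
    apply: eq_integral => x _; rewrite -(@RintZ _ _ R leb _ mT); last first.
      exact: itg_norm g'i.
    rewrite -(@EFin_Rintegral _ _ R leb _ mT); last first.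
      by apply: (@itgZ _ _ R leb _ mT); exact: itg_norm g'i.
    by apply: eq_integral => y _; rewrite /h/= normrM.
  have i1 : itg leb setT (fun x => `|f' x| * \int[leb]_y `|g' y|).
    have := @itgZ _ _ R leb _ mT (\int[leb]_y `|g' y|) _ (itg_norm f'i).
    by apply: (@itg_eq _ _ R leb _ mT) => x _; rewrite mulrC.
  by rewrite (@EFin_Rintegral _ _ R leb _ mT)// ltry.
have hE : (fun z : RR * RR => f z.1 * g z.2) \_ (X `*` Y) = h.
  by apply/funext => z; rewrite restrict_tensor.
split.
  have := hi; rewrite /itg -hE -restrict_EFin.
  by move=> ?; apply/integrable_mkcond.
rewrite /int2 Rintegral_mkcond hE.
have e1 : (\int[leb2]_z (h z)%:E = \int[leb]_x \int[leb]_y (h (x, y))%:E)%E.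
  by rewrite -(integral12_prod_meas1 hi).
rewrite /Rintegral e1.
have e2 : (\int[leb]_x \int[leb]_y (h (x, y))%:E =
    ((\int[leb]_(x in X) f x) * (\int[leb]_(y in Y) g y))%:E)%E.
  rewrite (Rintegral_mkcond leb X) (Rintegral_mkcond leb Y) -/f' -/g'.
  transitivity (\int[leb]_x (\int[leb]_y g' y * f' x)%:E)%E.
    apply: eq_integral => x _; rewrite mulrC -(@RintZ _ _ R leb _ mT)//.
    rewrite -(@EFin_Rintegral _ _ R leb _ mT)//.
    exact: (@itgZ _ _ R leb _ mT).
  rewrite (@EFin_Rintegral _ _ R leb _ mT); last exact: (@itgZ _ _ R leb _ mT).
  by rewrite (@RintZ _ _ R leb _ mT)// mulrC.
by rewrite e2.
Qed.

End Product_integrals.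

Section Ae_cells.
Context {d : measure_display} {T : measurableType d} {R : realType}.
Variables (mu : {measure set T -> \bar R}) (D : set T).
Hypothesis mD : measurable D.

Lemma itg_cells (I : finType) (C : I -> set T) (N : set T) (f : T -> R) :
  (forall i, measurable (C i)) -> (forall i, C i `<=` D) ->
  measurable N -> mu N = 0%E ->
  (forall x, D x -> ~ N x -> \sum_i \1_(C i) x = 1 :> R) ->
  measurable_fun D f -> (forall i, itg mu (C i) f) -> itg mu D f.
Proof.
move=> mC CD mN N0 C1 mf fi.
have iC i : itg mu D (f \_ (C i)).
  rewrite /itg -restrict_EFin; apply/integrable_restrict => //.
  by rewrite (setIidr (CD i)); exact: fi.
have := itg_norm (@itg_sum _ _ R mu D mD I (index_enum I) xpredT
  (fun i => f \_ (C i)) (fun i _ => iC i)).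
move=> /integrableP[_ fin]; apply/integrableP; split.
  exact/measurable_EFinP.
apply: le_lt_trans fin; rewrite le_eqVlt; apply/orP; left; apply/eqP.
apply: ae_eq_integral => //.
- by apply: measurableT_comp => //; exact/measurable_EFinP.
- apply: measurableT_comp => //; apply: measurable_int; apply: itg_norm.
  exact: itg_sum.
exists N; split => // x /= h; apply: contrapT => Nx; apply: h => Dx.
congr EFin; rewrite normr_id; congr (`| _ |).
rewrite -[LHS]mulr1 -(C1 x Dx Nx) mulr_sumr.
apply: eq_bigr => i _; rewrite patchE indicE.
by case: ifP; rewrite ?mulr1 ?mulr0.
Qed.

End Ae_cells.

Section Cell_coordinates.
Context {R : realType} {D : rectangle R}.
Variables (M : mesh D) (k : nat).
Notation RR := (measurableTypeR R).
Notation Ix := ('I_(Nx M) * 'I_k.+1)%type.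
Notation Iy := ('I_(Ny M) * 'I_k.+1)%type.
Implicit Types (v f g : R -> R -> R).

Let xlt i : (i < Nx M)%N ->
  node (xlo D) (xs M) i < node (xlo D) (xs M) i.+1.
Proof. by move=> h; exact: (node_lt (xs_partition M) h). Qed.

Let ylt j : (j < Ny M)%N ->
  node (ylo D) (ys M) j < node (ylo D) (ys M) j.+1.
Proof. by move=> h; exact: (node_lt (ys_partition M) h). Qed.

Definition xbasis : nat -> nat -> {poly R} := cellbasis (xlo D) (xs M).
Definition ybasis : nat -> nat -> {poly R} := cellbasis (ylo D) (ys M).

Definition psi (x : Ix) (y : Iy) (s t : R) : R :=
  (xbasis x.1 x.2).[s] * (ybasis y.1 y.2).[t].

Definition xsample (i a : nat) : R :=
  sample (node (xlo D) (xs M) i) (node (xlo D) (xs M) i.+1) a.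
Definition ysample (j b : nat) : R :=
  sample (node (ylo D) (ys M) j) (node (ylo D) (ys M) j.+1) b.

Definition cell_coord v (x : Ix) (y : Iy) : R :=
  int2 (xcell M x.1) (ycell M y.1) (fun s t => v s t * psi x y s t).

Lemma measurable_cells i j : measurable (xcell M i `*` ycell M j : set (RR * RR)).
Proof. by apply: measurableX; exact: measurable_itv. Qed.

Lemma cell_tensor i j (p q : {poly R}) :
  sqi leb2 (xcell M i `*` ycell M j) (fun z => p.[z.1] * q.[z.2]) /\
  int2 (xcell M i) (ycell M j) (fun s t => p.[s] * q.[t]) =
    pint (node (xlo D) (xs M) i) (node (xlo D) (xs M) i.+1) p *
    pint (node (ylo D) (ys M) j) (node (ylo D) (ys M) j.+1) q.
Proof.
have mX : measurable (xcell M i : set RR) by exact: measurable_itv.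
have mY : measurable (ycell M j : set RR) by exact: measurable_itv.
split; last first.
  by have [] := itg_tensor mX mY (itg_poly _ _ p) (itg_poly _ _ q).
split; first by have [/itg_meas] :=
  itg_tensor mX mY (itg_poly _ _ p) (itg_poly _ _ q).
have [h _] := itg_tensor mX mY (itg_poly _ _ (p ^+ 2)) (itg_poly _ _ (q ^+ 2)).
apply: (itg_eq (measurable_cells i j) _ h) => z _.
by rewrite !horner_exp exprMn.
Qed.

Let mC := measurable_cells.

Lemma sqi_psi (x : Ix) (y : Iy) i j :
  sqi leb2 (xcell M i `*` ycell M j) (fun z => psi x y z.1 z.2).
Proof. exact: (cell_tensor i j _ _).1. Qed.

Lemma psi_orthonormal (x x' : Ix) (y y' : Iy) : x.1 = x'.1 -> y.1 = y'.1 ->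
  int2 (xcell M x'.1) (ycell M y'.1) (fun s t => psi x y s t * psi x' y' s t) =
  ((x == x') && (y == y'))%:R.
Proof.
case: x x' y y' => [i p] [i' p'] [j q] [j' q'] /= ->->.
have -> : (fun s t => psi (i', p) (j', q) s t * psi (i', p') (j', q') s t) =
    (fun s t => (xbasis i' p * xbasis i' p').[s] * (ybasis j' q * ybasis j' q').[t]).
  by apply/funext => s; apply/funext => t; rewrite /psi/= !hornerM; ring.
rewrite (cell_tensor i' j' _ _).2 !legn_orthonormal ?xlt ?ylt//.
by rewrite !xpair_eqE !eqxx/= -natrM mulnb.
Qed.

Lemma coord_expansion v (i : 'I_(Nx M)) (j : 'I_(Ny M))
    (c : 'I_k.+1 -> 'I_k.+1 -> R) :
  (forall s t, xcell M i s -> ycell M j t ->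
    v s t = \sum_p \sum_q c p q * psi (i, p) (j, q) s t) ->
  forall p q, cell_coord v (i, p) (j, q) = c p q.
Proof.
move=> vc p q; have mij := mC i j.
have isqi p' q' : itg leb2 (xcell M i `*` ycell M j)
    (fun z => psi (i, p') (j, q') z.1 z.2 * psi (i, p) (j, q) z.1 z.2).
  exact: (sqiM_itg mij (sqi_psi (i, p') (j, q') i j) (sqi_psi (i, p) (j, q) i j)).
transitivity (\int[leb2]_(z in xcell M i `*` ycell M j) (\sum_p' \sum_q'
    c p' q' * (psi (i, p') (j, q') z.1 z.2 * psi (i, p) (j, q) z.1 z.2))).
  apply: eq_Rintegral => z; rewrite inE => -[zx zy].
  rewrite (vc _ _ zx zy) mulr_suml; apply: eq_bigr => p' _.
  by rewrite mulr_suml; apply: eq_bigr => q' _; rewrite mulrA.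
rewrite (Rintegral_sum mij); last first.
  by move=> p' _; apply: (itg_sum mij) => q' _; exact: (itgZ mij).
rewrite (bigD1 p)//= [X in _ + X]big1 ?addr0; last first.
  move=> p' pp'; rewrite (Rintegral_sum mij); last first.
    by move=> q' _; exact: (itgZ mij).
  rewrite big1// => q' _; rewrite (RintZ mij)//.
  have := psi_orthonormal (x := (i, p')) (x' := (i, p)) (y := (j, q'))
    (y' := (j, q)) erefl erefl.
  by rewrite /int2/= xpair_eqE eqxx/= (negbTE pp')/= => ->; rewrite mulr0.
rewrite (Rintegral_sum mij); last by move=> q' _; exact: (itgZ mij).
rewrite (bigD1 q)//= big1 ?addr0; last first.
  move=> q' qq'; rewrite (RintZ mij)//.
  have := psi_orthonormal (x := (i, p)) (x' := (i, p)) (y := (j, q'))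
    (y' := (j, q)) erefl erefl.
  by rewrite /int2/= !xpair_eqE !eqxx/= (negbTE qq')/= => ->; rewrite mulr0.
rewrite (RintZ mij)//.
have := psi_orthonormal (x := (i, p)) (x' := (i, p)) (y := (j, q))
  (y' := (j, q)) erefl erefl.
by rewrite /int2/= !eqxx/= => ->; rewrite mulr1.
Qed.

Lemma xbasis_monomial i (r : 'I_k.+1) s : (i < Nx M)%N ->
  s ^+ r = \sum_(p < k.+1) pint (node (xlo D) (xs M) i) (node (xlo D) (xs M) i.+1)
    ('X^r * xbasis i p) * (xbasis i p).[s].
Proof.
move=> iN; have sz : (size ('X^r : {poly R}) <= k.+1)%N by rewrite size_polyXn.
rewrite -[LHS]hornerXn [in LHS](legn_expand (xlt iN) sz) horner_sum.
by apply: eq_bigr => p _; rewrite hornerZ.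
Qed.

Lemma ybasis_monomial j (r : 'I_k.+1) t : (j < Ny M)%N ->
  t ^+ r = \sum_(q < k.+1) pint (node (ylo D) (ys M) j) (node (ylo D) (ys M) j.+1)
    ('X^r * ybasis j q) * (ybasis j q).[t].
Proof.
move=> jN; have sz : (size ('X^r : {poly R}) <= k.+1)%N by rewrite size_polyXn.
rewrite -[LHS]hornerXn [in LHS](legn_expand (ylt jN) sz) horner_sum.
by apply: eq_bigr => q _; rewrite hornerZ.
Qed.

(** Each monomial of degree at most [k] is a combination of the first [k + 1]
    Legendre polynomials, and hence each product of two is a combination of the
    [psi]. *)
Lemma dg_expand v (i : 'I_(Nx M)) (j : 'I_(Ny M)) : dg_space M k v ->
  forall s t, xcell M i s -> ycell M j t ->
  v s t = \sum_p \sum_q cell_coord v (i, p) (j, q) * psi (i, p) (j, q) s t.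
Proof.
move=> [_ /(_ i j)[c vc]].
pose al (r p : 'I_k.+1) := pint (node (xlo D) (xs M) i) (node (xlo D) (xs M) i.+1)
    ('X^r * xbasis i p).
pose be (r p : 'I_k.+1) := pint (node (ylo D) (ys M) j) (node (ylo D) (ys M) j.+1)
    ('X^r * ybasis j p).
pose e p q := \sum_r \sum_r' c r r' * al r p * be r' q.
have ve s t : xcell M i s -> ycell M j t ->
    v s t = \sum_p \sum_q e p q * psi (i, p) (j, q) s t.
  move=> si tj; rewrite (vc s t si tj).
  under eq_bigr do under eq_bigr do
    rewrite (xbasis_monomial _ _ (ltn_ord i)) (ybasis_monomial _ _ (ltn_ord j)).
  under [RHS]eq_bigr do under eq_bigr do rewrite mulr_suml.
  under [RHS]eq_bigr do rewrite exchange_big/=.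
  rewrite [RHS]exchange_big/=; apply: eq_bigr => r _.
  under [RHS]eq_bigr do under eq_bigr do rewrite mulr_suml.
  under [RHS]eq_bigr do rewrite exchange_big/=.
  rewrite [RHS]exchange_big/=; apply: eq_bigr => r' _.
  rewrite [X in X * _]mulr_sumr mulr_suml; apply: eq_bigr => p _.
  rewrite mulr_sumr; apply: eq_bigr => q _.
  by rewrite -/(al r p) -/(be r' q) /psi/=; ring.
move=> s t si tj; rewrite (ve s t si tj).
apply: eq_bigr => p _; apply: eq_bigr => q _.
by rewrite (coord_expansion ve).
Qed.

(** Coordinates are integrals, but the continuity and the adaptedness of a
    discrete process are known at points: coordinates are combinations of
    finitely many point values. *)
Lemma coord_quadrature (x : Ix) (y : Iy) : exists om : 'I_k.+1 -> 'I_k.+1 -> R,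
  forall v, dg_space M k v -> cell_coord v x y =
    \sum_a \sum_b om a b * v (xsample x.1 a) (ysample y.1 b).
Proof.
case: x y => [i p] [j q].
have [om omP] := quadrature (xlt (ltn_ord i)) k (xbasis i p).
have [om' omP'] := quadrature (ylt (ltn_ord j)) k (ybasis j q).
exists (fun a b => om a * om' b) => v dv.
have xs_in a : xcell M i (xsample i a) by exact: sample_itv (xlt (ltn_ord i)) a.
have ys_in b : ycell M j (ysample j b) by exact: sample_itv (ylt (ltn_ord j)) b.
have qx (p' : 'I_k.+1) : (p' == p)%:R = \sum_a om a * (xbasis i p').[xsample i a].
  rewrite -omP; last by rewrite /xbasis /cellbasis size_legn ?xlt.
  by rewrite legn_orthonormal ?xlt.
have qy (q' : 'I_k.+1) : (q' == q)%:R = \sum_b om' b * (ybasis j q').[ysample j b].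
  rewrite -omP'; last by rewrite /ybasis /cellbasis size_legn ?ylt.
  by rewrite legn_orthonormal ?ylt.
transitivity (\sum_p' \sum_q' cell_coord v (i, p') (j, q') *
    ((p' == p)%:R * (q' == q)%:R)).
  rewrite (bigD1 p)//= [X in _ + X]big1 ?addr0; last first.
    by move=> p' /negbTE h; rewrite big1// => q' _; rewrite h mul0r mulr0.
  rewrite (bigD1 q)//= big1 ?addr0; last first.
    by move=> q' /negbTE h; rewrite h !mulr0.
  by rewrite !eqxx !mulr1.
transitivity (\sum_a \sum_b om a * om' b * (\sum_p' \sum_q'
    cell_coord v (i, p') (j, q') * psi (i, p') (j, q') (xsample i a) (ysample j b))).
  under eq_bigr do under eq_bigr do rewrite qx qy.
  under [RHS]eq_bigr do under eq_bigr do rewrite mulr_sumr.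
  under [RHS]eq_bigr do rewrite exchange_big/=.
  rewrite [RHS]exchange_big/=; apply: eq_bigr => p' _.
  under [RHS]eq_bigr do under eq_bigr do rewrite mulr_sumr.
  under [RHS]eq_bigr do rewrite exchange_big/=.
  rewrite [RHS]exchange_big/=; apply: eq_bigr => q' _.
  rewrite mulr_suml mulr_sumr; apply: eq_bigr => a _.
  rewrite !mulr_sumr; apply: eq_bigr => b _.
  by rewrite /psi/=; ring.
apply: eq_bigr => a _; apply: eq_bigr => b _.
by rewrite /= -(dg_expand dv).
Qed.

Definition cells (c : 'I_(Nx M) * 'I_(Ny M)) : set (RR * RR) :=
  xcell M c.1 `*` ycell M c.2.

Lemma cells_domain c : cells c `<=` domain D.
Proof.
move=> z [zx zy]; split.
  exact: (cell_sub (xs_partition M) (ltn_ord c.1)).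
exact: (cell_sub (ys_partition M) (ltn_ord c.2)).
Qed.

Lemma measurable_domain : measurable (domain D : set (RR * RR)).
Proof. by apply: measurableX; exact: measurable_itv. Qed.

Let NX : set RR := [set s | exists2 i, (i <= size (xs M))%N & s = node (xlo D) (xs M) i].
Let NY : set RR := [set t | exists2 j, (j <= size (ys M))%N & t = node (ylo D) (ys M) j].

Definition interfaces : set (RR * RR) := (NX `*` setT) `|` (setT `*` NY).

Lemma interfaces_null : leb2 interfaces = 0%E /\ measurable interfaces.
Proof.
have [x0 mX] := nodes_null (xlo D) (xs M).
have [y0 mY] := nodes_null (ylo D) (ys M).
have m1 : measurable (NX `*` [set: RR]) by exact: measurableX.
have m2 : measurable ([set: RR] `*` NY) by exact: measurableX.
split; last exact: measurableU.
apply/eqP; rewrite eq_le measure_ge0 andbT.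
apply: le_trans (measureU2 _ m1 m2) _.
have z1 : leb2 (NX `*` [set: RR]) = 0%E.
  by rewrite /leb2 product_measure1E// [X in (X * _)%E]x0 mul0e.
have z2 : leb2 ([set: RR] `*` NY) = 0%E.
  by rewrite /leb2 product_measure1E// [X in (_ * X)%E]y0 mule0.
suff : (leb2 (NX `*` [set: RR]) + leb2 ([set: RR] `*` NY) <= 0)%E by [].
by rewrite z1 z2 adde0.
Qed.

Lemma sum_indic_cells z : domain D z -> ~ interfaces z ->
  \sum_c \1_(cells c) z = 1 :> R.
Proof.
case: z => s t [/= sD tD] h.
have hx i : (i <= size (xs M))%N -> s != node (xlo D) (xs M) i.
  by move=> iN; apply/eqP => e; apply: h; left; split => //; exists i.
have hy j : (j <= size (ys M))%N -> t != node (ylo D) (ys M) j.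
  by move=> jN; apply/eqP => e; apply: h; right; split => //; exists j.
have := sum_indic_cell (xs_partition M) sD hx.
have := sum_indic_cell (ys_partition M) tD hy.
rewrite -(pair_bigA _ (fun i j => \1_(cells (i, j)) (s, t)))/= => h1 h2.
rewrite -[RHS]h2; apply: eq_bigr => i _.
rewrite -[RHS]mulr1 -[X in _ = _ * X]h1 mulr_sumr; apply: eq_bigr => j _.
by rewrite !indicE /cells/= in_setX -natrM mulnb.
Qed.

Lemma int2_cells f : itg leb2 (domain D) (fun z => f z.1 z.2) ->
  int2 (xside D) (yside D) f =
  \sum_(i < Nx M) \sum_(j < Ny M) int2 (xcell M i) (ycell M j) f.
Proof.
move=> fi; have [N0 mN] := interfaces_null.
rewrite pair_bigA/=.
exact: (Rintegral_cells measurable_domain (C := cells) (fun c => mC c.1 c.2)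
  cells_domain mN N0 sum_indic_cells fi).
Qed.

Lemma sqi_cell i j f : (i < Nx M)%N -> (j < Ny M)%N ->
  sqi leb2 (domain D) (fun z => f z.1 z.2) ->
  sqi leb2 (xcell M i `*` ycell M j) (fun z => f z.1 z.2).
Proof.
move=> iN jN; apply: (sqiS measurable_domain (mC i j)).
exact: (cells_domain (c := (Ordinal iN, Ordinal jN))).
Qed.

Lemma dg_sqi v : dg_space M k v -> sqi leb2 (domain D) (fun z => v z.1 z.2).
Proof.
move=> dv; have [mv _] := dv; have [N0 mN] := interfaces_null.
split; first exact: mv.
apply: (itg_cells measurable_domain (C := cells) (fun c => mC c.1 c.2)
  cells_domain mN N0 sum_indic_cells); first exact: measurable_funX.
case=> i j.
have : sqi leb2 (cells (i, j)) (fun z => \sum_p \sum_q cell_coord v (i, p) (j, q) *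
    psi (i, p) (j, q) z.1 z.2).
  apply: (sqi_sum (mC i j)) => p _; apply: (sqi_sum (mC i j)) => q _.
  by apply: (sqiZ (mC i j)); exact: sqi_psi.
move=> [_]; apply: (itg_eq (mC i j)) => z; rewrite inE => -[zx zy].
by rewrite -(dg_expand dv zx zy).
Qed.

Lemma inner_expansion v f (i : 'I_(Nx M)) (j : 'I_(Ny M))
    (c : 'I_k.+1 -> 'I_k.+1 -> R) :
  (forall s t, xcell M i s -> ycell M j t ->
    v s t = \sum_p \sum_q c p q * psi (i, p) (j, q) s t) ->
  sqi leb2 (xcell M i `*` ycell M j) (fun z => f z.1 z.2) ->
  int2 (xcell M i) (ycell M j) (fun s t => v s t * f s t) =
  \sum_p \sum_q c p q * cell_coord f (i, p) (j, q).
Proof.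
move=> vc sf; have mij := mC i j.
have ipf p q : itg leb2 (xcell M i `*` ycell M j)
    (fun z => f z.1 z.2 * psi (i, p) (j, q) z.1 z.2).
  exact: (sqiM_itg mij sf (sqi_psi (i, p) (j, q) i j)).
transitivity (\int[leb2]_(z in xcell M i `*` ycell M j) (\sum_p \sum_q
    c p q * (f z.1 z.2 * psi (i, p) (j, q) z.1 z.2))).
  apply: eq_Rintegral => z; rewrite inE => -[zx zy].
  rewrite (vc _ _ zx zy) mulr_suml; apply: eq_bigr => p _.
  by rewrite mulr_suml; apply: eq_bigr => q _; ring.
rewrite (Rintegral_sum mij); last first.
  by move=> p _; apply: (itg_sum mij) => q _; exact: (itgZ mij).
apply: eq_bigr => p _; rewrite (Rintegral_sum mij); last first.
  by move=> q _; exact: (itgZ mij).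
by apply: eq_bigr => q _; rewrite (RintZ mij).
Qed.

Lemma bessel_cell f (i : 'I_(Nx M)) (j : 'I_(Ny M)) :
  sqi leb2 (xcell M i `*` ycell M j) (fun z => f z.1 z.2) ->
  \sum_p \sum_q cell_coord f (i, p) (j, q) ^+ 2 <=
    int2 (xcell M i) (ycell M j) (fun s t => f s t ^+ 2).
Proof.
move=> sf; have mij := mC i j.
pose c p q := cell_coord f (i, p) (j, q).
pose v s t := \sum_p \sum_q c p q * psi (i, p) (j, q) s t.
have vc s t : xcell M i s -> ycell M j t ->
    v s t = \sum_p \sum_q c p q * psi (i, p) (j, q) s t by [].
have sv : sqi leb2 (xcell M i `*` ycell M j) (fun z => v z.1 z.2).
  apply: (sqi_sum mij) => p _; apply: (sqi_sum mij) => q _.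
  by apply: (sqiZ mij); exact: sqi_psi.
have e1 := inner_expansion vc sf; have e2 := inner_expansion vc sv.
have : 0 <= \int[leb2]_(z in xcell M i `*` ycell M j)
    (f z.1 z.2 - v z.1 z.2) ^+ 2.
  by apply: Rintegral_ge0 => z _; exact: sqr_ge0.
have -> : \int[leb2]_(z in xcell M i `*` ycell M j)
    (f z.1 z.2 - v z.1 z.2) ^+ 2 = \int[leb2]_(z in xcell M i `*` ycell M j)
    (f z.1 z.2 ^+ 2 - 2 * (v z.1 z.2 * f z.1 z.2) + v z.1 z.2 * v z.1 z.2).
  by apply: eq_Rintegral => z _; ring.
have ivf := sqiM_itg mij sv sf; have ivv := sqiM_itg mij sv sv.
rewrite (RintD mij)//; last first.
  by apply: (itgB mij); [exact: sqi_itg2|exact: itgZ].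
rewrite (RintB mij); [|exact: sqi_itg2|exact: itgZ].
rewrite (RintZ mij)// -/(int2 _ _ (fun s t => v s t * f s t)) e1.
rewrite -/(int2 _ _ (fun s t => v s t * v s t)) e2.
have -> : \sum_p \sum_q c p q * cell_coord v (i, p) (j, q) =
    \sum_p \sum_q c p q * cell_coord f (i, p) (j, q).
  apply: eq_bigr => p _; apply: eq_bigr => q _.
  by rewrite (coord_expansion vc).
have -> : \sum_p \sum_q c p q * cell_coord f (i, p) (j, q) =
    \sum_p \sum_q cell_coord f (i, p) (j, q) ^+ 2.
  by apply: eq_bigr => p _; apply: eq_bigr => q _; rewrite expr2.
rewrite /int2; lra.
Qed.

Lemma sum_pairs (h : Ix -> Iy -> R) :
  \sum_i \sum_j \sum_p \sum_q h (i, p) (j, q) = \sum_x \sum_y h x y.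
Proof.
transitivity (\sum_(x : Ix) \sum_y h (x.1, x.2) y); last first.
  by apply: eq_bigr => -[].
rewrite -(pair_bigA _ (fun i p => \sum_y h (i, p) y))/=.
apply: eq_bigr => i _; rewrite exchange_big/=; apply: eq_bigr => p _.
by rewrite pair_bigA/=; apply: eq_bigr => -[].
Qed.

Lemma inner_coord v f : dg_space M k v ->
  sqi leb2 (domain D) (fun z => f z.1 z.2) ->
  inner D v f = \sum_x \sum_y cell_coord v x y * cell_coord f x y.
Proof.
move=> dv sf; rewrite /inner int2_cells; last first.
  exact: (sqiM_itg measurable_domain (dg_sqi dv) sf).
rewrite -sum_pairs; apply: eq_bigr => i _; apply: eq_bigr => j _.
by rewrite (inner_expansion (dg_expand dv))//; exact: sqi_cell.
Qed.

Lemma bessel f : sqi leb2 (domain D) (fun z => f z.1 z.2) ->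
  \sum_x \sum_y cell_coord f x y ^+ 2 <= inner D f f.
Proof.
move=> sf; rewrite /inner int2_cells; last first.
  exact: (sqiM_itg measurable_domain sf sf).
rewrite -sum_pairs; apply: ler_sum => i _; apply: ler_sum => j _.
apply: le_trans (bessel_cell _) _; first exact: sqi_cell.
by rewrite le_eqVlt; apply/orP; left; apply/eqP; apply: eq_Rintegral => z _;
  rewrite expr2.
Qed.

Lemma L2norm_coord v : dg_space M k v ->
  L2norm D v ^+ 2 = \sum_x \sum_y cell_coord v x y ^+ 2.
Proof.
move=> dv; rewrite /L2norm (inner_coord dv (dg_sqi dv)).
rewrite sqr_sqrtr; last first.
  by apply: sumr_ge0 => x _; apply: sumr_ge0 => y _; rewrite -expr2 sqr_ge0.
by apply: eq_bigr => x _; apply: eq_bigr => y _; rewrite expr2.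
Qed.

Lemma psi_dg x y : dg_space M k (psi x y).
Proof.
split.
  have h (p q : {poly R}) : measurable_fun setT (fun z : RR * RR => p.[z.1] * q.[z.2]).
    apply: measurable_funM.
      apply: (measurableT_comp (f := horner p)) => //.
      exact: (continuous_measurable_fun (@continuous_horner R p)).
    apply: (measurableT_comp (f := horner q)) => //.
    exact: (continuous_measurable_fun (@continuous_horner R q)).
  exact: measurable_funTS (h _ _).
move=> i j; exists (\matrix_(r, r') ((xbasis x.1 x.2)`_r * (ybasis y.1 y.2)`_r')).
move=> s t _ _; rewrite /psi.
have sx : (size (xbasis x.1 x.2) <= k.+1)%N.
  by rewrite /xbasis /cellbasis size_legn ?xlt.
have sy : (size (ybasis y.1 y.2) <= k.+1)%N.
  by rewrite /ybasis /cellbasis size_legn ?ylt.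
rewrite (horner_coef_wide s sx) (horner_coef_wide t sy) mulr_suml.
apply: eq_bigr => r _; rewrite mulr_sumr; apply: eq_bigr => r' _.
by rewrite mxE; ring.
Qed.

End Cell_coordinates.

(** * The discrete trace in coordinates *)

Lemma big_nat_prod (V : nmodType) (m n : nat) (f : nat -> V) :
  \sum_(0 <= l < m * n) f l = \sum_(p < m) \sum_(q < n) f (p * n + q)%N.
Proof.
elim: m => [|m IH]; first by rewrite mul0n big_geq// big_ord0.
rewrite mulSn addnC (big_cat_nat (leq0n _) (leq_addr _ _))/= IH big_ord_recr/=.
congr (_ + _); rewrite -{1}[(m * n)%N]add0n big_addn addKn big_mkord.
by apply: eq_bigr => q _; rewrite addnC.
Qed.

Section Covariance.
Context {R : realType} {D : rectangle R} {d : measure_display}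
  {Omega : measurableType d}.
Variables (P : probability Omega R) (F : R -> set (set Omega)).
Variables (Q : (R -> R -> R) -> R -> R -> R).
Variables (e : nat -> R -> R -> R) (gamma : nat -> R)
  (B : nat -> R -> Omega -> R).
Hypothesis hW : Q_wiener D P F Q e gamma B.
Notation RR := (measurableTypeR R).

Lemma basis_sqi m : sqi leb2 (domain D) (fun z : RR * RR => e m z.1 z.2).
Proof.
have [/(_ m)[me fe] _ _] := qw_basis hW.
by apply/(sqiP _ measurable_domain).
Qed.

Lemma basis_unit m : inner D (e m) (e m) = 1.
Proof. by have [_ -> _] := qw_basis hW; rewrite eqxx. Qed.

(** The eigenvalue is the value at [e m] of the quadratic form of [Q]. *)
Lemma gamma_ge0 m : 0 <= gamma m.
Proof.
have [eL _ _] := qw_basis hW.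
have := op_nonneg (qw_operator hW) (eL m).
suff -> : inner D (Q (e m)) (e m) = gamma m by [].
have [mQ _] := op_inL2 (qw_operator hW) (eL m).
have [me _] := eL m.
have ie := sqiM_itg measurable_domain (basis_sqi m) (basis_sqi m).
transitivity (\int[leb2]_(z in domain D) (gamma m * (e m z.1 z.2 * e m z.1 z.2))).
  congr fine; apply: ae_eq_integral.
  - exact: measurable_domain.
  - by apply/measurable_EFinP; exact: measurable_funM.
  - apply/measurable_EFinP; apply: measurable_funM => //.
    exact: measurable_funM.
  - have [N [mN N0 sN]] := qw_eigen hW m.
    exists N; split => // z h; apply: sN => h'; apply: h => zD.
    by rewrite h'// mulrA.
rewrite (RintZ measurable_domain)//.
by have := basis_unit m; rewrite /inner /int2 => ->; rewrite mulr1.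
Qed.

Variables (M : mesh D) (k : nat).
Notation Ix := ('I_(Nx M) * 'I_k.+1)%type.
Notation Iy := ('I_(Ny M) * 'I_k.+1)%type.

Lemma coord_basis_le1 m (x : Ix) (y : Iy) : cell_coord (e m) x y ^+ 2 <= 1.
Proof.
rewrite -(basis_unit m); apply: le_trans (bessel M k (basis_sqi m)).
rewrite (bigD1 x)//= (bigD1 y)//= -addrA lerDl addr_ge0//.
  by apply: sumr_ge0 => y' _; exact: sqr_ge0.
by apply: sumr_ge0 => x' _; apply: sumr_ge0 => y' _; exact: sqr_ge0.
Qed.

Lemma cvg_trace_term (x : Ix) (y : Iy) :
  cvgn (series (fun m => gamma m * cell_coord (e m) x y ^+ 2)).
Proof.
apply: (series_le_cvg (v_ := gamma)).
- by move=> m; rewrite mulr_ge0 ?gamma_ge0 ?sqr_ge0.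
- exact: gamma_ge0.
- by move=> m; rewrite ler_piMr ?gamma_ge0// coord_basis_le1.
- exact: qw_trace hW.
Qed.

Definition trace_term (x : Ix) (y : Iy) : R :=
  limn (series (fun m => gamma m * cell_coord (e m) x y ^+ 2)).

Lemma limn_seriesZ (c : R) (u : R ^nat) : cvgn (series u) ->
  limn (series (fun m => c * u m)) = c * limn (series u).
Proof.
move=> cu; have -> : series (fun m => c * u m) = (fun n => c * series u n).
  by apply/funext => n; rewrite /series/= mulr_sumr.
by apply: cvg_lim => //; apply: cvgM; [exact: cvg_cst|exact: cu].
Qed.

(** Normalizing the Legendre basis absorbs the coefficients [mu_coef]. *)
Lemma discrete_traceE :
  discrete_trace M k e gamma = \sum_x \sum_y trace_term x y.
Proof.
rewrite -sum_pairs /discrete_trace; apply: eq_bigr => i _; apply: eq_bigr => j _.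
have -> : ((k ^ 2 + 2 * k).+1 = k.+1 * k.+1)%N by lia.
rewrite big_nat_prod; apply: eq_bigr => p _; apply: eq_bigr => q _.
set l := (p * k.+1 + q)%N.
have lp : (l %/ k.+1 = p)%N by rewrite divnMDl// divn_small// addn0.
have lq : (l %% k.+1 = q)%N by rewrite modnMDl modn_small.
have xx : node (xlo D) (xs M) i < node (xlo D) (xs M) i.+1.
  exact: (node_lt (xs_partition M)).
have yy : node (ylo D) (ys M) j < node (ylo D) (ys M) j.+1.
  exact: (node_lt (ys_partition M)).
pose nx := pint (node (xlo D) (xs M) i) (node (xlo D) (xs M) i.+1)
  (legp (node (xlo D) (xs M) i) (node (xlo D) (xs M) i.+1) p ^+ 2).
pose ny := pint (node (ylo D) (ys M) j) (node (ylo D) (ys M) j.+1)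
  (legp (node (ylo D) (ys M) j) (node (ylo D) (ys M) j.+1) q ^+ 2).
have nx0 : 0 < nx by apply: pint_sqr_gt0 => //; exact: legp_neq0.
have ny0 : 0 < ny by apply: pint_sqr_gt0 => //; exact: legp_neq0.
have LE s t : legendre_basis M k i j l s t =
    Num.sqrt nx * Num.sqrt ny * psi (M := M) (i, p) (j, q) s t.
  rewrite /legendre_basis lp lq !legendre_onE// (legnE xx) (legnE yy).
  rewrite (hornerZ _ (legn _ _ p)) (hornerZ _ (legn _ _ q)) -/nx -/ny.
  by rewrite mulrACA.
have mij := measurable_cells M i j.
have mu : mu_coef M k i j l = (nx * ny)^-1.
  congr (_^-1).
  transitivity (\int[leb2]_(z in xcell M i `*` ycell M j)
    ((nx * ny) * (psi (M := M) (i, p) (j, q) z.1 z.2 *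
                  psi (M := M) (i, p) (j, q) z.1 z.2))).
    apply: eq_Rintegral => z _.
    by rewrite LE 2!exprMn (sqr_sqrtr (ltW nx0)) (sqr_sqrtr (ltW ny0)) expr2.
  rewrite (RintZ mij); last exact: (sqiM_itg mij (sqi_psi _ _ _ _) (sqi_psi _ _ _ _)).
  have := psi_orthonormal (M := M) (x := (i, p)) (x' := (i, p)) (y := (j, q))
    (y' := (j, q)) erefl erefl.
  by rewrite /int2/= !eqxx/= => ->; rewrite mulr1.
rewrite mu.
have -> : (fun m => int2 (xcell M i) (ycell M j) (fun s t =>
    legendre_basis M k i j l s t * (Num.sqrt (gamma m) * e m s t)) ^+ 2) =
    (fun m => (nx * ny) * (gamma m * cell_coord (e m) (i, p) (j, q) ^+ 2)).
  apply/funext => m.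
  have -> : int2 (xcell M i) (ycell M j) (fun s t =>
      legendre_basis M k i j l s t * (Num.sqrt (gamma m) * e m s t)) =
      Num.sqrt nx * Num.sqrt ny * Num.sqrt (gamma m) *
      cell_coord (e m) (i, p) (j, q).
    transitivity (\int[leb2]_(z in xcell M i `*` ycell M j)
      ((Num.sqrt nx * Num.sqrt ny * Num.sqrt (gamma m)) *
      (e m z.1 z.2 * psi (M := M) (i, p) (j, q) z.1 z.2))).
      by apply: eq_Rintegral => z _; rewrite LE; ring.
    rewrite (RintZ mij)//.
    apply: (sqiM_itg mij); last exact: sqi_psi.
    exact: (sqi_cell (ltn_ord i) (ltn_ord j) (basis_sqi m)).
  rewrite 3!exprMn (sqr_sqrtr (ltW nx0)) (sqr_sqrtr (ltW ny0)).
  by rewrite (sqr_sqrtr (gamma_ge0 m)) !mulrA.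
rewrite limn_seriesZ; last exact: cvg_trace_term.
by rewrite mulrA mulVf ?mul1r// mulf_neq0 ?gt_eqF.
Qed.

End Covariance.

(** * The scheme as an antisymmetric linear system *)

Lemma antisym_form0 (R : realFieldType) (I : finType) (A : I -> I -> R) :
  (forall q r, A q r + A r q = 0) ->
  forall x : I -> R, \sum_q x q * (\sum_r A q r * x r) = 0.
Proof.
move=> anti x; set S := \sum_q _.
have SE : S = \sum_q \sum_r x q * (A q r * x r).
  by apply: eq_bigr => q _; rewrite mulr_sumr.
suff : S + S = 0 by lra.
rewrite {2}SE exchange_big/= SE -big_split/= big1// => q _.
rewrite -big_split/= big1// => r _.
have -> : x q * (A q r * x r) + x r * (A r q * x q) = x q * x r * (A q r + A r q).
  by ring.
by rewrite anti mulr0.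
Qed.

Section Clamp.
Context {R : realType}.
Variable b : R.
Hypothesis b0 : 0 <= b.

(** Freezing a process outside of the interval from 0 to [b] makes its paths
    continuous on the whole line, and keeps it adapted. *)
Definition clamp (s : R) : R := Num.max 0 (Num.min s b).

Lemma clamp_itv s : clamp s \in `[0, b].
Proof.
by rewrite in_itv/= /clamp le_max lexx/= ge_max b0/= ge_min lexx orbT.
Qed.

Lemma clamp_id s : 0 <= s -> s <= b -> clamp s = s.
Proof. by move=> s0 sb; rewrite /clamp min_l// max_r. Qed.

Lemma clamp_le s : 0 <= s -> clamp s <= s.
Proof. by move=> s0; rewrite /clamp ge_max s0/= ge_min lexx. Qed.

Lemma continuous_clamp : continuous clamp.
Proof.
move=> s; apply: (@continuous_max _ _ (fun=> 0) (fun s => Num.min s b)).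
  exact: cvg_cst.
by apply: (@continuous_min _ _ id (fun=> b)); [exact: cvg_id|exact: cvg_cst].
Qed.

Lemma continuous_comp_clamp (f : R -> R) : {within `[0, b], continuous f} ->
  continuous (fun s => f (clamp s)).
Proof.
move=> /subspace_continuousP cf s V fV.
have : \forall y \near clamp s, `[0, b]%classic y -> V (f y).
  exact: (cf _ (clamp_itv s) V fV).
move=> /continuous_clamp h.
suff : \forall r \near s, V (f (clamp r)) by [].
by near=> r; move: (clamp_itv r); near: r.
Unshelve. all: by end_near. Qed.

End Clamp.

Section Drift_in_coordinates.
Context {R : realType} {D : rectangle R}.
Variables (M : mesh D) (k : nat).
Notation leb := (@lebesgue_measure R).
Notation Ix := ('I_(Nx M) * 'I_k.+1)%type.
Notation Iy := ('I_(Ny M) * 'I_k.+1)%type.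
Implicit Types (f : R -> R -> R) (x : Ix) (y : Iy).

Lemma sum_single (lo : R) (s : seq R)
    (c : 'I_(size s) * 'I_k.+1 -> R) (i : 'I_(size s)) u :
  (\sum_y c y *: single lo y i).[u] =
  \sum_p c (i, p) * (cellbasis lo s i p).[u].
Proof.
rewrite horner_sum.
transitivity (\sum_(y : 'I_(size s) * 'I_k.+1)
  (c (y.1, y.2) *: single lo (y.1, y.2) i).[u]); first by apply: eq_bigr => -[].
rewrite -(pair_bigA _ (fun i' p => (c (i', p) *: single lo (i', p) i).[u]))/=.
rewrite (bigD1 i)//= [X in _ + X]big1 ?addr0; last first.
  move=> i' ii'; rewrite big1// => p _.
  by rewrite /single/= (inj_eq val_inj) eq_sym (negbTE ii') scaler0 horner0.
by apply: eq_bigr => p _; rewrite /single/= eqxx hornerZ.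
Qed.

(** For a fixed value of the transverse variable the form acts through its
    matrix; the integral over that variable is diagonal by orthonormality. *)
Lemma Rintegral_formI f x y a : dg_space M k f ->
  \int[leb]_(t in ycell M y.1) formI M x.1 f (psi x y) a t =
  \sum_x' stencil (xlo D) a x x' * cell_coord f x' y.
Proof.
move=> df.
have xx := xlo_lt_xhi D; have yy := node_lt (ys_partition M) (ltn_ord y.1).
pose P : {poly R} := \sum_x' \sum_q (stencil (xlo D) a x x' *
  cell_coord f x' (y.1, q)) *: (ybasis M y.1 q * ybasis M y.1 y.2).
transitivity (pint (node (ylo D) (ys M) y.1) (node (ylo D) (ys M) y.1.+1) P).
  apply: eq_Rintegral => t; rewrite inE => ty.
  pose c (x' : Ix) := \sum_q cell_coord f x' (y.1, q) * (ybasis M y.1 q).[t].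
  have pw : piecewise (xlo D) (xs M) (fun s => f s t)
      (fun j => \sum_x' c x' *: single (xlo D) x' j).
    move=> i s iN si; rewrite (sum_single _ c (Ordinal iN)).
    rewrite (dg_expand (i := Ordinal iN) df si ty).
    apply: eq_bigr => p _; rewrite /c mulr_suml; apply: eq_bigr => q _.
    by rewrite /psi/= /xbasis; ring.
  have := dgform_cellbasis xx (xs_partition M) a x pw ((ybasis M y.1 y.2).[t]).
  rewrite /formI => h.
  have -> : (fun s => psi x y s t) =
      (fun s => (ybasis M y.1 y.2).[t] * (cellbasis (xlo D) (xs M) x.1 x.2).[s]).
    by apply/funext => s; rewrite /psi mulrC.
  rewrite h /P horner_sum mulr_sumr; apply: eq_bigr => x' _.
  rewrite horner_sum /c mulr_suml mulr_sumr; apply: eq_bigr => q _.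
  by rewrite [RHS]hornerZ [X in _ = _ * X]hornerM; ring.
rewrite /P pint_sum; apply: eq_bigr => x' _.
rewrite pint_sum (bigD1 y.2)//= big1 ?addr0; last first.
  move=> q qy; rewrite pintZ legn_orthonormal//.
  by rewrite (inj_eq val_inj) (negbTE qy) mulr0.
by rewrite pintZ legn_orthonormal// eqxx mulr1; case: (y).
Qed.

Lemma Rintegral_formJ f x y a : dg_space M k f ->
  \int[leb]_(s in xcell M x.1) formJ M y.1 f (psi x y) a s =
  \sum_y' stencil (ylo D) a y y' * cell_coord f x y'.
Proof.
move=> df.
have yy := ylo_lt_yhi D; have xx := node_lt (xs_partition M) (ltn_ord x.1).
pose P : {poly R} := \sum_y' \sum_p (stencil (ylo D) a y y' *
  cell_coord f (x.1, p) y') *: (xbasis M x.1 p * xbasis M x.1 x.2).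
transitivity (pint (node (xlo D) (xs M) x.1) (node (xlo D) (xs M) x.1.+1) P).
  apply: eq_Rintegral => s; rewrite inE => sx.
  pose c (y' : Iy) := \sum_p cell_coord f (x.1, p) y' * (xbasis M x.1 p).[s].
  have pw : piecewise (ylo D) (ys M) (f s)
      (fun j => \sum_y' c y' *: single (ylo D) y' j).
    move=> j t jN tj; rewrite (sum_single _ c (Ordinal jN)).
    rewrite (dg_expand (j := Ordinal jN) df sx tj) exchange_big/=.
    apply: eq_bigr => q _; rewrite /c mulr_suml; apply: eq_bigr => p _.
    by rewrite /psi/= /ybasis; ring.
  have := dgform_cellbasis yy (ys_partition M) a y pw ((xbasis M x.1 x.2).[s]).
  rewrite /formJ => h.
  rewrite h /P horner_sum mulr_sumr; apply: eq_bigr => y' _.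
  rewrite horner_sum /c mulr_suml mulr_sumr; apply: eq_bigr => p _.
  by rewrite [RHS]hornerZ [X in _ = _ * X]hornerM; ring.
rewrite /P pint_sum; apply: eq_bigr => y' _.
rewrite pint_sum (bigD1 x.2)//= big1 ?addr0; last first.
  move=> p px; rewrite pintZ legn_orthonormal//.
  by rewrite (inj_eq val_inj) (negbTE px) mulr0.
by rewrite pintZ legn_orthonormal// eqxx mulr1; case: (x).
Qed.

End Drift_in_coordinates.

Section Scheme_energy_law.
Context {R : realType} {D : rectangle R} {d : measure_display}
  {Omega : measurableType d}.
Variables (P : probability Omega R) (F : R -> set (set Omega)).
Variables (Q : (R -> R -> R) -> R -> R -> R).
Variables (e : nat -> R -> R -> R) (gamma : nat -> R)
  (B : nat -> R -> Omega -> R).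
Hypothesis hF : filtration F.
Hypothesis hW : Q_wiener D P F Q e gamma B.
Variables (M : mesh D) (k : nat) (tmax : R).
Notation leb := (@lebesgue_measure R).
Notation Ix := ('I_(Nx M) * 'I_k.+1)%type.
Notation Iy := ('I_(Ny M) * 'I_k.+1)%type.
Let mT := @measurableT _ Omega.
Let hB := qw_brownian hW.

Section Process.
Variables (U0 : R -> R -> R) (U : R -> Omega -> R -> R -> R).
Hypothesis hU : dg_process F M k tmax U0 U.
Hypothesis tm0 : 0 <= tmax.
Variables (x : Ix) (y : Iy).

Let xin a : xcell M x.1 (xsample M x.1 a).
Proof. exact: sample_itv (node_lt (xs_partition M) (ltn_ord x.1)) a. Qed.

Let yin a : ycell M y.1 (ysample M y.1 a).
Proof. exact: sample_itv (node_lt (ys_partition M) (ltn_ord y.1)) a. Qed.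

Lemma continuous_coord w : continuous (fun s => cell_coord (U (clamp tmax s) w) x y).
Proof.
have [om omE] := coord_quadrature x y.
have -> : (fun s => cell_coord (U (clamp tmax s) w) x y) = (fun s =>
    \sum_a \sum_b om a b * U (clamp tmax s) w (xsample M x.1 a) (ysample M y.1 b)).
  by apply/funext => s; rewrite omE//; apply: (dgp_space hU); exact: clamp_itv.
have h a b : continuous
    (fun s => U (clamp tmax s) w (xsample M x.1 a) (ysample M y.1 b)).
  apply: (continuous_comp_clamp tm0
    (f := fun s => U s w (xsample M x.1 a) (ysample M y.1 b))).
  exact: (dgp_continuous hU (xin a) (yin b)).
move=> s; apply: cvg_sumr => a; apply: cvg_sumr => b.
by apply: cvgM; [exact: cvg_cst|exact: h].
Qed.

Lemma adapted_coord s : 0 <= s ->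
  measurable_wrt (F s) (fun w => cell_coord (U (clamp tmax s) w) x y).
Proof.
move=> s0; have [om omE] := coord_quadrature x y.
have -> : (fun w => cell_coord (U (clamp tmax s) w) x y) = (fun w =>
    \sum_a \sum_b om a b * U (clamp tmax s) w (xsample M x.1 a) (ysample M y.1 b)).
  by apply/funext => w; rewrite omE//; apply: (dgp_space hU); exact: clamp_itv.
apply: (mwrt_sum hF) => // a _; apply: (mwrt_sum hF) => // b _.
apply: (mwrtM hF) => //; first exact: (mwrt_cst hF).
have ci := clamp_itv tm0 s; have := ci; rewrite in_itv/= => /andP[c0 _].
apply: (mwrt_mono hF c0 (clamp_le tmax s0)).
exact: (dgp_adapted hU ci (xin a) (yin b)).
Qed.

Lemma measurable_coord s :
  measurable_fun setT (fun w => cell_coord (U (clamp tmax s) w) x y).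
Proof.
have [s0|s0] := leP 0 s; first exact: (mwrt_meas hF s0 (adapted_coord s0)).
have -> : clamp tmax s = clamp tmax 0.
  by rewrite /clamp !min_l ?(le_trans (ltW s0))// !max_l// ltW.
exact: (mwrt_meas hF (lexx 0) (adapted_coord (lexx 0))).
Qed.

(** The integrands are constant in time, so their Ito integrals are multiples
    of the Brownian motions. *)
Lemma cell_equation_noise (dr : R -> Omega -> R) (c s : R) : 0 <= s -> s <= tmax ->
  cell_equation P F e gamma B M tmax x.1 y.1 U (psi x y) dr c ->
  exists N : Omega -> R, [/\ measurable_fun setT N,
    L2_cvg P (fun n w => \sum_(m < n) Num.sqrt (gamma m) *
      (c * cell_coord (e m) x y) * increment (B m) 0 s w) N &
    {ae P, forall w, cell_coord (U (clamp tmax s) w) x y =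
      cell_coord U0 x y + \int[leb]_(r in `[0, s]) dr r w + N w}].
Proof.
move=> s0 st /(_ s); rewrite in_itv/= s0 st => /(_ isT)[N [[mN [J [ito cJ]]] eqN]].
exists N; split => //; last first.
  apply: filterS eqN => w; rewrite (dgp_init hU) clamp_id//.
have mc := measurable_cells M x.1 y.1.
have ie m : itg leb2 (xcell M x.1 `*` ycell M y.1)
    (fun z => e m z.1 z.2 * psi x y z.1 z.2).
  apply: (sqiM_itg mc); last exact: sqi_psi.
  exact: (sqi_cell (ltn_ord _) (ltn_ord _) (basis_sqi hW m)).
have JE m : {ae P, forall w, J m w =
    c * cell_coord (e m) x y * increment (B m) 0 s w}.
  apply: (is_ito_cst hF hB s0).
  have := ito m; congr is_ito; apply/funext => r; apply/funext => w.
  transitivity (\int[leb2]_(z in xcell M x.1 `*` ycell M y.1)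
    (c * (e m z.1 z.2 * psi x y z.1 z.2))).
    by apply: eq_Rintegral => z _; ring.
  by rewrite (RintZ mc).
apply: cvg_trans cJ; apply: near_eq_cvg; apply: nearW => n.
have allm : {ae P, forall w, forall m : 'I_n, J m w =
    c * cell_coord (e m) x y * increment (B m) 0 s w}.
  by apply: filter_forall => m; exact: JE.
have mJ m : measurable_fun setT (J m) by have [] := ito m.
have mi m := inc_meas hF hB m (lexx 0) s0.
apply: ae_eq_integral => //.
- apply/measurable_EFinP; apply: measurable_funX; apply: measurable_funB => //.
  by apply: measurable_sum => m; exact: measurable_funM.
- apply/measurable_EFinP; apply: measurable_funX; apply: measurable_funB => //.
  by apply: measurable_sum => m; apply: measurable_funM => //.
apply: filterS allm => w h _; congr ((_ - _) ^+ 2)%:E.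
by apply: eq_bigr => m _; rewrite h mulrA.
Qed.

End Process.

Variables (alpha1 alpha2 lambda1 lambda2 : R) (E0 S0 T0 : R -> R -> R)
  (E S T : R -> Omega -> R -> R -> R).
Hypothesis sol : dg_solution P F e gamma B M k tmax alpha1 alpha2 lambda1 lambda2
  E0 S0 T0 E S T.
Variable t : R.
Hypotheses (t0 : 0 <= t) (tt : t <= tmax).

Let tm0 : 0 <= tmax. Proof. exact: le_trans tt. Qed.

(** The coordinates of [E], [S] and [T], in this order. *)
Notation I := ((Ix * Iy) + ((Ix * Iy) + (Ix * Iy)))%type.

Definition by_field (A : Type) (aE aS aT : A) (q : I) : A :=
  match q with inl _ => aE | inr (inl _) => aS | inr (inr _) => aT end.

Definition position (q : I) : Ix * Iy :=
  match q with inl xy => xy | inr (inl xy) => xy | inr (inr xy) => xy end.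

Definition dg_matrix (q r : I) : R :=
  match q, r with
  | inl (x, y), inr (inl (x', y')) =>
      (x == x')%:R * stencil (ylo D) (- alpha2) y y'
  | inr (inl (x, y)), inl (x', y') => (x == x')%:R * stencil (ylo D) alpha2 y y'
  | inl (x, y), inr (inr (x', y')) =>
      - ((y == y')%:R * stencil (xlo D) alpha1 x x')
  | inr (inr (x, y)), inl (x', y') =>
      - ((y == y')%:R * stencil (xlo D) (- alpha1) x x')
  | _, _ => 0
  end.

(** The two equations that couple a pair of fields use opposite flux
    parameters, as [stencil_antisym] requires. *)
Lemma dg_matrix_antisym q r : dg_matrix q r + dg_matrix r q = 0.
Proof.
have ax a x x' := stencil_antisym (xs_partition M) (k := k) a x x'.
have ay a y y' := stencil_antisym (ys_partition M) (k := k) a y y'.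
case: q r => [[x y]|[[x y]|[x y]]] [[x' y']|[[x' y']|[x' y']]] /=; rewrite ?addr0//.
- by rewrite (eq_sym x') -mulrDr -[X in stencil _ X y' y]opprK ay mulr0.
- by rewrite (eq_sym y') -opprD -mulrDr ax mulr0 oppr0.
- by rewrite (eq_sym x') -mulrDr ay mulr0.
- by rewrite (eq_sym y') -opprD -mulrDr -[X in stencil _ X x' x]opprK ax mulr0 oppr0.
Qed.

Definition zc (q : I) (s : R) (w : Omega) : R :=
  cell_coord (by_field E S T q (clamp tmax s) w) (position q).1 (position q).2.

Definition zc0 (q : I) : R :=
  cell_coord (by_field E0 S0 T0 q) (position q).1 (position q).2.

Definition noise_coef (q : I) (m : nat) : R :=
  by_field (- lambda1) lambda2 lambda2 q *
  cell_coord (e m) (position q).1 (position q).2.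

Lemma field_process q :
  dg_process F M k tmax (by_field E0 S0 T0 q) (by_field E S T q).
Proof.
by case: q => [?|[?|?]] /=; [exact: dg_E sol|exact: dg_S sol|exact: dg_T sol].
Qed.

Lemma sum_index (f : I -> R) : \sum_q f q = \sum_x \sum_y f (inl (x, y)) +
  (\sum_x \sum_y f (inr (inl (x, y))) + \sum_x \sum_y f (inr (inr (x, y)))).
Proof.
rewrite !big_sumType/= !pair_bigA/=.
by congr (_ + (_ + _)); apply: eq_bigr => -[].
Qed.

Lemma sum_deltal (I1 I2 : finType) (i : I1) (f : I1 -> I2 -> R) :
  \sum_x \sum_y (i == x)%:R * f x y = \sum_y f i y.
Proof.
rewrite (bigD1 i)//= [X in _ + X]big1 ?addr0.
  by apply: eq_bigr => y _; rewrite eqxx mul1r.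
by move=> x xi; rewrite big1// => y _; rewrite eq_sym (negbTE xi) mul0r.
Qed.

Lemma dg_space_at (q : I) (s : R) w : dg_space M k (by_field E S T q (clamp tmax s) w).
Proof. exact: (dgp_space (field_process q) _ (clamp_itv tm0 s)). Qed.

Lemma driftE x y s w :
  (drift zc dg_matrix (inl (x, y)) s w =
    - (\int[leb]_(v in ycell M y.1)
         formI M x.1 (T (clamp tmax s) w) (psi x y) alpha1 v)
    + \int[leb]_(u in xcell M x.1)
         formJ M y.1 (S (clamp tmax s) w) (psi x y) (- alpha2) u) /\
  (drift zc dg_matrix (inr (inl (x, y))) s w =
    \int[leb]_(u in xcell M x.1)
         formJ M y.1 (E (clamp tmax s) w) (psi x y) alpha2 u) /\
  (drift zc dg_matrix (inr (inr (x, y))) s w =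
    - (\int[leb]_(v in ycell M y.1)
         formI M x.1 (E (clamp tmax s) w) (psi x y) (- alpha1) v)).
Proof.
have dE := dg_space_at (inl (x, y)) s w.
have dS := dg_space_at (inr (inl (x, y))) s w.
have dT := dg_space_at (inr (inr (x, y))) s w.
rewrite /= in dE dS dT.
have z0s (h : I -> R) : (\sum_x \sum_y 0 * zc (inl (x, y)) s w = 0 :> R).
  by rewrite big1// => x' _; rewrite big1// => y' _; rewrite mul0r.
rewrite !Rintegral_formI// !Rintegral_formJ// /drift !sum_index/=.
have n0 (f : Ix -> Iy -> R) : \sum_x \sum_y 0 * f x y = 0.
  by rewrite big1// => x' _; rewrite big1// => y' _; rewrite mul0r.
have dx (f : Ix -> Iy -> R) (c : Iy -> R) :
    \sum_x' \sum_y' (x == x')%:R * c y' * f x' y' = \sum_y' c y' * f x y'.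
  rewrite -(sum_deltal x (fun x' y' => c y' * f x' y')).
  by apply: eq_bigr => x' _; apply: eq_bigr => y' _; rewrite mulrA.
have dy (f : Ix -> Iy -> R) (c : Ix -> R) :
    \sum_x' \sum_y' - ((y == y')%:R * c x') * f x' y' = - \sum_x' c x' * f x' y.
  rewrite exchange_big/= -(sum_deltal y (fun y' x' => c x' * f x' y')) -sumrN.
  apply: eq_bigr => y' _; rewrite -sumrN; apply: eq_bigr => x' _.
  by rewrite mulNr mulrA.
split; [|split].
- rewrite (n0 (fun x y => zc (inl (x, y)) s w)) add0r addrC.
  rewrite (dx (fun x y => zc (inr (inl (x, y))) s w)).
  by rewrite (dy (fun x y => zc (inr (inr (x, y))) s w)).
- rewrite (n0 (fun x y => zc (inr (inl (x, y))) s w)).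
  rewrite (n0 (fun x y => zc (inr (inr (x, y))) s w)) !addr0.
  by rewrite (dx (fun x y => zc (inl (x, y)) s w)).
- rewrite (n0 (fun x y => zc (inr (inl (x, y))) s w)).
  rewrite (n0 (fun x y => zc (inr (inr (x, y))) s w)) !addr0.
  by rewrite (dy (fun x y => zc (inl (x, y)) s w)).
Qed.

Let G q m := Num.sqrt (gamma m) * noise_coef q m.

Lemma sqr_G q m : G q m ^+ 2 = by_field (lambda1 ^+ 2) (lambda2 ^+ 2) (lambda2 ^+ 2) q *
  (gamma m * cell_coord (e m) (position q).1 (position q).2 ^+ 2).
Proof.
rewrite /G /noise_coef 2!exprMn (sqr_sqrtr (gamma_ge0 hW m)) mulrCA; congr (_ * _).
by case: q => [|[]] ?; rewrite /= ?sqrrN.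
Qed.

Lemma cvg_sqr_G q : cvgn (series (fun m => G q m ^+ 2)).
Proof.
have ct : cvgn (series (fun m =>
    gamma m * cell_coord (e m) (position q).1 (position q).2 ^+ 2)).
  exact: (cvg_trace_term hW).
have -> : series (fun m => G q m ^+ 2) = (fun n =>
    by_field (lambda1 ^+ 2) (lambda2 ^+ 2) (lambda2 ^+ 2) q * series (fun m =>
      gamma m * cell_coord (e m) (position q).1 (position q).2 ^+ 2) n).
  apply/funext => n; rewrite /series/= mulr_sumr.
  by apply: eq_bigr => m _; rewrite sqr_G.
by apply: is_cvgM => //; exact: is_cvg_cst.
Qed.

(** The equation of [E] contributes [lambda1 ^+ 2], those of [S] and [T]
    contribute [lambda2 ^+ 2] each; signs disappear in the squares. *)
Lemma bracketE : \sum_q bracket G q =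
  (lambda1 ^+ 2 + 2 * lambda2 ^+ 2) * discrete_trace M k e gamma.
Proof.
have bE q : bracket G q = by_field (lambda1 ^+ 2) (lambda2 ^+ 2) (lambda2 ^+ 2) q *
    trace_term e gamma (position q).1 (position q).2.
  rewrite /bracket /trace_term -limn_seriesZ; last exact: (cvg_trace_term hW).
  by congr (limn (series _)); apply/funext => m; rewrite sqr_G.
rewrite (discrete_traceE hW) sum_index/=.
have h (f : Ix -> Iy -> I) c :
    (forall x y, bracket G (f x y) = c * trace_term e gamma x y) ->
    \sum_(x : Ix) \sum_(y : Iy) bracket G (f x y) =
    c * \sum_(x : Ix) \sum_(y : Iy) trace_term e gamma x y.
  move=> fc; rewrite mulr_sumr; apply: eq_bigr => x _.
  by rewrite mulr_sumr; apply: eq_bigr => y _; exact: fc.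
rewrite (h (fun x y => inl (x, y)) (lambda1 ^+ 2)); last by move=> x y; rewrite bE.
rewrite (h (fun x y => inr (inl (x, y))) (lambda2 ^+ 2)); last by move=> x y; rewrite bE.
by ring.
Qed.

Lemma coordinate_equation q s : 0 <= s -> s <= t -> exists N : Omega -> R,
  [/\ measurable_fun setT N,
    L2_cvg P (fun n w => \sum_(m < n) G q m * increment (B m) 0 s w) N &
    {ae P, forall w, zc q s w =
       zc0 q + \int[leb]_(r in `[0, s]) drift zc dg_matrix q r w + N w}].
Proof.
move=> s0 st; have sm := le_trans st tt.
have conv (dr : R -> Omega -> R) (c : R) :
    (forall r w, 0 <= r -> r <= tmax -> drift zc dg_matrix q r w = dr r w) ->
    (forall m, c * cell_coord (e m) (position q).1 (position q).2 = noise_coef q m) ->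
    cell_equation P F e gamma B M tmax (position q).1.1 (position q).2.1
      (by_field E S T q) (psi (position q).1 (position q).2) dr c ->
    exists N : Omega -> R, [/\ measurable_fun setT N,
    L2_cvg P (fun n w => \sum_(m < n) G q m * increment (B m) 0 s w) N &
    {ae P, forall w, zc q s w =
       zc0 q + \int[leb]_(r in `[0, s]) drift zc dg_matrix q r w + N w}].
  move=> drE cE eqn.
  have [N [mN cN eN]] := cell_equation_noise (field_process q) s0 sm eqn.
  exists N; split => //.
    apply: cvg_trans cN; apply: near_eq_cvg; apply: nearW => n.
    apply: eq_integral => w _; congr ((_ - _) ^+ 2)%:E.
    by apply: eq_bigr => m _; rewrite /G cE.
  apply: filterS eN => w eN; rewrite /zc eN; congr (_ + _ + _).
  apply: eq_Rintegral => r; rewrite inE/= in_itv/= => /andP[r0 rs].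
  by rewrite drE// (le_trans rs).
case: q conv => [[x y]|[[x y]|[x y]]] /= conv.
- apply: (conv _ (- lambda1)) _ _ (dg_eqE sol _ _ (psi_dg x y)) => // r w r0 rt.
  by rewrite (driftE x y r w).1 !clamp_id.
- apply: (conv _ lambda2) _ _ (dg_eqS sol _ _ (psi_dg x y)) => // r w r0 rt.
  by rewrite (driftE x y r w).2.1 !clamp_id.
- apply: (conv _ lambda2) _ _ (dg_eqT sol _ _ (psi_dg x y)) => // r w r0 rt.
  by rewrite (driftE x y r w).2.2 !clamp_id.
Qed.

Lemma is_ito_eq (b : R -> Omega -> R) (X Y : R -> Omega -> R) (J : Omega -> R) :
  (forall s w, 0 <= s -> s <= t -> X s w = Y s w) ->
  is_ito P F b X t J -> is_ito P F b Y t J.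
Proof.
move=> XY [mX aX mJ [H [cH IH]]]; split => //.
- apply: eq_measurable_fun mX => -[s w]; rewrite inE => -[/= + _].
  by rewrite in_itv/= => /andP[s0 st]; rewrite XY.
- move=> s si; have -> : Y s = X s; last exact: aX.
  by apply/funext => w; move: si; rewrite in_itv/= => /andP[s0 st]; rewrite XY.
- exists H; split; last exact: IH.
  apply: cvg_trans cH; apply: near_eq_cvg.
  apply: nearW => n; apply: eq_integral => w _; apply: eq_integral => s.
  by rewrite inE/= in_itv/= => /andP[s0 st]; rewrite XY.
Qed.

Lemma energy_coordE s w : 0 <= s -> s <= tmax -> \sum_q zc q s w ^+ 2 =
  L2norm D (E s w) ^+ 2 + L2norm D (S s w) ^+ 2 + L2norm D (T s w) ^+ 2.
Proof.
move=> s0 st; have si : s \in `[0, tmax] by rewrite in_itv/= s0.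
rewrite sum_index /zc/= clamp_id// addrA.
rewrite (L2norm_coord (dgp_space (dg_E sol) w si)).
rewrite (L2norm_coord (dgp_space (dg_S sol) w si)).
by rewrite (L2norm_coord (dgp_space (dg_T sol) w si)).
Qed.

Lemma initial_coordE (w : Omega) : \sum_q zc0 q ^+ 2 =
  L2norm D E0 ^+ 2 + L2norm D S0 ^+ 2 + L2norm D T0 ^+ 2.
Proof.
rewrite -(dgp_init (dg_E sol) w) -(dgp_init (dg_S sol) w) -(dgp_init (dg_T sol) w).
rewrite -energy_coordE//; apply: eq_bigr => q _; congr (_ ^+ 2).
rewrite /zc0 /zc clamp_id//; congr cell_coord.
by have := dgp_init (field_process q) w.
Qed.

Lemma noise_sourceE m s w : 0 <= s -> s <= t ->
  \sum_q noise_coef q m * zc q s w =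
  int2 (xside D) (yside D) (fun x y =>
    (lambda2 * (T s w x y + S s w x y) - lambda1 * E s w x y) * e m x y).
Proof.
move=> s0 st; have sm := le_trans st tt.
have si : s \in `[0, tmax] by rewrite in_itv/= s0.
have se := basis_sqi hW m; have mD := measurable_domain (D := D).
have ip (q : I) : itg leb2 (domain D)
    (fun z => by_field E S T q s w z.1 z.2 * e m z.1 z.2).
  exact: (sqiM_itg mD (dg_sqi (dgp_space (field_process q) w si)) se).
have ie (q : I) :
    \int[leb2]_(z in domain D) (by_field E S T q s w z.1 z.2 * e m z.1 z.2) =
    \sum_(x : Ix) \sum_(y : Iy)
      cell_coord (by_field E S T q s w) x y * cell_coord (e m) x y.
  exact: (inner_coord (dgp_space (field_process q) w si) se).
have x0 : 'I_(Nx M).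
  exact: (Ordinal (size_mesh_gt0 (xlo_lt_xhi D) (xs_partition M))).
have y0 : 'I_(Ny M).
  exact: (Ordinal (size_mesh_gt0 (ylo_lt_yhi D) (ys_partition M))).
(* [inl xy], [inr (inl xy)] and [inr (inr xy)] stand for the fields [E], [S]
   and [T]. *)
pose xy : Ix * Iy := ((x0, ord0), (y0, ord0)).
have [iE iS iT] := And3 (ip (inl xy)) (ip (inr (inl xy))) (ip (inr (inr xy))).
have [eE eS eT] := And3 (ie (inl xy)) (ie (inr (inl xy))) (ie (inr (inr xy))).
rewrite /= in iE iS iT eE eS eT.
transitivity (\int[leb2]_(z in domain D) (lambda2 * (T s w z.1 z.2 * e m z.1 z.2 +
    S s w z.1 z.2 * e m z.1 z.2) - lambda1 * (E s w z.1 z.2 * e m z.1 z.2))).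
  rewrite (RintB mD); [|by apply: (itgZ mD); exact: itgD|exact: itgZ].
  rewrite (RintZ mD); last exact: itgD.
  rewrite (RintZ mD)// (RintD mD)// eE eS eT sum_index /noise_coef /zc/= clamp_id//.
  have h (f : Ix -> Iy -> R) (c : R) :
      \sum_(x : Ix) \sum_(y : Iy) c * cell_coord (e m) x y * f x y =
      c * \sum_(x : Ix) \sum_(y : Iy) f x y * cell_coord (e m) x y.
    rewrite mulr_sumr; apply: eq_bigr => x _; rewrite mulr_sumr.
    by apply: eq_bigr => y _; ring.
  rewrite (h (cell_coord (E s w))) (h (cell_coord (S s w))).
  by rewrite (h (cell_coord (T s w))); ring.
by apply: eq_Rintegral => z _; ring.
Qed.

Theorem scheme_energy_law : let K := discrete_trace M k e gamma in
  (exists I : Omega -> R,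
    is_dW_integral P F e gamma B (xside D) (yside D)
      (fun s w x y => lambda2 * (T s w x y + S s w x y) - lambda1 * E s w x y) t I /\
    {ae P, forall w,
      L2norm D (E t w) ^+ 2 + L2norm D (S t w) ^+ 2 + L2norm D (T t w) ^+ 2
      = 2 * I w
        + L2norm D E0 ^+ 2 + L2norm D S0 ^+ 2 + L2norm D T0 ^+ 2
        + (lambda1 ^+ 2 + 2 * lambda2 ^+ 2) * K * t}) /\
  ('E_P[fun w => (L2norm D (E t w) ^+ 2 + L2norm D (S t w) ^+ 2
                  + L2norm D (T t w) ^+ 2)%R]
   = (L2norm D E0 ^+ 2 + L2norm D S0 ^+ 2 + L2norm D T0 ^+ 2
      + (lambda1 ^+ 2 + 2 * lambda2 ^+ 2) * K * t)%:E)%E.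
Proof.
move=> K.
have cz (q : I) w : continuous (zc q ^~ w).
  exact: (continuous_coord (field_process q) tm0).
have az (q : I) s : 0 <= s -> measurable_wrt (F s) (zc q s).
  exact: (adapted_coord (field_process q) tm0).
have mz (q : I) s : measurable_fun setT (zc q s).
  exact: (measurable_coord (field_process q) tm0).
have zi (q : I) w : zc q 0 w = zc0 q.
  rewrite /zc /zc0 clamp_id//; congr cell_coord.
  exact: (dgp_init (field_process q) w).
have anti := antisym_form0 dg_matrix_antisym.
have GE q m : G q m = Num.sqrt (gamma m) * noise_coef q m by [].
have [J [itoJ cJ EJ0 en]] := energy_identity hF hB t0 cz az mz zi cvg_sqr_G
  coordinate_equation anti GE.
have iE := itg_energy hF hB t0 cz mz zi cvg_sqr_G coordinate_equation.
set I := energy_martingale t zc zc0 G in cJ EJ0 en iE.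
have enL w : L2norm D (E t w) ^+ 2 + L2norm D (S t w) ^+ 2 + L2norm D (T t w) ^+ 2 =
    2 * I w + (L2norm D E0 ^+ 2 + L2norm D S0 ^+ 2 + L2norm D T0 ^+ 2) +
    (lambda1 ^+ 2 + 2 * lambda2 ^+ 2) * K * t.
  by rewrite -energy_coordE// en (initial_coordE w) bracketE.
split.
  exists I; split; last by apply: nearW => w; rewrite enL !addrA.
  split; first exact: itg_meas iE.
  exists J; split; last exact: cJ.
  move=> m.
  by apply: is_ito_eq (itoJ m) => s w s0 st; exact: noise_sourceE.
rewrite unlock.
pose c0 := L2norm D E0 ^+ 2 + L2norm D S0 ^+ 2 + L2norm D T0 ^+ 2.
pose c1 := (lambda1 ^+ 2 + 2 * lambda2 ^+ 2) * K * t.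
transitivity (\int[P]_w (2 * I w + (c0 + c1))%:E)%E.
  by apply: eq_integral => w _; rewrite enL -addrA.
have fP : (P setT < +oo)%E by rewrite probability_setT ltry.
have i2 : itg P setT (fun w => 2 * I w) by exact: itgZ.
have ic : itg P setT (fun=> c0 + c1) by exact: itg_cst.
rewrite (EFin_Rintegral mT); last exact: itgD.
rewrite (RintD mT)// (RintZ mT)// EJ0 mulr0 add0r Rint_cst_prob.
by [].
Qed.

End Scheme_energy_law.

(** * Upper bound and convergence of the discrete trace *)

Section Mean_value.
Context {R : realType}.

Lemma itvoo_seg (a b x y z : R) : x \in `]a, b[ -> y \in `]a, b[ ->
  z \in `[x, y] -> z \in `]a, b[.
Proof.
rewrite !in_itv/= => /andP[ax _] /andP[_ yb] /andP[xz zy].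
by rewrite (lt_le_trans ax xz)// (le_lt_trans zy yb).
Qed.

Lemma lipschitz_itvoo (f : R -> R) (a b G : R) :
  (forall x, x \in `]a, b[ -> derivable f x 1) ->
  (forall x, x \in `]a, b[ -> `|f^`()%classic x| <= G) ->
  forall x y, x \in `]a, b[ -> y \in `]a, b[ -> `|f y - f x| <= G * `|y - x|.
Proof.
move=> df dG x y.
wlog xy : x y / x <= y => [h|] xi yi.
  have [xy|/ltW yx] := leP x y; first exact: h.
  by rewrite distrC [X in _ * X]distrC; exact: h.
have sub z : z \in `[x, y] -> z \in `]a, b[ by exact: itvoo_seg.
have dfz z : z \in `]x, y[ -> is_derive z 1 f (f^`()%classic z).
  move=> zi; rewrite derive1E; apply: derivableP; apply: df; apply: sub.
  exact: subset_itv_oo_cc.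
have cf : {within `[x, y], continuous f}.
  by apply: derivable_within_continuous => z zi; apply: df; exact: sub.
have [c ci ->] := MVT_segment xy dfz cf.
by rewrite normrM ler_wpM2r// dG// sub.
Qed.

End Mean_value.

Section Projection_defect.
Context {R : realType} {D : rectangle R}.
Variables (M : mesh D) (k : nat).
Notation Ix := ('I_(Nx M) * 'I_k.+1)%type.
Notation Iy := ('I_(Ny M) * 'I_k.+1)%type.
Implicit Types (f : R -> R -> R).

Lemma dg_space_cst (c : R) : dg_space M k (fun _ _ => c).
Proof.
split; first exact: measurable_cst.
move=> i j; exists (\matrix_(p, q) (c * ((p == ord0) && (q == ord0))%:R)).
move=> x y _ _; rewrite (bigD1 ord0)//= [X in _ = _ + X]big1 ?addr0; last first.
  by move=> p /negbTE p0; rewrite big1// => q _; rewrite mxE p0 !(mulr0, mul0r).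
rewrite (bigD1 ord0)//= [X in _ = _ + X]big1 ?addr0; last first.
  by move=> q /negbTE q0; rewrite mxE q0 andbF !(mulr0, mul0r).
by rewrite mxE !eqxx !expr0 !mulr1.
Qed.

(** The left-hand side is the squared distance of [f] to its projection, which
    is the closest element of the discrete space, and constants belong to that
    space. *)
Lemma cell_defect f (c : R) (i : 'I_(Nx M)) (j : 'I_(Ny M)) :
  sqi leb2 (domain D) (fun z => f z.1 z.2) ->
  int2 (xcell M i) (ycell M j) (fun x y => f x y * f x y)
    - \sum_p \sum_q cell_coord (k := k) f (i, p) (j, q) ^+ 2 <=
  int2 (xcell M i) (ycell M j) (fun x y => (f x y - c) ^+ 2).
Proof.
move=> sfD; have mij := measurable_cells M i j.
have dc := dg_space_cst c.
have sf : sqi leb2 (xcell M i `*` ycell M j) (fun z => f z.1 z.2).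
  exact: sqi_cell (ltn_ord i) (ltn_ord j) sfD.
have sc : sqi leb2 (xcell M i `*` ycell M j) (fun=> c).
  exact: (@sqi_cell R D M i j (fun _ _ => c) (ltn_ord i) (ltn_ord j) (dg_sqi dc)).
have ecf := inner_expansion (dg_expand dc) sf.
have ecc := inner_expansion (f := fun _ _ => c) (dg_expand (i := i) (j := j) dc) sc.
have iff := sqiM_itg mij sf sf.
have icf := sqiM_itg mij sc sf.
have icc := sqiM_itg mij sc sc.
have -> : int2 (xcell M i) (ycell M j) (fun x y => (f x y - c) ^+ 2) =
    int2 (xcell M i) (ycell M j) (fun x y => f x y * f x y)
    - 2 * int2 (xcell M i) (ycell M j) (fun x y => c * f x y)
    + int2 (xcell M i) (ycell M j) (fun x y => c * c).
  rewrite /int2 -(RintZ mij)//.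
  rewrite -(RintB mij)//; last exact: itgZ.
  rewrite -(RintD mij)//; last by apply: (itgB mij) => //; exact: itgZ.
  by apply: eq_Rintegral => z _; ring.
rewrite ecf ecc -subr_ge0.
set I := int2 _ _ _; set a := fun p q => cell_coord (k := k) f (i, p) (j, q).
set b := fun p q => cell_coord (k := k) (fun _ _ => c) (i, p) (j, q).
suff -> : I - 2 * (\sum_p \sum_q b p q * a p q) + \sum_p \sum_q b p q * b p q
    - (I - \sum_p \sum_q a p q ^+ 2) = \sum_p \sum_q (a p q - b p q) ^+ 2.
  by apply: sumr_ge0 => p _; apply: sumr_ge0 => q _; exact: sqr_ge0.
have -> : \sum_p \sum_q (a p q - b p q) ^+ 2 =
    \sum_p \sum_q a p q ^+ 2 - 2 * (\sum_p \sum_q b p q * a p q)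
    + \sum_p \sum_q b p q * b p q.
  rewrite mulr_sumr -sumrB -big_split/=; apply: eq_bigr => p _.
  rewrite mulr_sumr -sumrB -big_split/=; apply: eq_bigr => q _.
  by ring.
by ring.
Qed.

Lemma xwidth_le i : (i < Nx M)%N -> width (xlo D) (xs M) i <= mesh_size M.
Proof.
move=> iN; rewrite /mesh_size le_max; apply/orP; left.
exact: (le_bigmax 0 (fun i : 'I_(Nx M) => width (xlo D) (xs M) i) (Ordinal iN)).
Qed.

Lemma ywidth_le j : (j < Ny M)%N -> width (ylo D) (ys M) j <= mesh_size M.
Proof.
move=> jN; rewrite /mesh_size le_max; apply/orP; right.
exact: (le_bigmax 0 (fun j : 'I_(Ny M) => width (ylo D) (ys M) j) (Ordinal jN)).
Qed.

Lemma mesh_size_ge0 : 0 <= mesh_size M.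
Proof. by rewrite /mesh_size le_max; apply/orP; left; exact: bigmax_ge_id. Qed.

Lemma dist_itvoo (a b x y : R) : x \in `]a, b[ -> y \in `]a, b[ ->
  `|y - x| <= b - a.
Proof.
rewrite !in_itv/= => /andP[ax xb] /andP[ay yb].
by rewrite ler_distlC; apply/andP; split; lra.
Qed.

Definition area : R := int2 (xside D) (yside D) (fun _ _ => 1).

Lemma area_ge0 : 0 <= area.
Proof. by apply: Rintegral_ge0 => z _; exact: ler01. Qed.

Lemma itg_cstD (c : R) : itg leb2 (domain D) (fun=> c).
Proof.
have [_ h] := dg_sqi (dg_space_cst 1).
have := itgZ measurable_domain c h; apply: (itg_eq measurable_domain) => z _.
by rewrite expr1n mulr1.
Qed.

(** On each cell, [f] is compared with its value at the midpoint; a path along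
    the axes from there moves by at most [mesh_size M] in each direction. *)
Lemma defect_le f (G : R) : sqi leb2 (domain D) (fun z => f z.1 z.2) ->
  has_partials D f ->
  (forall x y, x \in `]xlo D, xhi D[ -> y \in `]ylo D, yhi D[ ->
    `|(fun x' => f x' y)^`()%classic x| <= G /\ `|(f x)^`()%classic y| <= G) ->
  inner D f f - \sum_(x : Ix) \sum_(y : Iy) cell_coord f x y ^+ 2 <=
    4 * area * mesh_size M ^+ 2 * G ^+ 2.
Proof.
move=> sf pf dG; set h := mesh_size M.
have h0 : 0 <= h := mesh_size_ge0.
rewrite /inner (int2_cells M); last exact: (sqiM_itg measurable_domain sf sf).
rewrite -(sum_pairs (fun x y => cell_coord f x y ^+ 2)).
have -> : 4 * area * h ^+ 2 * G ^+ 2 =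
    int2 (xside D) (yside D) (fun _ _ => 4 * h ^+ 2 * G ^+ 2).
  transitivity (4 * h ^+ 2 * G ^+ 2 * area); first by ring.
  rewrite /area /int2 -(RintZ measurable_domain); last exact: itg_cstD.
  by apply: eq_Rintegral => z _; rewrite mulr1.
rewrite [X in _ <= X](int2_cells M); last exact: itg_cstD.
rewrite -sumrB; apply: ler_sum => i _.
rewrite -sumrB; apply: ler_sum => j _.
have mij := measurable_cells M i j.
have xlt : node (xlo D) (xs M) i < node (xlo D) (xs M) i.+1.
  exact: (node_lt (xs_partition M)).
have ylt : node (ylo D) (ys M) j < node (ylo D) (ys M) j.+1.
  exact: (node_lt (ys_partition M)).
pose x0 := (node (xlo D) (xs M) i + node (xlo D) (xs M) i.+1) / 2.
pose y0 := (node (ylo D) (ys M) j + node (ylo D) (ys M) j.+1) / 2.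
have x0i : xcell M i x0 by rewrite /xcell /cell/= in_itv/= midf_lt// midf_lt.
have y0j : ycell M j y0 by rewrite /ycell /cell/= in_itv/= midf_lt// midf_lt.
apply: le_trans (cell_defect (f x0 y0) i j sf) _.
have sfc : sqi leb2 (xcell M i `*` ycell M j) (fun z => f z.1 z.2).
  exact: sqi_cell (ltn_ord i) (ltn_ord j) sf.
have scc c : sqi leb2 (xcell M i `*` ycell M j) (fun=> c).
  exact: (@sqi_cell R D M i j (fun _ _ => c) (ltn_ord i) (ltn_ord j)
    (dg_sqi (dg_space_cst c))).
apply: (le_Rint mij).
- by have [] := sqiB mij sfc (scc (f x0 y0)).
- have [_] := scc 1 => ic; have := itgZ mij (4 * h ^+ 2 * G ^+ 2) ic.
  by apply: (itg_eq mij) => z _; rewrite expr1n mulr1.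
move=> [x y] [/= xi yj].
have xD : x \in `]xlo D, xhi D[ := cell_sub_open (xs_partition M) (ltn_ord i) xi.
have yD : y \in `]ylo D, yhi D[ := cell_sub_open (ys_partition M) (ltn_ord j) yj.
have x0D : x0 \in `]xlo D, xhi D[ := cell_sub_open (xs_partition M) (ltn_ord i) x0i.
have y0D : y0 \in `]ylo D, yhi D[ := cell_sub_open (ys_partition M) (ltn_ord j) y0j.
have G0 : 0 <= G by have [+ _] := dG x y xD yD; exact: le_trans.
have lx : `|f x y - f x0 y| <= G * h.
  apply: le_trans (lipschitz_itvoo (f := fun x' => f x' y) (a := xlo D)
    (b := xhi D) (G := G) _ _ x0D xD) _.
  - by move=> x' x'D; exact: (pf x' y x'D yD).1.
  - by move=> x' x'D; exact: (dG x' y x'D yD).1.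
  rewrite ler_wpM2l//; apply: le_trans (xwidth_le (ltn_ord i)).
  exact: dist_itvoo.
have ly : `|f x0 y - f x0 y0| <= G * h.
  apply: le_trans (lipschitz_itvoo (f := f x0) (a := ylo D)
    (b := yhi D) (G := G) _ _ y0D yD) _.
  - by move=> y' y'D; exact: (pf x0 y' x0D y'D).2.
  - by move=> y' y'D; exact: (dG x0 y' x0D y'D).2.
  rewrite ler_wpM2l//; apply: le_trans (ywidth_le (ltn_ord j)).
  exact: dist_itvoo.
have le2 : `|f x y - f x0 y0| <= 2 * (G * h).
  have -> : f x y - f x0 y0 = (f x y - f x0 y) + (f x0 y - f x0 y0) by ring.
  by apply: le_trans (ler_normD _ _) _; lra.
have -> : 4 * h ^+ 2 * G ^+ 2 = (2 * (G * h)) ^+ 2 by ring.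
by rewrite -real_normK ?num_real// lerXn2r// nnegrE mulr_ge0// mulr_ge0.
Qed.

End Projection_defect.

Section Interpolation.
Context {R : realType}.

Lemma le_powR_min (u a alpha : R) : 0 <= u -> 0 < alpha -> alpha <= 2 ->
  a <= 1 -> a <= u ^+ 2 -> a <= u `^ alpha.
Proof.
move=> u0 al0 al2 a1 au.
have [u1|/ltW u1] := leP u 1; last first.
  by apply: (le_trans a1); rewrite -(powRr0 u) ler_powR// ltW.
apply: (le_trans au); rewrite -powR_mulrn//.
have [->|un0] := eqVneq u 0; first by rewrite !powR0 ?gt_eqF.
by apply: ger_powR => //; rewrite u1 andbT lt0r un0.
Qed.

(** For [alpha <= 2] this is the geometric interpolation between the two
    bounds. For [alpha > 2] the second bound is used as it stands, with
    [G ^+ 2 <= 1 + G `^ alpha]. *)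
Lemma interpolate (A h G a alpha : R) : 0 <= A -> 0 <= h -> 0 <= G ->
  0 < alpha -> a <= 1 -> a <= A * h ^+ 2 * G ^+ 2 ->
  a <= (Num.sqrt A `^ alpha + A) * h `^ Num.min alpha 2 * (1 + G `^ alpha).
Proof.
move=> A0 h0 G0 al0 a1 ah.
have p0 := powR_ge0 (Num.sqrt A) alpha.
have q0 := powR_ge0 G alpha.
have [al2|al2] := leP alpha 2.
- have : a <= (Num.sqrt A * h * G) `^ alpha.
    apply: le_powR_min => //; first by rewrite !mulr_ge0 ?sqrtr_ge0.
    by rewrite 2!exprMn sqr_sqrtr.
  rewrite powRM ?mulr_ge0 ?sqrtr_ge0// powRM ?sqrtr_ge0// => /le_trans; apply.
  have r0 := powR_ge0 h alpha.
  apply: ler_pM => //; first by rewrite mulr_ge0.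
    by rewrite ler_wpM2r// lerDl.
  by rewrite lerDr.
- rewrite (powR_mulrn 2 h0); apply: (le_trans ah).
  apply: ler_pM => //; rewrite ?mulr_ge0 ?sqr_ge0//.
    by rewrite ler_wpM2r ?sqr_ge0// lerDr.
  have [G1|/ltW G1] := leP G 1.
    by rewrite (@le_trans _ _ 1) ?lerDl// expr_le1.
  rewrite -powR_mulrn// (@le_trans _ _ (G `^ alpha)) ?lerDr//.
  by rewrite ler_powR// ltW.
Qed.

End Interpolation.

Section Trace_approximation.
Context {R : realType} {D : rectangle R} {d : measure_display}
  {Omega : measurableType d}.
Variables (P : probability Omega R) (F : R -> set (set Omega)).
Variables (Q : (R -> R -> R) -> R -> R -> R).
Variables (e : nat -> R -> R -> R) (gamma : nat -> R)
  (B : nat -> R -> Omega -> R).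
Hypothesis hW : Q_wiener D P F Q e gamma B.

Section Fixed_mesh.
Variables (M : mesh D) (k : nat).
Notation Ix := ('I_(Nx M) * 'I_k.+1)%type.
Notation Iy := ('I_(Ny M) * 'I_k.+1)%type.

(** The squared norm of the projection of [e m] on the discrete space. *)
Definition mass m : R := \sum_(x : Ix) \sum_(y : Iy) cell_coord (e m) x y ^+ 2.

Lemma mass_ge0 m : 0 <= mass m.
Proof.
by apply: sumr_ge0 => x _; apply: sumr_ge0 => y _; exact: sqr_ge0.
Qed.

Lemma mass_le1 m : mass m <= 1.
Proof.
by rewrite -(basis_unit hW m); exact: (bessel M k (basis_sqi hW m)).
Qed.

Lemma cvg_mass : cvgn (series (fun m => gamma m * mass m)).
Proof.
apply: (series_le_cvg (v_ := gamma)).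
- by move=> m; rewrite mulr_ge0 ?(gamma_ge0 hW) ?mass_ge0.
- exact: (gamma_ge0 hW).
- by move=> m; rewrite ler_piMr ?(gamma_ge0 hW) ?mass_le1.
- exact: qw_trace hW.
Qed.

Lemma discrete_trace_mass :
  discrete_trace M k e gamma = limn (series (fun m => gamma m * mass m)).
Proof.
rewrite (discrete_traceE hW); symmetry; apply: cvg_lim => //.
have -> : series (fun m => gamma m * mass m) = fun n => \sum_(x : Ix) \sum_(y : Iy)
    series (fun m => gamma m * cell_coord (e m) x y ^+ 2) n.
  apply/funext => n; rewrite /series/=.
  under eq_bigr do rewrite /mass mulr_sumr.
  rewrite exchange_big/=; apply: eq_bigr => x _.
  under eq_bigr do rewrite mulr_sumr.
  by rewrite exchange_big.
apply: cvg_sumr => x; apply: cvg_sumr => y.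
exact: (cvg_trace_term hW).
Qed.

Lemma discrete_trace_le : discrete_trace M k e gamma <= limn (series gamma).
Proof.
rewrite discrete_trace_mass; apply: lim_series_le; [exact: cvg_mass|exact: qw_trace hW|].
by move=> m; rewrite ler_piMr ?(gamma_ge0 hW) ?mass_le1.
Qed.

Lemma trace_ge0 : 0 <= limn (series gamma).
Proof.
apply: limr_ge; first exact: qw_trace hW.
by apply: nearW => n; apply: sumr_ge0 => m _; exact: (gamma_ge0 hW).
Qed.

Lemma discrete_trace_bound : (0 < k)%N ->
  discrete_trace M k e gamma <= (k ^ 2 + 2 * k)%:R * limn (series gamma).
Proof.
move=> k0; apply: le_trans discrete_trace_le _.
by rewrite ler_peMl ?trace_ge0// ler1n; lia.
Qed.

End Fixed_mesh.

Lemma partials_le (f : R -> R -> R) : (sup_grad D f < +oo)%E ->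
  exists2 G, 0 <= G & sup_grad D f = G%:E /\
  forall x y, x \in `]xlo D, xhi D[ -> y \in `]ylo D, yhi D[ ->
    `|(fun x' => f x' y)^`()%classic x| <= G /\ `|(f x)^`()%classic y| <= G.
Proof.
move=> fin.
pose gr x y := Num.sqrt (((fun x' => f x' y)^`()%classic x) ^+ 2
                       + ((f x)^`()%classic y) ^+ 2).
have ub x y : x \in `]xlo D, xhi D[ -> y \in `]ylo D, yhi D[ ->
    ((gr x y)%:E <= sup_grad D f)%E.
  by move=> xD yD; apply: ereal_sup_ubound; exists x, y; split.
have mx : (xlo D + xhi D) / 2 \in `]xlo D, xhi D[.
  by rewrite in_itv/= !midf_lt ?xlo_lt_xhi.
have my : (ylo D + yhi D) / 2 \in `]ylo D, yhi D[.
  by rewrite in_itv/= !midf_lt ?ylo_lt_yhi.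
have ge0 : (0 <= sup_grad D f)%E.
  by apply: le_trans (ub _ _ mx my); rewrite lee_fin sqrtr_ge0.
have fn : sup_grad D f \is a fin_num by rewrite ge0_fin_numE.
exists (fine (sup_grad D f)); first exact: fine_ge0.
split; first by rewrite fineK.
move=> x y xD yD; have := ub x y xD yD; rewrite -[X in (_ <= X)%E](fineK fn) lee_fin.
move=> h; split; apply: le_trans h; rewrite -sqrtr_sqr /gr ler_wsqrtr//.
  by rewrite lerDl sqr_ge0.
by rewrite lerDr sqr_ge0.
Qed.

Lemma discrete_trace_cvg (k : nat) (alpha : R) : 0 < alpha ->
  (forall m, has_partials D (e m)) ->
  (\sum_(m <oo) (gamma m)%:E * (sup_grad D (e m) `^ alpha) < +oo)%E ->
  exists C, forall M : mesh D,
    `|discrete_trace M k e gamma - limn (series gamma)|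
      <= C * mesh_size M `^ Num.min alpha 2.
Proof.
move=> al0 pe fin.
have g0 := gamma_ge0 hW.
pose t m : \bar R := ((gamma m)%:E * (sup_grad D (e m) `^ alpha))%E.
have t0 m : (0 <= t m)%E by rewrite mule_ge0 ?lee_fin// poweR_ge0.
have part n : (\sum_(0 <= m < n) t m <= \sum_(m <oo) t m)%E.
  exact: nneseries_lim_ge.
have tfin m : (t m < +oo)%E.
  apply: le_lt_trans fin; apply: le_trans (part m.+1).
  by rewrite big_nat_recr//= leeDr// sume_ge0.
pose G m := fine (sup_grad D (e m)).
(* A function [e m] with unbounded gradient has weight [gamma m = 0], as the
   series would diverge otherwise. *)
have grad0 m : gamma m != 0 -> (sup_grad D (e m) < +oo)%E.
  move=> gm; rewrite ltey; apply/eqP => h; have := tfin m.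
  by rewrite /t h poweRyr ?gt_eqF// gt0_muley// lte_fin lt0r gm g0.
have tE m : (gamma m * G m `^ alpha)%:E = t m.
  have [gm|gm] := eqVneq (gamma m) 0; first by rewrite /t gm mul0r mul0e.
  have [Gm _ [hG _]] := partials_le (grad0 m gm).
  by rewrite /t /G hG.
have cS : cvgn (series (fun m => gamma m * G m `^ alpha)).
  apply: nondecreasing_is_cvgn.
    by apply: nondecreasing_series => m _ _; rewrite mulr_ge0 ?powR_ge0.
  exists (fine (\sum_(m <oo) t m)%E) => _ [n _ <-].
  rewrite -lee_fin fineK; last first.
    by rewrite ge0_fin_numE//; apply: nneseries_ge0.
  rewrite /series/= -sumEFin; under eq_bigr do rewrite tE.
  exact: part.
have cg := qw_trace hW.
pose A0 : R := 4 * area (D := D).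
have A00 : 0 <= A0 by rewrite mulr_ge0 ?area_ge0.
pose C1 := Num.sqrt A0 `^ alpha + A0.
have C10 : 0 <= C1 by rewrite addr_ge0// powR_ge0.
pose v m := gamma m + gamma m * G m `^ alpha.
have cv : cvgn (series v) by exact: is_cvg_seriesD.
exists (C1 * limn (series v)) => M.
set H := mesh_size M `^ Num.min alpha 2.
have H0 : 0 <= H by exact: powR_ge0.
have key m : gamma m - gamma m * mass M k m <= (C1 * H) * v m.
  have [gm|gm] := eqVneq (gamma m) 0.
    by rewrite /v gm !mul0r subr0 addr0 mulr0.
  have [Gm Gm0 [hG dG]] := partials_le (grad0 m gm).
  have -> : v m = gamma m * (1 + Gm `^ alpha) by rewrite /v /G hG/=; ring.
  have -> : gamma m - gamma m * mass M k m =
      gamma m * (1 - mass M k m) by ring.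
  rewrite mulrCA ler_wpM2l//; apply: interpolate => //.
  - exact: mesh_size_ge0.
  - by rewrite gerBl mass_ge0.
  - rewrite -{1}(basis_unit hW m).
    exact: (defect_le M k (basis_sqi hW m) (pe m) dG).
have cm : cvgn (series (fun m => gamma m * mass M k m)) by exact: cvg_mass.
rewrite distrC ger0_norm ?subr_ge0 ?discrete_trace_le//.
rewrite discrete_trace_mass.
have -> : limn (series gamma) - limn (series (fun m => gamma m * mass M k m)) =
    limn (series (fun m => gamma m - gamma m * mass M k m)).
  by rewrite -lim_seriesB.
rewrite mulrAC -limn_seriesZ//; apply: lim_series_le.
- exact: is_cvg_seriesB.
- exact: is_cvg_seriesZ.
- exact: key.
Qed.

End Trace_approximation.

Theorem theorem3p2 (R : realType) (D : rectangle R) (d : measure_display)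
  (Omega : measurableType d) (P : probability Omega R)
  (F : R -> set (set Omega)) (Q : (R -> R -> R) -> R -> R -> R)
  (e : nat -> R -> R -> R) (gamma : nat -> R) (B : nat -> R -> Omega -> R)
  (lambda1 lambda2 : R) (k : nat)
  (hF : filtration F) (hW : Q_wiener D P F Q e gamma B) :
  (* energy law *)
  (forall (M : mesh D) (alpha1 alpha2 tmax : R) (E0 S0 T0 : R -> R -> R)
      (E S T : R -> Omega -> R -> R -> R),
    dg_solution P F e gamma B M k tmax alpha1 alpha2 lambda1 lambda2
      E0 S0 T0 E S T ->
    let K := discrete_trace M k e gamma in
    forall t : R, t \in `[0, tmax] ->
      (exists I : Omega -> R,
         is_dW_integral P F e gamma B (xside D) (yside D)
           (fun s w x y => lambda2 * (T s w x y + S s w x y)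
                           - lambda1 * E s w x y) t I /\
         {ae P, forall w,
           L2norm D (E t w) ^+ 2 + L2norm D (S t w) ^+ 2 + L2norm D (T t w) ^+ 2
           = 2 * I w
             + L2norm D E0 ^+ 2 + L2norm D S0 ^+ 2 + L2norm D T0 ^+ 2
             + (lambda1 ^+ 2 + 2 * lambda2 ^+ 2) * K * t}) /\
      ('E_P[fun w => (L2norm D (E t w) ^+ 2 + L2norm D (S t w) ^+ 2
                      + L2norm D (T t w) ^+ 2)%R]
       = (L2norm D E0 ^+ 2 + L2norm D S0 ^+ 2 + L2norm D T0 ^+ 2
          + (lambda1 ^+ 2 + 2 * lambda2 ^+ 2) * K * t)%:E)%E) /\
  (* upper bound on K *)
  ((0 < k)%N -> forall M : mesh D,
     discrete_trace M k e gamma <= (k ^ 2 + 2 * k)%:R * limn (series gamma)) /\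
  (* convergence of K to the trace of Q *)
  (forall alpha : R, 0 < alpha ->
     (forall m, has_partials D (e m)) ->
     (\sum_(m <oo) (gamma m)%:E * (sup_grad D (e m) `^ alpha) < +oo)%E ->
     exists C h0 : R, 0 < h0 /\
       forall M : mesh D, mesh_size M <= h0 ->
         `|discrete_trace M k e gamma - limn (series gamma)|
           <= C * mesh_size M `^ Num.min alpha 2).
Proof.
split; [|split].
- move=> M alpha1 alpha2 tmax E0 S0 T0 E S T sol K t.
  rewrite in_itv/= => /andP[t0 tt].
  exact: (scheme_energy_law hF hW sol t0 tt).
- by move=> k0 M; exact: (discrete_trace_bound hW M k0).
- move=> alpha al0 pe fin.
  have [C hC] := discrete_trace_cvg hW k al0 pe fin.
  by exists C, 1; split => // M _; exact: hC.
Qed.
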